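(* Let $\Bbbk$ be an algebraically closed field of characteristic zero, let $J$ be the bosonization of the Jordan plane over the infinite cyclic group (presented in the context), and let $\Omega=x^2g^{-1}\in J$ (a central element of $J$). Then: (1) The prime spectrum of $J$ is $$\mathrm{Spec}(J)=\{\langle 0\rangle\}\cup\{\langle \Omega-\alpha\rangle\mid \alpha\in\Bbbk^*\}\cup\{\langle x,\mathfrak p\rangle\mid \mathfrak p\in \mathrm{Spec}(\Bbbk[g^{\pm1},y])\}.$$ The inclusions among these primes are as follows: $\langle 0\rangle$ is contained in every prime; each $\langle\Omega-\alpha\rangle$ ($\alpha\in\Bbbk^*$) properly contains only $\langle 0\rangle$ and is properly contained in no other prime; $\langle x\rangle\subset\langle x,\mathfrak p\rangle$ for every height-one prime $\mathfrak p$ of $\Bbbk[g^{\pm1},y]$; $\langle x,\mathfrak p\rangle\subset\langle x,g-\beta,y-\gamma\rangle$ (with $\mathfrak p$ of height one, $\beta\in\Bbbk^*$, $\gamma\in\Bbbk$) exactly when $\mathfrak p\subset (g-\beta,y-\gamma)$ in $\Bbbk[g^{\pm1},y]$; and there are no other proper inclusions apart from those obtained from these by transitivity. (2) The primitive spectrum of $J$ coincides with its maximal spectrum and is given by $$\mathrm{Prim}(J)=\mathrm{Max}(J)=\{\langle\Omega-\alpha\rangle\mid\alpha\in\Bbbk^*\}\cup\{\langle x,g-\beta,y-\gamma\rangle\mid \beta\in\Bbbk^*,\ \gamma\in\Bbbk\}.$$ (3) Every prime ideal of $J$ is completely prime. (4) Every nonzero (two-sided) ideal of $J$ intersects the centre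 $Z(J)$ nontrivially.
   Context: $\Bbbk^*=\Bbbk\setminus\{0\}$. $J$ is the associative unital $\Bbbk$-algebra generated by $g^{\pm1},x,y$ with defining relations $gg^{-1}=g^{-1}g=1$, $gxg^{-1}=x$, $gyg^{-1}=y+x$, $yx-xy=-\tfrac12x^2$. Modules are left modules. $\langle \mathcal S\rangle$ denotes the two-sided ideal generated by $\mathcal S$. The element $x$ is normal in $J$ (i.e. $xJ=Jx$) and $J/\langle x\rangle\cong\Bbbk[g^{\pm1},y]$ is commutative; for an ideal $\mathfrak p$ of $\Bbbk[g^{\pm1},y]$, $\langle x,\mathfrak p\rangle$ denotes the preimage of $\mathfrak p$ under $J\to J/\langle x\rangle\cong\Bbbk[g^{\pm1},y]$. A proper ideal $P$ is prime if $\mathfrak a\mathfrak b\subseteq P$ implies $\mathfrak a\subseteq P$ or $\mathfrak b\subseteq P$ for all ideals $\mathfrak a,\mathfrak b$; completely prime if the quotient by $P$ is a domain; primitive if it is the annihilator of a simple (left) module. $\mathrm{Spec}$, $\mathrm{Prim}$, $\mathrm{Max}$ denote the sets of prime, primitive and maximal two-sided ideals. *)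

(* Defs.v *)
From HB Require Import structures.
From Stdlib Require Import Relations.
From mathcomp Require Import all_boot all_algebra.
From mathcomp Require Import boolp classical_sets.
From mathcomp Require Import ring_quotient.
From mathcomp.multinomials Require Import monalg.

Set Implicit Arguments.
Unset Strict Implicit.
Unset Printing Implicit Defensive.

Import GRing.Theory.

Local Open Scope classical_set_scope.
Local Open Scope ring_scope.
Local Open Scope quotient_scope.

Section Ideals.
Variable R : pzRingType.
Implicit Types (I P A B S : set R).

Definition is_ideal I : Prop :=
  [/\ I 0, forall a b, I a -> I b -> I (a - b)
    & forall r a, I a -> I (r * a) /\ I (a * r)].

Definition ideal_gen S : set R := smallest is_ideal S.

Definition ideal_mul A B : set R :=
  [set r | exists s : seq (R * R),
     (forall u, u \in s -> A u.1 /\ B u.2) /\ r = \sum_(u <- s) u.1 * u.2].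

Definition prime_ideal P : Prop :=
  [/\ is_ideal P, P <> setT &
      forall A B, is_ideal A -> is_ideal B ->
        ideal_mul A B `<=` P -> A `<=` P \/ B `<=` P].

Definition maximal_ideal P : Prop :=
  [/\ is_ideal P, P <> setT &
      forall I, is_ideal I -> P `<=` I -> I = P \/ I = setT].

Definition is_submodule (M : lmodType R) (N : set M) : Prop :=
  [/\ N 0, forall u v, N u -> N v -> N (u + v)
    & forall r u, N u -> N (r *: u)].

Definition simple_module (M : lmodType R) : Prop :=
  (exists m : M, m != 0) /\
  forall N : set M, is_submodule N -> N = [set 0] \/ N = setT.

Definition annihilator (M : lmodType R) : set R :=
  [set r | forall m : M, r *: m = 0].

Definition primitive_ideal P : Prop :=
  exists M : lmodType R, simple_module M /\ P = annihilator M.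

Definition Spec : set (set R) := [set P | prime_ideal P].
Definition Prim : set (set R) := [set P | primitive_ideal P].
Definition Max : set (set R) := [set P | maximal_ideal P].

Definition center : set R := [set z | forall r, z * r = r * z].

Definition is_domain : Prop :=
  (1 : R) <> 0 /\ forall a b : R, a * b = 0 -> a = 0 \/ b = 0.

Definition prime_chain (n : nat) (c : nat -> set R) P : Prop :=
  [/\ forall i, (i <= n)%N -> Spec (c i),
      forall i, (i < n)%N -> c i `<` c i.+1 & c n = P].

(* Dropping the bottom of a chain gives a shorter one, so the supremum of the
   lengths is n iff n is attained and n.+1 is not. *)
Definition has_height P (n : nat) : Prop :=
  Spec P /\ (exists c, prime_chain n c P) /\ ~ (exists c, prime_chain n.+1 c P).

Lemma ideal_gen_ideal S : is_ideal (ideal_gen S).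
Proof.
split=> [I [[]] //|a b Ia Ib I IP|r a Ia].
  by have [_ IB _] := IP.1; apply: IB; [apply: Ia|apply: Ib].
by split=> I IP; have [_ _ /(_ r a (Ia I IP))[]] := IP.1.
Qed.

Lemma sub_ideal_gen S : S `<=` ideal_gen S.
Proof. by move=> a Sa I [_]; apply. Qed.

Lemma ideal_genP S I : is_ideal I -> S `<=` I -> ideal_gen S `<=` I.
Proof. by move=> idI SI a; apply. Qed.

End Ideals.

Arguments Spec R : clear implicits.
Arguments Prim R : clear implicits.
Arguments Max R : clear implicits.
Arguments center R : clear implicits.

Section RingQuotient.
Variables (R : pzRingType) (S : set R).

Definition ideal_gen_pred : {pred R} := fun r => `[< ideal_gen S r >].

Fact ideal_gen_pred_zmod : zmod_closed ideal_gen_pred.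
Proof.
have [I0 IB _] := ideal_gen_ideal S; split; first exact/asboolP.
by move=> a b /asboolP Ia /asboolP Ib; apply/asboolP; exact: IB.
Qed.

HB.instance Definition _ :=
  GRing.isZmodClosed.Build R ideal_gen_pred ideal_gen_pred_zmod.

Definition ring_quot : Type := Quotient.quot ideal_gen_pred.

HB.instance Definition _ := GRing.Zmodule.on ring_quot.
HB.instance Definition _ := EqQuotient.on ring_quot.

Definition to_quot (r : R) : ring_quot := \pi_(Quotient.quot ideal_gen_pred) r.

Lemma to_quot_eq a b : to_quot a = to_quot b <-> ideal_gen S (a - b).
Proof.
split=> [/eqP|Iab]; last apply/eqP.
  by rewrite -Quotient.idealrBE => /asboolP.
by rewrite -Quotient.idealrBE; apply/asboolP.
Qed.

Lemma repr_quotK (u : ring_quot) : to_quot (repr u) = u.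
Proof. exact: reprK. Qed.

Lemma to_quot_is_zmod_morphism : zmod_morphism to_quot.
Proof. exact: (@pi_is_zmod_morphism R _ _ (Quotient.quot ideal_gen_pred)). Qed.

HB.instance Definition _ :=
  GRing.isZmodMorphism.Build R ring_quot to_quot to_quot_is_zmod_morphism.

Definition quot_one : ring_quot := to_quot 1.
Definition quot_mul (u v : ring_quot) : ring_quot := to_quot (repr u * repr v).

Lemma quot_mulE a b : quot_mul (to_quot a) (to_quot b) = to_quot (a * b).
Proof.
have [_ IB IM] := ideal_gen_ideal S; apply/to_quot_eq.
set a' := repr _; set b' := repr _.
have Ia : ideal_gen S (a' - a) by apply/to_quot_eq; rewrite repr_quotK.
have Ib : ideal_gen S (b - b') by apply/to_quot_eq; rewrite repr_quotK.
have -> : a' * b' - a * b = (a' - a) * b' - a * (b - b').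
  by rewrite mulrBl mulrBr opprB addrA subrK.
by apply: IB; [have [] := IM b' _ Ia|have [] := IM a _ Ib].
Qed.

Fact quot_mulA : associative quot_mul.
Proof.
move=> u v w; rewrite -[u]repr_quotK -[v]repr_quotK -[w]repr_quotK.
by rewrite !quot_mulE mulrA.
Qed.

Fact quot_mul1 : left_id quot_one quot_mul.
Proof. by move=> u; rewrite -[u]repr_quotK quot_mulE mul1r. Qed.

Fact quot_mulr1 : right_id quot_one quot_mul.
Proof. by move=> u; rewrite -[u]repr_quotK quot_mulE mulr1. Qed.

Fact quot_mulDl : left_distributive quot_mul +%R.
Proof.
move=> u v w; rewrite -[u]repr_quotK -[v]repr_quotK -[w]repr_quotK.
by rewrite -raddfD !quot_mulE mulrDl raddfD.
Qed.

Fact quot_mulDr : right_distributive quot_mul +%R.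
Proof.
move=> u v w; rewrite -[u]repr_quotK -[v]repr_quotK -[w]repr_quotK.
by rewrite -raddfD !quot_mulE mulrDr raddfD.
Qed.

HB.instance Definition _ := GRing.Zmodule_isPzRing.Build ring_quot
  quot_mulA quot_mul1 quot_mulr1 quot_mulDl quot_mulDr.

Fact to_quot_is_monoid_morphism : monoid_morphism to_quot.
Proof. by split=> // a b; rewrite -quot_mulE. Qed.

HB.instance Definition _ :=
  GRing.isMonoidMorphism.Build R ring_quot to_quot to_quot_is_monoid_morphism.

End RingQuotient.

Section AlgebraQuotient.
Variables (k : comNzRingType) (F : algType k) (S : set F).

Definition quot_scale (c : k) (u : ring_quot S) : ring_quot S :=
  to_quot S c%:A * u.

Fact quot_scaleE c a : quot_scale c (to_quot S a) = to_quot S (c *: a).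
Proof. by rewrite /quot_scale -rmorphM /= mulr_algl. Qed.

Fact quot_scaleA a b u : quot_scale a (quot_scale b u) = quot_scale (a * b) u.
Proof. by rewrite -[u]repr_quotK !quot_scaleE scalerA. Qed.

Fact quot_scale1 : left_id 1 quot_scale.
Proof. by move=> u; rewrite -[u]repr_quotK quot_scaleE scale1r. Qed.

Fact quot_scaleDr : right_distributive quot_scale +%R.
Proof. by move=> a u v; rewrite /quot_scale mulrDr. Qed.

Fact quot_scaleDl u : {morph quot_scale^~ u : a b / a + b}.
Proof. by move=> a b; rewrite /quot_scale scalerDl rmorphD /= mulrDl. Qed.

HB.instance Definition _ := GRing.Zmodule_isLmodule.Build k (ring_quot S)
  quot_scaleA quot_scale1 quot_scaleDr quot_scaleDl.

Fact quot_scaleAl (c : k) (u v : ring_quot S) : c *: (u * v) = (c *: u) * v.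
Proof. exact: mulrA. Qed.

Fact quot_scaleAr (c : k) (u v : ring_quot S) : c *: (u * v) = u * (c *: v).
Proof.
rewrite -[u]repr_quotK -[v]repr_quotK -rmorphM /=.
by rewrite /GRing.scale /= !quot_scaleE -rmorphM /= scalerAr.
Qed.

End AlgebraQuotient.

(* For an ideal P, [ring_quot P] is the quotient by [ideal_gen P] = P. *)
Definition completely_prime (R : pzRingType) (P : set R) : Prop :=
  [/\ is_ideal P, P <> setT & is_domain (ring_quot P)].

Section Laurent.
Variable k : fieldType.

(* k[g^{+-1}] is the localization of k[g] at the powers of g, realized inside
   the fraction field k(g). *)
Definition laurent_pred : {pred {fraction {poly k}}} :=
  fun f => `[< exists (n : nat) (p : {poly k}),
                 f * tofrac 'X ^+ n = tofrac p >].

Fact laurent_pred_subring : subring_closed laurent_pred.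
Proof.
split.
- by apply/asboolP; exists 0%N, 1; rewrite expr0 mulr1 rmorph1.
- move=> f h /asboolP[n [p fE]] /asboolP[m [q hE]]; apply/asboolP.
  exists (n + m)%N, (p * 'X^m - q * 'X^n).
  rewrite tofracB !tofracM !tofracXn -fE -hE mulrBl exprD.
  by rewrite mulrA; congr (_ - _); rewrite -mulrA [X in h * X]mulrC mulrA.
- move=> f h /asboolP[n [p fE]] /asboolP[m [q hE]]; apply/asboolP.
  by exists (n + m)%N, (p * q); rewrite exprD mulrACA fE hE tofracM.
Qed.

HB.instance Definition _ := GRing.isSubringClosed.Build {fraction {poly k}}
  laurent_pred laurent_pred_subring.

Record laurent := Laurent {
  laurent_val :> {fraction {poly k}};
  laurent_valP : laurent_val \in laurent_pred }.

HB.instance Definition _ := [isSub for laurent_val].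
HB.instance Definition _ := [Choice of laurent by <:].
HB.instance Definition _ := [SubChoice_isSubComNzRing of laurent by <:].

Fact poly_laurent (p : {poly k}) : tofrac p \in laurent_pred.
Proof. by apply/asboolP; exists 0%N, p; rewrite expr0 mulr1. Qed.

Definition laurent_of_poly (p : {poly k}) : laurent := Laurent (poly_laurent p).

Fact laurent_of_poly_is_zmod_morphism : zmod_morphism laurent_of_poly.
Proof. by move=> p q; apply: val_inj; rewrite /= rmorphB. Qed.

Fact laurent_of_poly_is_monoid_morphism : monoid_morphism laurent_of_poly.
Proof. by split=> [|p q]; apply: val_inj; rewrite /= ?rmorph1 ?rmorphM. Qed.

HB.instance Definition _ := GRing.isZmodMorphism.Build {poly k} laurent
  laurent_of_poly laurent_of_poly_is_zmod_morphism.
HB.instance Definition _ := GRing.isMonoidMorphism.Build {poly k} laurent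
  laurent_of_poly laurent_of_poly_is_monoid_morphism.

Fact laurentVX_subproof : (tofrac 'X : {fraction {poly k}})^-1 \in laurent_pred.
Proof.
apply/asboolP; exists 1%N, 1; rewrite expr1 mulVf ?rmorph1 //.
by rewrite tofrac_eq0 polyX_eq0.
Qed.

Definition laurentX : laurent := laurent_of_poly 'X.
Definition laurentVX : laurent := Laurent laurentVX_subproof.

Lemma laurentXV : laurentX * laurentVX = 1.
Proof.
by apply: val_inj; rewrite /= divff // tofrac_eq0 polyX_eq0.
Qed.

(* The ring k[g^{+-1}, y]. *)
Definition kgy : Type := {poly laurent}.
HB.instance Definition _ := GRing.ComNzRing.on kgy.

Definition kgy_const : k -> kgy := polyC \o laurent_of_poly \o polyC.
HB.instance Definition _ := GRing.RMorphism.on kgy_const.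

Definition kgy_g : kgy := laurentX%:P.
Definition kgy_gi : kgy := laurentVX%:P.
Definition kgy_y : kgy := 'X.

End Laurent.

Inductive Jgen := gen_g | gen_gi | gen_x | gen_y.

HB.instance Definition _ := gen_eqMixin Jgen.
HB.instance Definition _ := gen_choiceMixin Jgen.

Section FreeEval.
Variables (A : comNzRingType) (e : Jgen -> A).

Definition word_eval (m : {fmonom Jgen}) : A := \prod_(i <- m) e i.

Fact word_eval_is_mmorphism : mmorphism word_eval.
Proof.
split=> [m n|]; rewrite /word_eval.
  by rewrite fmM big_cat.
by rewrite fm1 big_nil.
Qed.

HB.instance Definition _ :=
  isMultiplicative.Build {fmonom Jgen} A word_eval word_eval_is_mmorphism.

Lemma word_eval_gen i : word_eval (fmu i) = e i.
Proof. by rewrite /word_eval fmU big_seq1. Qed.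

End FreeEval.

(* The relations g g^-1 = 1, g^-1 g = 1, g x g^-1 = x, g y g^-1 = y + x and
   y x - x y = - x^2 / 2, each as the difference of its two sides. *)
Definition Jrelations (k : fieldType) (F : algType k) (g gi x y : F) : set F :=
  [set u | [\/ u = g * gi - 1 \/ u = gi * g - 1,
               u = g * x * gi - x,
               u = g * y * gi - (y + x)
             | u = (y * x - x * y) - (- (2^-1 *: x ^+ 2))]].

Fact Jrelations_eval (k : fieldType) (F : algType k) (A : comNzRingType)
    (f : {rmorphism k -> A}) (phi : {rmorphism F -> A}) (g gi x y : F) :
    (forall c u, phi (c *: u) = f c * phi u) ->
    phi g * phi gi = 1 -> phi x = 0 ->
  forall u, Jrelations g gi x y u -> phi u = 0.
Proof.
move=> phiZ phig phix u [[->|->]|->|->|->].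
- by rewrite rmorphB rmorphM rmorph1 /= phig subrr.
- by rewrite rmorphB rmorphM rmorph1 /= mulrC phig subrr.
- by rewrite rmorphB !rmorphM /= phix mulr0 mul0r subrr.
- by rewrite rmorphB rmorphD !rmorphM /= phix addr0 mulrAC phig mul1r subrr.
- rewrite !rmorphB rmorphN phiZ rmorphXn !rmorphM /= phix.
  by rewrite expr0n !(mulr0, mul0r, oppr0, addr0).
Qed.

Section J.
Variable k : fieldType.

(* The free associative algebra on the four generators, as the monoid algebra
   of the free monoid. *)
Definition freeJ : Type := {malg k[{fmonom Jgen}]}.
HB.instance Definition _ := GRing.Lalgebra.on freeJ.

Fact freeJ_scaleAr (c : k) (u v : freeJ) : c *: (u * v) = u * (c *: v).
Proof.
have -> : c *: v = c *: 1 * v by rewrite -scalerAl mul1r.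
rewrite scalerAl mulrA; congr (_ * _).
have -> : c *: u = c *: 1 * u by rewrite -scalerAl mul1r.
rewrite -[c *: 1]mul_malgC mulr1 !malgM_def fgmulUg fgmulgU.
by apply: eq_bigr => m _; rewrite mulrC mul1m mulm1.
Qed.

HB.instance Definition _ := GRing.Lalgebra_isAlgebra.Build k freeJ freeJ_scaleAr.

Definition fgen (i : Jgen) : freeJ := << fmu i >>.

Definition Jrel : set freeJ :=
  Jrelations (fgen gen_g) (fgen gen_gi) (fgen gen_x) (fgen gen_y).

Definition J : Type := ring_quot Jrel.
HB.instance Definition _ := GRing.PzRing.on J.
HB.instance Definition _ := GRing.Lmodule.on J.

Definition Jpi : freeJ -> J := @to_quot _ Jrel.
HB.instance Definition _ := GRing.RMorphism.on Jpi.

Section Eval.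
Variables (A : comNzRingType) (f : {rmorphism k -> A}) (e : Jgen -> A).

Definition free_eval : freeJ -> A := mmap f (word_eval e).
HB.instance Definition _ := GRing.RMorphism.on free_eval.

Lemma free_eval_gen i : free_eval (fgen i) = e i.
Proof.
rewrite /free_eval [LHS]mmapU word_eval_gen.
by rewrite -[RHS]mul1r; congr (_ * _); exact: rmorph1.
Qed.

Lemma free_evalZ c u : free_eval (c *: u) = f c * free_eval u.
Proof. exact: mmapZ. Qed.

Lemma free_eval_rel u :
  e gen_g * e gen_gi = 1 -> e gen_x = 0 -> ideal_gen Jrel u -> free_eval u = 0.
Proof.
move=> e_g e_x; apply: (@ideal_genP _ _ [set u | free_eval u = 0]).
  pose phi : {rmorphism freeJ -> A} := free_eval.
  split=> [|a b /= a0 b0|r a /= a0]; first exact: (rmorph0 phi).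
    by rewrite (rmorphB phi) /= a0 b0 subrr.
  by split; rewrite (rmorphM phi) /= a0 ?mulr0 ?mul0r.
apply: (@Jrelations_eval k freeJ A f free_eval); first exact: free_evalZ.
  by rewrite -e_g; congr (_ * _); exact: free_eval_gen.
by rewrite -e_x; exact: free_eval_gen.
Qed.

End Eval.

Fact J_oner_neq0 : (1 : J) != 0.
Proof.
pose e i : k := match i with gen_g | gen_gi => 1 | _ => 0 end.
apply/eqP=> J10; have : Jpi 1 = Jpi 0 by rewrite rmorph1 rmorph0.
move=> /to_quot_eq /(@free_eval_rel _ idfun e _ (mulr1 _) erefl) /eqP.
by rewrite subr0 rmorph1 oner_eq0.
Qed.

HB.instance Definition _ := GRing.PzSemiRing_isNonZero.Build J J_oner_neq0.

HB.instance Definition _ := GRing.Lmodule_isLalgebra.Build k J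
  (@quot_scaleAl k freeJ Jrel).
HB.instance Definition _ := GRing.Lalgebra_isAlgebra.Build k J
  (@quot_scaleAr k freeJ Jrel).

Definition Jg : J := Jpi (fgen gen_g).
Definition Jgi : J := Jpi (fgen gen_gi).
Definition Jx : J := Jpi (fgen gen_x).
Definition Jy : J := Jpi (fgen gen_y).

Definition Omega : J := Jx ^+ 2 * Jgi.

Definition kgy_gen (i : Jgen) : kgy k :=
  match i with
  | gen_g => kgy_g k | gen_gi => kgy_gi k | gen_x => 0 | gen_y => kgy_y k
  end.

(* The composite J -> J/<x> = k[g^{+-1}, y], that is, the algebra map sending
   g to g, x to 0 and y to y; see [JprojE] for independence of [repr]. *)
Definition Jproj (u : J) : kgy k := free_eval (@kgy_const k) kgy_gen (repr u).

Lemma JprojE u : Jproj (Jpi u) = free_eval (@kgy_const k) kgy_gen u.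
Proof.
pose phi : {rmorphism freeJ -> kgy k} := free_eval (@kgy_const k) kgy_gen.
apply/eqP; rewrite -subr_eq0 -(rmorphB phi) /=; apply/eqP.
apply: free_eval_rel; rewrite //=.
  by rewrite -polyCM laurentXV.
by apply/to_quot_eq; rewrite repr_quotK.
Qed.

Fact Jproj_is_zmod_morphism : zmod_morphism Jproj.
Proof.
move=> u v; rewrite -[u]repr_quotK -[v]repr_quotK -raddfB /=.
by rewrite !JprojE [LHS]rmorphB.
Qed.

Fact Jproj_is_monoid_morphism : monoid_morphism Jproj.
Proof.
split=> [|u v]; first by rewrite -(rmorph1 Jpi) JprojE [LHS]rmorph1.
rewrite -[u]repr_quotK -[v]repr_quotK -[_ * _](rmorphM Jpi) /=.
by rewrite !JprojE [LHS]rmorphM.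
Qed.

HB.instance Definition _ :=
  GRing.isZmodMorphism.Build J (kgy k) Jproj Jproj_is_zmod_morphism.
HB.instance Definition _ :=
  GRing.isMonoidMorphism.Build J (kgy k) Jproj Jproj_is_monoid_morphism.

Lemma Jproj_gen i : Jproj (Jpi (fgen i)) = kgy_gen i.
Proof. by rewrite JprojE free_eval_gen. Qed.

Definition zero_ideal : set J := ideal_gen [set 0].

Definition x_ideal : set J := ideal_gen [set Jx].

Definition Omega_ideal (a : k) : set J := ideal_gen [set Omega - a%:A].

Definition xp_ideal (p : set (kgy k)) : set J := Jproj @^-1` p.

Definition xgy_ideal (b c : k) : set J :=
  ideal_gen [set Jx; Jg - b%:A; Jy - c%:A].

Definition gy_ideal (b c : k) : set (kgy k) :=
  ideal_gen [set kgy_g k - kgy_const b; kgy_y k - kgy_const c].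

(* The inclusions listed in the theorem; all others are obtained from these by
   transitivity. *)
Inductive basic_inclusion : set J -> set J -> Prop :=
| zero_inclusion P :
    Spec J P -> P <> zero_ideal -> basic_inclusion zero_ideal P
| x_inclusion p :
    has_height p 1 -> basic_inclusion x_ideal (xp_ideal p)
| xp_inclusion p b c :
    has_height p 1 -> b != 0 -> p `<` gy_ideal b c ->
    basic_inclusion (xp_ideal p) (xgy_ideal b c).

End J.

Arguments zero_ideal k : clear implicits.
Arguments x_ideal k : clear implicits.

(* Main.v *)
Require Import Defs.
From HB Require Import structures.
From Stdlib Require Import Relations.
From mathcomp Require Import all_boot all_algebra.
From mathcomp Require Import boolp classical_sets functions.
From mathcomp Require Import ring_quotient.
From mathcomp.multinomials Require Import monalg.

Set Implicit Arguments.
Unset Strict Implicit.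
Unset Printing Implicit Defensive.

Import GRing.Theory.

Local Open Scope classical_set_scope.
Local Open Scope ring_scope.

(** [J] is the Ore extension [A[y; d]] of [A = k[g^+-1, x]] by the derivation
[d = - x (x/2 d/dx + g d/dg)], and [Omega = x^2 g^-1] is a constant of [d].  Once
[x] is inverted, [A] becomes [k[Omega^+-1, x^+-1]], [d] becomes
[- x^2/2 d/dx], and the inverse of [x] is, up to a factor, conjugate to [y]: the
algebra is a localized Weyl algebra over [k[Omega^+-1]].  So its ideals come from
[k[Omega^+-1]], whereas modulo [x] there remains the ring [k[g^+-1, y]].

Localizations are replaced by numerators.  After multiplication by a power of
[s = Omega x^2] an element of [J] is a polynomial in [y] with coefficients in
[k[Omega][x]] ([Omega_cover]); modulo [Omega - a] the coefficients are in [k[x]].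
This form is unique because [J] acts on a module, coinduced from the subalgebra
generated by [x] and [y], on which the coefficients are visible ([evO_inj]).
Leading coefficients multiply, so [0] and the ideals of the [Omega - a] are
completely prime ([completely_prime_mod]).  Commutators with [x] and [y]
differentiate in [y] and [x]; hence an ideal above one of these contains a power
of [Omega] times a nonzero constant, which is a polynomial in [Omega] in the first
case and a scalar in the second ([ideal_above_mod]).  Thus a nonzero ideal meets
the centre, [Omega - a] generates a maximal ideal, and a nonzero prime contains
some [Omega - a] since [k] is algebraically closed; if [a = 0] it contains [x]
because [x] is normal.  The primes above [x] are those of [k[g^+-1, y]], a ring of
dimension two whose maximal ideals are the points ([prime_in_gy],
[prime_chain_gy]).

A maximal ideal is primitive, a primitive ideal is prime, and a primitive ideal
with commutative quotient is maximal; so it remains to see that no simple module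
[M] is faithful ([faithful_absurd]).  On a faithful one every nonzero polynomial
in [Omega] would act bijectively, and this contradicts generic freeness: a cyclic
module with an annihilator of degree [n] in [y] is, after inverting the leading
coefficient, free on [1, y, ..., y^(n-1)] over [k[Omega, x]], and there
[Omega - b] is not invertible for general [b].  If a polynomial in [x] and [Omega]
kills a vector, one uses instead Kashiwara's lemma, by which [M] contains
the direct sum of the [y^i V], with [V] the kernel of that polynomial. *)

(** * Ideals of rings *)

Section GeneralIdeals.
Variable R : pzRingType.
Implicit Types (P I : set R).

Lemma ideal0 I : is_ideal I -> I 0. Proof. by case. Qed.

Lemma idealB I a b : is_ideal I -> I a -> I b -> I (a - b).
Proof. by case=> _ + _ => /(_ a b). Qed.

Lemma idealN I a : is_ideal I -> I a -> I (- a).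
Proof. by move=> idI Ia; rewrite -sub0r; apply: idealB => //; exact: ideal0. Qed.

Lemma idealD I a b : is_ideal I -> I a -> I b -> I (a + b).
Proof.
by move=> idI Ia Ib; rewrite -(opprK b); apply: idealB => //; exact: idealN.
Qed.

Lemma idealMl I r a : is_ideal I -> I a -> I (r * a).
Proof. by case=> _ _ IM /(IM r)[]. Qed.

Lemma idealMr I r a : is_ideal I -> I a -> I (a * r).
Proof. by case=> _ _ IM /(IM r)[]. Qed.

Lemma ideal_addl I a b : is_ideal I -> I a -> I (a + b) -> I b.
Proof. by move=> idI Ia Iab; rewrite -(addKr a b) addrC; exact: idealB. Qed.

Lemma ideal_sum I (T : Type) (r : seq T) (F : T -> R) : is_ideal I ->
  (forall i, I (F i)) -> I (\sum_(i <- r) F i).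
Proof.
move=> idI IF; elim/big_ind: _ => [|a b|] //; first exact: ideal0.
exact: idealD.
Qed.

Lemma ideal1 I : is_ideal I -> I 1 -> I = setT.
Proof.
move=> idI I1; apply/seteqP; split=> // a _.
by rewrite -[a]mulr1; exact: idealMl.
Qed.

Lemma proper_ideal I : is_ideal I -> I <> setT <-> ~ I 1.
Proof.
move=> idI; split=> [nT I1|n1 IT]; first exact/nT/ideal1.
by apply: n1; rewrite IT.
Qed.

Lemma ideal_genE I : is_ideal I -> ideal_gen I = I.
Proof.
move=> idI; apply/seteqP; split; last exact: sub_ideal_gen.
by apply: ideal_genP.
Qed.

Lemma ideal_gen1 a I : is_ideal I -> I a -> ideal_gen [set a] `<=` I.
Proof. by move=> idI Ia; apply: ideal_genP => // _ ->. Qed.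

Lemma zero_genE : ideal_gen [set 0] = [set (0 : R)].
Proof.
apply/seteqP; split=> [|_ ->]; last exact: ideal0 (ideal_gen_ideal _).
apply: ideal_genP => //; split=> // [a b /= -> ->|r a /= ->].
  by rewrite subrr.
by rewrite mulr0 mul0r.
Qed.

(** The condition that [u r v] lies in [P] for all [r] is linear in [u] and in [v],
so it extends from [a] and [b] to the ideals that they generate. *)
Lemma prime_elem P a b : prime_ideal P -> (forall r, P (a * r * b)) -> P a \/ P b.
Proof.
move=> [idP _ prP] ab.
have Pall (r t u : R) : P (r * a * t * b * u).
  by apply: idealMr => //; rewrite -2!mulrA; apply: idealMl => //; rewrite mulrA.
have idab c d : (forall r, P (c * r * d)) ->
    forall u v, ideal_gen [set c] u -> ideal_gen [set d] v -> P (u * v).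
  move=> cd u v cu dv.
  pose I1 : set R := [set w | forall r, P (w * r * d)].
  have idI1 : is_ideal I1.
    split=> [|w w' Iw Iw'|t w Iw]; first by move=> r; rewrite !mul0r; exact: ideal0.
      by move=> r; rewrite !mulrBl; exact: idealB.
    split=> r; last by rewrite -(mulrA w).
    by rewrite -!mulrA; apply: idealMl => //; rewrite mulrA.
  have I1u : I1 u by apply: ideal_gen1 cu.
  pose I2 : set R := [set w | forall r, P (u * r * w)].
  have idI2 : is_ideal I2.
    split=> [|w w' Iw Iw'|t w Iw]; first by move=> r; rewrite mulr0; exact: ideal0.
      by move=> r; rewrite mulrBr; exact: idealB.
    split=> r; first by rewrite mulrA -(mulrA u).
    by rewrite mulrA; exact: idealMr.
  have : I2 v by apply: ideal_gen1 dv.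
  by move/(_ 1); rewrite mulr1.
have [||||] := prP (ideal_gen [set a]) (ideal_gen [set b]).
- exact: ideal_gen_ideal.
- exact: ideal_gen_ideal.
- move=> _ [s [sab ->]]; elim: s sab => [|u s IH] sab.
    by rewrite big_nil; exact: ideal0.
  rewrite big_cons; apply: idealD => //; last first.
    by apply: IH => v vs; apply: sab; rewrite in_cons vs orbT.
  have [ua ub] := sab u (mem_head _ _); exact: idab ua ub.
- by move=> aP; left; apply: aP; apply: sub_ideal_gen.
- by move=> bP; right; apply: bP; apply: sub_ideal_gen.
Qed.

Lemma prime_center P z u : prime_ideal P -> center R z -> P (z * u) -> P z \/ P u.
Proof.
move=> prP zc Pzu; apply: prime_elem => // r.
rewrite zc -mulrA; case: prP => idP _ _; exact: idealMl.
Qed.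

(** Complete primeness, in terms of elements. *)
Definition no_zero_div P : Prop :=
  [/\ is_ideal P, ~ P 1 & forall u v, P (u * v) -> P u \/ P v].

Lemma no_zero_div_prime P : no_zero_div P -> prime_ideal P.
Proof.
move=> [idP P1 prP]; split=> //; first exact/proper_ideal.
move=> A B idA idB ABP; apply: contrapT => /not_orP[nAP nBP].
have [a [Aa nPa]] : exists a, A a /\ ~ P a.
  by apply: contrapT => n; apply: nAP => a Aa; apply: contrapT => nPa; apply: n; exists a.
have [b [Bb nPb]] : exists b, B b /\ ~ P b.
  by apply: contrapT => n; apply: nBP => b Bb; apply: contrapT => nPb; apply: n; exists b.
have : P (a * b).
  apply: ABP; exists [:: (a, b)]; rewrite big_seq1; split=> // u.
  by rewrite inE => /eqP ->.
by case/prP.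
Qed.

Lemma no_zero_div_completely_prime P : no_zero_div P -> completely_prime P.
Proof.
move=> [idP P1 prP]; split=> //; first exact/proper_ideal.
have qP (a : R) : to_quot P a = 0 <-> P a.
  rewrite -(raddf0 (@to_quot R P)); split=> [/to_quot_eq|Pa].
    by rewrite subr0 ideal_genE.
  by apply/to_quot_eq; rewrite subr0 ideal_genE.
split=> [|a b]; first by move/qP.
rewrite -(repr_quotK a) -(repr_quotK b); move: (repr a) (repr b) => {a b} a b.
rewrite [_ * _](@quot_mulE R P) => /qP/prP[] Pr; first by left; exact: (iffRL (qP _) Pr).
by right; exact: (iffRL (qP _) Pr).
Qed.

(** If neither [A] nor [B] lies in [P], then [1] is in [A + P] and in [B + P],
hence in [A B + P]. *)
Lemma maximal_prime P : maximal_ideal P -> prime_ideal P.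
Proof.
move=> [idP PT maxP]; split=> // A B idA idB AB.
apply: contrapT => /not_orP[nAP nBP].
pose S (X : set R) : set R := [set w | exists a p, [/\ X a, P p & w = a + p]].
have big (X : set R) : is_ideal X -> ~ X `<=` P -> exists a p, [/\ X a, P p & 1 = a + p].
  move=> idX nX; have idS : is_ideal (S X).
    split=> [|_ _ [a [p [Xa Pp ->]]] [b [q [Xb Pq ->]]]|r _ [a [p [Xa Pp ->]]]].
    - by exists 0, 0; split; rewrite ?addr0 //; exact: ideal0.
    - exists (a - b), (p - q); split; [exact: idealB|exact: idealB|].
      by rewrite opprD addrACA.
    - split; [exists (r * a), (r * p)|exists (a * r), (p * r)]; split;
        rewrite ?mulrDr ?mulrDl //; by [exact: idealMl|exact: idealMr].
  have PS : P `<=` S X.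
    by move=> p Pp; exists 0, p; split; rewrite ?add0r //; exact: ideal0.
  have [SP|ST] := maxP _ idS PS; last by have : S X 1 by rewrite ST.
  case: nX => a Xa; rewrite -SP; exists a, 0; split; rewrite ?addr0 //.
  exact: ideal0.
have [a [p [Aa Pp ap]]] := big A idA nAP; have [b [q [Bb Pq bq]]] := big B idB nBP.
apply/PT/ideal1 => //; rewrite -[1]mulr1 {1}ap bq mulrDl mulrDr.
apply: idealD => //; last exact: idealMr.
apply: idealD => //; last exact: idealMl.
apply: AB; exists [:: (a, b)]; rewrite big_seq1; split=> // u.
by rewrite inE => /eqP ->.
Qed.
End GeneralIdeals.

Lemma min_size (T : nzSemiRingType) (Q : {poly T} -> Prop) : (exists p, Q p) ->
  exists p, Q p /\ forall q, Q q -> (size p <= size q)%N.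
Proof.
move=> [p Qp].
have ex : exists n, `[< exists2 q, Q q & size q = n >].
  by exists (size p); apply/asboolP; exists p.
case: (ex_minnP ex) => n /asboolP[q Qq <-] min_n.
by exists q; split=> // r Qr; apply: min_n; apply/asboolP; exists r.
Qed.

Lemma prime_proper (A : pzRingType) (P : set A) : prime_ideal P -> ~ P 1.
Proof. by case=> idP PT _; apply/proper_ideal. Qed.

(** The polynomial splits into linear factors, and a prime that contains a
product of central elements contains one of them. *)
Lemma prime_linear_factor (k : closedFieldType) (A : pzRingType) (P : set A)
    (phi : {poly k} -> A) (r : {poly k}) : prime_ideal P ->
  (forall p q, phi (p * q) = phi p * phi q) -> phi 1 = 1 ->
  (forall p, center A (phi p)) ->
  r != 0 -> P (phi r) -> exists c, P (phi ('X - c%:P)).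
Proof.
move=> prP phiM phi1 phiC; have idP : is_ideal P by case: prP.
have [n] := ubnP (size r); elim: n r => // n IH r le_r r0 Pr.
have [sz|sz] := leqP (size r) 1.
  have rE := size1_polyC sz; case: (prime_proper prP).
  have r00 : r`_0 != 0 by apply: contra_neq r0; rewrite {2}rE => ->.
  rewrite -phi1 -polyC1 -(mulVf r00) polyCM phiM -rE; exact: idealMl.
have [c rc] : exists c, root r c by apply/closed_rootP; rewrite neq_ltn sz orbT.
have [q rE] := factor_theorem _ _ rc.
move: Pr; rewrite rE phiM => /(prime_center prP (phiC _))[Pq|Pc]; last by exists c.
have q0 : q != 0 by apply: contra_neq r0 => q0; rewrite rE q0 mul0r.
apply: (IH q) => //.
by move: le_r; rewrite rE size_Mmonic ?monicXsubC // size_XsubC addn2.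
Qed.

Lemma com_primeM (A : comPzRingType) (P : set A) u v :
  prime_ideal P -> P (u * v) -> P u \/ P v.
Proof.
move=> prP Puv; apply: prime_elem => // r; rewrite mulrAC.
by case: prP => idP _ _; exact: idealMr.
Qed.

(** * The algebra by generators and relations *)

(** The algebra is handled through what its presentation gives: the relations,
generation, and maps out of it.  Keeping it abstract also keeps the quotient
construction of [J] from being unfolded in computations. *)
Record is_bosonization (k : fieldType) (R : algType k) (g gi x y : R) : Prop :=
  IsBosonization {
    bos_ggi : g * gi = 1;
    bos_gig : gi * g = 1;
    bos_gx : g * x = x * g;
    bos_gy : g * y = (y + x) * g;
    bos_yx : y * x = x * y - 2^-1 *: (x * x);
    bos_ind : forall S : R -> Prop,
      S 1 -> (forall u v, S u -> S v -> S (u + v)) ->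
      (forall c u, S u -> S (c *: u)) ->
      (forall u, S u -> S (g * u)) -> (forall u, S u -> S (gi * u)) ->
      (forall u, S u -> S (x * u)) -> (forall u, S u -> S (y * u)) ->
      forall u, S u;
    bos_map : forall (B : nzRingType) (f : {rmorphism k -> B}) (b bi p q : B),
      (forall c, [/\ GRing.comm (f c) b, GRing.comm (f c) bi,
                     GRing.comm (f c) p & GRing.comm (f c) q]) ->
      [/\ b * bi = 1, bi * b = 1, b * p = p * b, b * q = (q + p) * b
        & q * p = p * q - f 2^-1 * (p * p)] ->
      exists phi : {rmorphism R -> B},
        [/\ phi g = b, phi gi = bi, phi x = p & phi y = q] /\
        forall c u, phi (c *: u) = f c * phi u }.

Section Presentation.
Variable k : fieldType.

Lemma JpiZ c (u : freeJ k) : Jpi (c *: u) = c *: Jpi u.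
Proof. by rewrite /Jpi -quot_scaleE. Qed.

Lemma JpiM (u v : freeJ k) : Jpi (u * v) = Jpi u * Jpi v.
Proof. exact: esym (quot_mulE _ _ _). Qed.

Lemma JpiD (u v : freeJ k) : Jpi (u + v) = Jpi u + Jpi v.
Proof. exact: raddfD (@Jpi k) _ _. Qed.

Lemma JpiB (u v : freeJ k) : Jpi (u - v) = Jpi u - Jpi v.
Proof. exact: raddfB (@Jpi k) _ _. Qed.

Local Notation fg := (fgen k gen_g).
Local Notation fgi := (fgen k gen_gi).
Local Notation fx := (fgen k gen_x).
Local Notation fy := (fgen k gen_y).

Lemma Jpi_relB (u v : freeJ k) : Jrel (u - v) -> Jpi u = Jpi v.
Proof. by move=> uv; apply/to_quot_eq; exact: sub_ideal_gen. Qed.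

Lemma Jg_gi : Jg k * Jgi k = 1.
Proof.
apply: etrans (esym (JpiM fg fgi)) _.
by apply: (@Jpi_relB _ 1); constructor 1; left.
Qed.

Lemma Jgi_g : Jgi k * Jg k = 1.
Proof.
apply: etrans (esym (JpiM fgi fg)) _.
by apply: (@Jpi_relB _ 1); constructor 1; right.
Qed.

Lemma move_inverse (A : pzRingType) (u v w z t : A) :
  w * t = 1 -> u * v * w = z -> u * v = z * t.
Proof. by move=> wt <-; rewrite -mulrA wt mulr1. Qed.

Lemma Jg_x : Jg k * Jx k = Jx k * Jg k.
Proof.
apply: move_inverse Jgi_g _; apply: etrans (_ : Jpi (fg * fx * fgi) = _).
  by apply: esym; apply: etrans (JpiM _ _) (congr1 ( *%R^~ _) (JpiM _ _)).
by apply: Jpi_relB; constructor 2.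
Qed.

Lemma Jg_y : Jg k * Jy k = (Jy k + Jx k) * Jg k.
Proof.
apply: move_inverse Jgi_g _; apply: etrans (_ : Jpi (fg * fy * fgi) = _).
  by apply: esym; apply: etrans (JpiM _ _) (congr1 ( *%R^~ _) (JpiM _ _)).
apply: etrans (_ : Jpi (fy + fx) = _); last exact: JpiD.
by apply: Jpi_relB; constructor 3.
Qed.

Lemma Jy_x : Jy k * Jx k = Jx k * Jy k - 2^-1 *: (Jx k * Jx k).
Proof.
apply: etrans (esym (JpiM fy fx)) _.
apply: etrans (_ : Jpi (fx * fy - 2^-1 *: (fx * fx) : freeJ k) = _).
  apply: Jpi_relB; constructor 4.
  by rewrite -expr2 opprD !opprK addrA.
apply: etrans (JpiB _ _) _.
apply: (congr2 (fun a b : J k => a - b)); first exact: JpiM.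
by apply: etrans (JpiZ _ _) (congr1 _ _); exact: JpiM.
Qed.

Lemma fmu_cons (i : Jgen) (s : seq Jgen) :
  << FMonom (i :: s) >> = fgen k i * << FMonom s >> :> freeJ k.
Proof.
rewrite [RHS]malgM_def fgmulUU mulr1; congr << _ >>.
by rewrite -[mmul _ _]fmK fmM fmuE.
Qed.

Lemma malgU_scale c (m : {fmonom Jgen}) : << c *g m >> = c *: << m >> :> freeJ k.
Proof. by rewrite -[RHS]mul_malgC [RHS]malgM_def fgmulUU mulr1 mul1m. Qed.

(** Words in the generators span [J], so a linear property may be proved by adding
one letter on the left at a time. *)
Lemma J_ind (S : J k -> Prop) :
  S 1 -> (forall u v, S u -> S v -> S (u + v)) ->
  (forall c u, S u -> S (c *: u)) ->
  (forall u, S u -> S (Jg k * u)) -> (forall u, S u -> S (Jgi k * u)) ->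
  (forall u, S u -> S (Jx k * u)) -> (forall u, S u -> S (Jy k * u)) ->
  forall u, S u.
Proof.
move=> S1 SD SZ Sg Sgi Sx Sy u.
have Sw (m : {fmonom Jgen}) : S (Jpi (<< m >> : freeJ k)).
  rewrite -(fmK m); elim: (fmonom_val m) => [|i s IH].
    by rewrite -fmoneE.
  rewrite fmu_cons JpiM.
  case: i; [exact: Sg|exact: Sgi|exact: Sx|exact: Sy].
rewrite -[u]repr_quotK -[to_quot _ _]/(Jpi (repr u)) [repr u]monalgE.
rewrite raddf_sum /=; elim/big_ind: _ => [||m _]; [|exact: SD|].
  by rewrite -[0 : J k](scale0r (1 : J k)); exact: SZ.
by rewrite malgU_scale JpiZ; exact/SZ/Sw.
Qed.

Section Map.
Variables (B : nzRingType) (f : {rmorphism k -> B}) (e : Jgen -> B).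
Hypothesis comm_fe : forall c i, GRing.comm (f c) (e i).
Hypothesis e_rel : [/\ e gen_g * e gen_gi = 1, e gen_gi * e gen_g = 1,
  e gen_g * e gen_x = e gen_x * e gen_g,
  e gen_g * e gen_y = (e gen_y + e gen_x) * e gen_g
  & e gen_y * e gen_x = e gen_x * e gen_y - f 2^-1 * (e gen_x * e gen_x)].

Definition word_map (m : {fmonom Jgen}) : B := \prod_(i <- m) e i.

Fact word_map_mmorphism : mmorphism word_map.
Proof.
by split=> [m n|]; rewrite /word_map ?fm1 ?big_nil // fmM big_cat.
Qed.

HB.instance Definition _ :=
  isMultiplicative.Build {fmonom Jgen} B word_map word_map_mmorphism.

Definition free_map : freeJ k -> B := mmap f word_map.

Fact free_map_zmod_morphism : zmod_morphism free_map.
Proof. by move=> u v; exact: mmap_is_additive. Qed.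

Fact free_map_monoid_morphism : monoid_morphism free_map.
Proof.
have [|h1 hM] := @commr_mmap_is_multiplicative _ _ _ f word_map; last by split.
by move=> u m n; apply: commr_prod => i _; exact: comm_fe.
Qed.

HB.instance Definition _ := GRing.isZmodMorphism.Build (freeJ k) B free_map
  free_map_zmod_morphism.
HB.instance Definition _ := GRing.isMonoidMorphism.Build (freeJ k) B free_map
  free_map_monoid_morphism.

Lemma free_map_gen i : free_map (fgen k i) = e i.
Proof.
rewrite /free_map [LHS]mmapU /word_map fmU big_seq1 -[RHS]mul1r.
by congr (_ * _); exact: rmorph1.
Qed.

Lemma free_mapZ c u : free_map (c *: u) = f c * free_map u.
Proof. exact: mmapZ. Qed.

Lemma free_map_rel (u : freeJ k) : ideal_gen (@Jrel k) u -> free_map u = 0.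
Proof.
pose phi : {rmorphism freeJ k -> B} := free_map.
have ph i : phi (fgen k i) = e i := free_map_gen i.
have phZ c v : phi (c *: v) = f c * phi v := free_mapZ c v.
have [e1 e2 e3 e4 e5] := e_rel.
apply: (@ideal_genP _ _ [set u | phi u = 0]).
  split=> [|a b /= a0 b0|r a /= a0]; first exact: (rmorph0 phi).
    by rewrite (rmorphB phi) /= a0 b0 subrr.
  by split; rewrite (rmorphM phi) /= a0 ?mulr0 ?mul0r.
have rel1 (a b : freeJ k) : phi (a * b - 1) = phi a * phi b - 1.
  by rewrite (rmorphB phi) (rmorphM phi) (rmorph1 phi).
have rel2 (a b c d : freeJ k) :
    phi (a * b * c - d) = phi a * phi b * phi c - phi d.
  by rewrite (rmorphB phi) (rmorphM phi (a * b)) (rmorphM phi).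
have rel3 (a b : freeJ k) : phi (b * a - a * b - - (2^-1 *: a ^+ 2)) =
    phi b * phi a - phi a * phi b + f 2^-1 * phi a ^+ 2.
  rewrite opprK (rmorphD phi) phZ (rmorphXn phi) (rmorphB phi).
  by congr (_ - _ + _); exact: (rmorphM phi).
move=> v rv; suff : phi v = 0 by []; case: rv => [[->|->]|->|->|->].
- by rewrite rel1 !ph e1 subrr.
- by rewrite rel1 !ph e2 subrr.
- by rewrite rel2 !ph e3 -mulrA e1 mulr1 subrr.
- by rewrite rel2 (rmorphD phi) !ph e4 -mulrA e1 mulr1 subrr.
- by rewrite rel3 !ph e5 expr2 addrAC subrK subrr.
Qed.

Definition Jmap (u : J k) : B := free_map (repr u).

Lemma JmapE (u : freeJ k) : Jmap (Jpi u) = free_map u.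
Proof.
apply/eqP; rewrite -subr_eq0 -(rmorphB free_map); apply/eqP.
by apply: free_map_rel; apply/to_quot_eq; rewrite repr_quotK.
Qed.

Fact Jmap_zmod_morphism : zmod_morphism Jmap.
Proof.
move=> u v; rewrite -[u]repr_quotK -[v]repr_quotK -raddfB.
by rewrite !JmapE [LHS](rmorphB free_map).
Qed.

Fact Jmap_monoid_morphism : monoid_morphism Jmap.
Proof.
split=> [|u v]; first by apply: etrans (JmapE 1) _; exact: (rmorph1 free_map).
rewrite -[u]repr_quotK -[v]repr_quotK -[_ * _]JpiM.
by rewrite !JmapE [LHS](rmorphM free_map).
Qed.

HB.instance Definition _ := GRing.isZmodMorphism.Build (J k) B Jmap
  Jmap_zmod_morphism.
HB.instance Definition _ := GRing.isMonoidMorphism.Build (J k) B Jmap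
  Jmap_monoid_morphism.

Lemma Jmap_gen i : Jmap (Jpi (fgen k i)) = e i.
Proof. by rewrite JmapE free_map_gen. Qed.

Lemma JmapZ c u : Jmap (c *: u) = f c * Jmap u.
Proof. by rewrite -[u]repr_quotK -[_ *: _]JpiZ !JmapE free_mapZ. Qed.

Lemma J_universal : exists phi : {rmorphism J k -> B},
  (forall i, phi (Jpi (fgen k i)) = e i) /\
  forall c u, phi (c *: u) = f c * phi u.
Proof. by exists Jmap; split; [exact: Jmap_gen|exact: JmapZ]. Qed.
End Map.

Lemma J_is_bosonization : is_bosonization (Jg k) (Jgi k) (Jx k) (Jy k).
Proof.
split; [exact: Jg_gi|exact: Jgi_g|exact: Jg_x|exact: Jg_y|exact: Jy_x|
        exact: J_ind|].
move=> B f b bi p q cf rel.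
pose e i := match i with gen_g => b | gen_gi => bi | gen_x => p | gen_y => q end.
have ce c i : GRing.comm (f c) (e i) by have [] := cf c; case: i.
have [phi [phi_gen phiZ]] := J_universal ce rel.
by exists phi; split=> //; split; exact: phi_gen.
Qed.

Lemma JprojZ c (u : J k) : Jproj (c *: u) = kgy_const c * Jproj u.
Proof. by rewrite -[u]repr_quotK -[_ *: _]JpiZ !JprojE free_evalZ. Qed.
End Presentation.

(** * Normal elements and differential operators in y *)

Section Bosonization.
Variables (k : fieldType) (R : algType k) (g gi x y : R).
Hypothesis hR : is_bosonization g gi x y.
Hypothesis char_k : [pchar k] =i pred0.

Local Notation Om := (x ^+ 2 * gi).

Let ggi : g * gi = 1. Proof. by case: hR. Qed.
Let gig : gi * g = 1. Proof. by case: hR. Qed.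
Let gx : g * x = x * g. Proof. by case: hR. Qed.
Let gy : g * y = (y + x) * g. Proof. by case: hR. Qed.
Let yx : y * x = x * y - 2^-1 *: (x * x). Proof. by case: hR. Qed.
Let ind := bos_ind hR.

Lemma natr_neq0 n : n.+1%:R != 0 :> k.
Proof. by rewrite (iffLR (pcharf0P k) char_k). Qed.

Lemma half2 : 2^-1 *+ 2 = 1 :> k.
Proof. by rewrite -[LHS]mulr_natr mulVf // natr_neq0. Qed.

Lemma gi_x : gi * x = x * gi.
Proof. by rewrite -[gi * x]mulr1 -ggi !mulrA -(mulrA gi) -gx mulrA gig mul1r. Qed.

Lemma gi_y : gi * y = (y - x) * gi.
Proof.
have h : g * (y - x) = y * g by rewrite mulrBr gy mulrDl gx addrK.
by rewrite -[gi * y]mulr1 -ggi mulrA -(mulrA gi) -h !mulrA gig mul1r.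
Qed.

Lemma y_x2 : y * x ^+ 2 = x ^+ 2 * y - x ^+ 3.
Proof.
rewrite expr2 mulrA yx mulrBl -(mulrA x y) yx mulrBr -scalerAr -scalerAl.
rewrite !mulrA -addrA -opprD -mulr2n scalerMnl half2 scale1r.
by rewrite exprS expr2 mulrA.
Qed.

Lemma central_gen z : z * g = g * z -> z * gi = gi * z -> z * x = x * z ->
  z * y = y * z -> forall u, z * u = u * z.
Proof.
move=> zg zgi zx zy; apply: ind => [|u v zu zv|c u zu|u zu|u zu|u zu|u zu].
- by rewrite mulr1 mul1r.
- by rewrite mulrDr mulrDl zu zv.
- by rewrite -scalerAr -scalerAl zu.
- by rewrite mulrA zg -mulrA zu mulrA.
- by rewrite mulrA zgi -mulrA zu mulrA.
- by rewrite mulrA zx -mulrA zu mulrA.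
- by rewrite mulrA zy -mulrA zu mulrA.
Qed.

Lemma Omega_comm u : Om * u = u * Om.
Proof.
have gx2 : g * x ^+ 2 = x ^+ 2 * g by rewrite expr2 mulrA gx -mulrA gx mulrA.
have gix2 : gi * x ^+ 2 = x ^+ 2 * gi.
  by rewrite expr2 mulrA gi_x -mulrA gi_x mulrA.
move: u; apply: central_gen.
- by rewrite -mulrA gig mulr1 mulrA gx2 -mulrA ggi mulr1.
- by rewrite mulrA gix2.
- by rewrite -mulrA gi_x [LHS]mulrA [RHS]mulrA -exprS -exprSr.
- by rewrite -mulrA gi_y mulrA mulrBr -exprSr -y_x2 mulrA.
Qed.

Lemma gi_x2 : gi * x ^+ 2 = Om.
Proof. by rewrite expr2 mulrA gi_x -mulrA gi_x mulrA. Qed.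

Lemma x2_gi : x ^+ 2 = g * Om.
Proof. by rewrite -gi_x2 mulrA ggi mul1r. Qed.

(** [x] is normal: it moves past [y] at the price of the shift [y + x / 2]. *)
Lemma x_normal u : exists u', x * u = u' * x.
Proof.
move: u; apply: ind => [|u v [u' zu] [v' zv]|c u [u' zu]|u [u' zu]|u [u' zu]|
  u [u' zu]|u [u' zu]].
- by exists 1; rewrite mulr1 mul1r.
- by exists (u' + v'); rewrite mulrDr mulrDl zu zv.
- by exists (c *: u'); rewrite -scalerAr -scalerAl zu.
- by exists (g * u'); rewrite mulrA -gx -!mulrA zu.
- by exists (gi * u'); rewrite mulrA -gi_x -!mulrA zu.
- by exists (x * u'); rewrite -!mulrA zu.
- exists ((y + 2^-1 *: x) * u').
  by rewrite -mulrA -zu !mulrA mulrDl yx -scalerAl subrK.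
Qed.

Lemma xn_normal n u : exists u', x ^+ n * u = u' * x ^+ n.
Proof.
elim: n u => [|n IH] u; first by exists u; rewrite mulr1 mul1r.
have [u' xu] := x_normal u; have [v xnu] := IH u'.
by exists v; rewrite exprSr -mulrA xu mulrA xnu -mulrA.
Qed.

Section Ore.
Variables (C : idomainType) (cC : {rmorphism C -> R}) (h : C).
Hypothesis cC_comm : forall c u, cC c * u = u * cC c.
Hypothesis cC_h : cC h = 2^-1 *: 1.

Implicit Types (a b : {poly C}) (p q : {poly {poly C}}).

Let cC_x : commr_rmorph cC x. Proof. by move=> c; rewrite /GRing.comm cC_comm. Qed.

Definition evx : {poly C} -> R := horner_morph cC_x.
HB.instance Definition _ := GRing.RMorphism.on evx.

Lemma evxX : evx 'X = x. Proof. exact: horner_morphX. Qed.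
Lemma evxC c : evx c%:P = cC c. Proof. exact: horner_morphC. Qed.

(** An element [p] of [C[x][y]] stands for the element of [R] in which the
coefficients in [C[x]] are written on the left. *)
Definition evxy (p : {poly {poly C}}) : R := \sum_(i < size p) evx p`_i * y ^+ i.

Lemma evxyE n p : (size p <= n)%N -> evxy p = \sum_(i < n) evx p`_i * y ^+ i.
Proof.
move=> le_pn; rewrite /evxy (big_ord_widen _ (fun i => evx p`_i * y ^+ i) le_pn).
rewrite big_mkcond; apply: eq_bigr => i _; case: ltnP => // le_pi.
by rewrite nth_default // rmorph0 mul0r.
Qed.

Fact evxy_zmod_morphism : zmod_morphism evxy.
Proof.
move=> p q; pose n := maxn (size p) (size q).
rewrite (@evxyE n) ?(@evxyE n p) ?(@evxyE n q) ?leq_maxl ?leq_maxr //.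
  by rewrite -sumrB; apply: eq_bigr => i _; rewrite coefB rmorphB mulrBl.
by rewrite (leq_trans (size_polyD _ _)) ?size_polyN.
Qed.

HB.instance Definition _ := GRing.isZmodMorphism.Build _ _ evxy
  evxy_zmod_morphism.

Lemma evxyD p q : evxy (p + q) = evxy p + evxy q. Proof. exact: raddfD. Qed.
Lemma evxyB p q : evxy (p - q) = evxy p - evxy q. Proof. exact: raddfB. Qed.

Lemma evxyZ a p : evxy (a *: p) = evx a * evxy p.
Proof.
rewrite (@evxyE (size p)) ?size_scale_leq // /evxy mulr_sumr.
by apply: eq_bigr => i _; rewrite coefZ rmorphM mulrA.
Qed.

Lemma evxyC a : evxy a%:P = evx a.
Proof. by rewrite (@evxyE 1) ?size_polyC_leq1 // big_ord1 coefC mulr1. Qed.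

Lemma evxy_mulX p : evxy (p * 'X) = evxy p * y.
Proof.
rewrite (@evxyE (size p).+1); last first.
  by have [->|p0] := eqVneq p 0; rewrite ?mul0r ?size_poly0 ?size_mulX.
rewrite big_ord_recl coefMX rmorph0 mul0r add0r /evxy mulr_suml.
by apply: eq_bigr => i _; rewrite coefMX /= -mulrA -exprSr.
Qed.

(** The derivation of [C[x]] by which [y] acts: [y a = a y + xder a]. *)
Definition xder (a : {poly C}) : {poly C} := - (h%:P * 'X^2 * a^`()).

Lemma xder0 : xder 0 = 0.
Proof. by rewrite /xder linear0 mulr0 oppr0. Qed.

Lemma y_evx a : y * evx a = evx a * y + evx (xder a).
Proof.
elim/poly_ind: a => [|a c IH].
  by rewrite xder0 rmorph0 mulr0 mul0r addr0.
have dE : xder (a * 'X + c%:P) = xder a * 'X - h%:P * 'X^2 * a.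
  rewrite /xder derivD derivM derivX derivC addr0 mulr1 mulrDr opprD mulNr.
  by rewrite mulrA.
rewrite {}dE; move: (xder a) IH => D IH.
rewrite !(rmorphD, rmorphN, rmorphM) /= !evxX !evxC cC_h.
rewrite mulrDr mulrA IH mulrDl -mulrA yx mulrDl -[y * cC c]cC_comm.
have -> : 2^-1 *: 1 * (x * x) * evx a = evx a * (2^-1 *: (x * x)).
  rewrite -!scalerAl mul1r -scalerAr -evxX -!rmorphM; congr (_ *: evx _).
  by rewrite mulrC.
rewrite mulrBr !mulrA [RHS]addrA [LHS]addrAC.
by rewrite (addrAC _ (- _) (cC c * y)) [LHS]addrAC.
Qed.

Definition ymul p := p * 'X + map_poly xder p.

Lemma y_evxy p : y * evxy p = evxy (ymul p).
Proof.
rewrite raddfD /= evxy_mulX (@evxyE (size p) (map_poly _ _)) ?size_poly //.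
rewrite /evxy mulr_sumr mulr_suml -big_split; apply: eq_bigr => i _.
by rewrite coef_map_id0 ?xder0 // mulrA y_evx mulrDl -!mulrA -exprS exprSr.
Qed.

Lemma yn_evxy n p : y ^+ n * evxy p = evxy (iter n ymul p).
Proof.
by elim: n => [|n IH]; rewrite ?mul1r // exprS -mulrA IH y_evxy.
Qed.

Lemma coef_ymul p i : (ymul p)`_i.+1 = p`_i + xder p`_i.+1.
Proof. by rewrite coefD coefMX coef_map_id0 ?xder0. Qed.

Lemma coef_iter_ymul n p i :
  ((size p).-1 + n <= i)%N ->
  (iter n ymul p)`_i = if i == ((size p).-1 + n)%N then lead_coef p else 0.
Proof.
elim: n i => [|n IH] i.
  rewrite addn0 leq_eqVlt eq_sym => /orP[/eqP -> |lt_i]; first by rewrite eqxx.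
  rewrite gtn_eqF // nth_default //; move: lt_i; case: (size p) => //.
case: i => [|i]; rewrite addnS // ltnS => le_i.
rewrite /= coef_ymul IH // IH; last exact: leqW.
by rewrite eqSS [i.+1 == _]gtn_eqF ?ltnS // xder0 addr0.
Qed.

(** The product of [C[x][y]] that makes [evxy] multiplicative. *)
Definition ore_mul p q := \sum_(i < size p) p`_i *: iter i ymul q.

Lemma evxyM p q : evxy p * evxy q = evxy (ore_mul p q).
Proof.
rewrite raddf_sum /= {1}/evxy mulr_suml; apply: eq_bigr => i _.
by rewrite -mulrA yn_evxy evxyZ.
Qed.

(** Leading coefficients in [y] multiply as in the commutative case, because
the derivation only contributes to lower degrees. *)
Lemma ore_mul_neq0 p q : p != 0 -> q != 0 -> ore_mul p q != 0.
Proof.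
move=> p0 q0; apply/eqP => /(congr1 (fun r : {poly {poly C}} => r`_((size q).-1 + (size p).-1))).
apply/eqP; rewrite coef0 /ore_mul coef_sum.
have -> : size p = (size p).-1.+1 by rewrite prednK // lt0n size_poly_eq0.
rewrite big_ord_recr /= big1 => [|i _]; last first.
  rewrite coefZ coef_iter_ymul; last by rewrite leq_add2l ltnW.
  by rewrite eqn_add2l gtn_eqF ?mulr0.
rewrite add0r coefZ coef_iter_ymul // eqxx mulf_neq0 ?lead_coef_eq0 //.
Qed.

(** The inverse of [x] is, up to a factor [2], a coordinate conjugate to [y]: its
commutators differentiate in [y].  Multiplying by [x] on both sides expresses
this without the inverse. *)
Lemma evxy_comm_x p : x * evxy p - evxy p * x = 2^-1 *: (x * evxy p^`() * x).
Proof.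
elim/poly_ind: p => [|p a IH].
  by rewrite linear0 raddf0 !(mulr0, mul0r) subrr scaler0.
have ax : x * evx a = evx a * x by rewrite -evxX -!rmorphM mulrC.
rewrite derivD derivM derivX derivC addr0 mulr1 !(raddfD evxy) /= !evxy_mulX evxyC.
rewrite mulrDr mulrDl ax opprD addrACA subrr addr0.
set F := evxy p in IH *; set G := evxy p^`() in IH *.
have Fx : F * x = x * F - 2^-1 *: (x * G * x) by rewrite -IH opprB addrC subrK.
have Fyx : F * y * x = F * x * y - 2^-1 *: (F * x * x).
  by rewrite -[in LHS]mulrA yx mulrBr -scalerAr !mulrA.
have Gyx : x * (G * y) * x = x * G * x * y - 2^-1 *: (x * G * x * x).
  by rewrite -!mulrA yx !mulrBr -!scalerAr.
rewrite mulrDr mulrDl Fyx Gyx mulrA opprB addrA addrAC -mulrBl IH.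
rewrite -scalerAl scalerDr scalerBr -addrA; congr (_ + _).
by rewrite -scalerN -scalerDr addrC Fx mulrBl -scalerAl.
Qed.
End Ore.
End Bosonization.

(** * A faithful module *)

Section Model.
Variable k : fieldType.

(** The module coinduced from the action of the subalgebra generated by [x] and
[y] on [k[x][y]], that is, on itself: the value at [n] is the value of [g^n] on
the module map from [J], so that [g] acts as a shift and [y] as [y + n x]. *)
Definition model : Type := int -> {poly {poly k}}.
HB.instance Definition _ := GRing.Zmodule.on model.

Record endo := Endo {
  endo_fun :> model -> model;
  endoD : {morph endo_fun : u v / u + v} }.

HB.instance Definition _ := gen_eqMixin endo.
HB.instance Definition _ := gen_choiceMixin endo.

Lemma endoP (u v : endo) : (forall f n, u f n = v f n) -> u = v.
Proof.
case: u v => [u uD] [v vD] /= uv.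
have {}uv : u = v by apply/funext => f; apply/funext => n; exact: uv.
by case: _ / uv vD => vD; congr Endo; exact: Prop_irrelevance.
Qed.

Fact endo_add_subproof (u v : endo) : {morph (fun f => u f + v f) : f1 f2 / f1 + f2}.
Proof. by move=> f1 f2; rewrite !endoD addrACA. Qed.
Fact endo_zero_subproof : {morph (fun _ : model => 0 : model) : f1 f2 / f1 + f2}.
Proof. by move=> f1 f2; rewrite addr0. Qed.
Fact endo_opp_subproof (u : endo) : {morph (fun f => - u f) : f1 f2 / f1 + f2}.
Proof. by move=> f1 f2; rewrite endoD opprD. Qed.
Fact endo_mul_subproof (u v : endo) : {morph u \o v : f1 f2 / f1 + f2}.
Proof. by move=> f1 f2 /=; rewrite !endoD. Qed.
Fact endo_one_subproof : {morph (id : model -> model) : f1 f2 / f1 + f2}.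
Proof. by []. Qed.

Definition endo_add u v := Endo (endo_add_subproof u v).
Definition endo_zero := Endo endo_zero_subproof.
Definition endo_opp u := Endo (endo_opp_subproof u).
Definition endo_mul u v := Endo (endo_mul_subproof u v).
Definition endo_one := Endo endo_one_subproof.

Fact endo_addA : associative endo_add.
Proof. by move=> u v w; apply: endoP => f n /=; rewrite addrA. Qed.
Fact endo_addC : commutative endo_add.
Proof. by move=> u v; apply: endoP => f n /=; rewrite addrC. Qed.
Fact endo_add0 : left_id endo_zero endo_add.
Proof. by move=> u; apply: endoP => f n /=; rewrite add0r. Qed.
Fact endo_addN : left_inverse endo_zero endo_opp endo_add.
Proof. by move=> u; apply: endoP => f n /=; rewrite addNr. Qed.

HB.instance Definition _ := GRing.isZmodule.Build endo
  endo_addA endo_addC endo_add0 endo_addN.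

Fact endo_mulA : associative endo_mul.
Proof. by move=> u v w; apply: endoP. Qed.
Fact endo_mul1 : left_id endo_one endo_mul.
Proof. by move=> u; apply: endoP. Qed.
Fact endo_mulr1 : right_id endo_one endo_mul.
Proof. by move=> u; apply: endoP. Qed.
Fact endo_mulDl : left_distributive endo_mul +%R.
Proof. by move=> u v w; apply: endoP. Qed.
Fact endo_mulDr : right_distributive endo_mul +%R.
Proof. by move=> u v w; apply: endoP => f n /=; rewrite endoD. Qed.
Fact endo_one_neq0 : endo_one != 0.
Proof.
apply/eqP => /(congr1 (fun u : endo => u (fun=> 1) 0)) /=.
by move/eqP; rewrite oner_eq0.
Qed.

HB.instance Definition _ := GRing.Zmodule_isNzRing.Build endo
  endo_mulA endo_mul1 endo_mulr1 endo_mulDl endo_mulDr endo_one_neq0.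

Lemma endo_subE (u v : endo) f n : (u - v) f n = u f n - v f n.
Proof. by []. Qed.
Lemma endo_mulE (u v : endo) f : (u * v) f = u (v f).
Proof. by []. Qed.

Fact mscal_subproof c :
  {morph (fun (f : model) n => c%:P%:P * f n) : f1 f2 / f1 + f2}.
Proof. by move=> f1 f2; apply/funext => n; rewrite /= mulrDr. Qed.
Definition mscal (c : k) := Endo (mscal_subproof c).

Fact mscal_zmod_morphism : zmod_morphism mscal.
Proof. by move=> c d; apply: endoP => f n; rewrite /= !rmorphB mulrBl. Qed.
Fact mscal_monoid_morphism : monoid_morphism mscal.
Proof.
split=> [|c d]; apply: endoP => f n; first by rewrite /= !rmorph1 mul1r.
by rewrite /= !rmorphM mulrA.
Qed.

HB.instance Definition _ := GRing.isZmodMorphism.Build k endo mscal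
  mscal_zmod_morphism.
HB.instance Definition _ := GRing.isMonoidMorphism.Build k endo mscal
  mscal_monoid_morphism.

Local Notation h := (2^-1 : k).
Local Notation mX := ('X%:P : {poly {poly k}}).

Fact mshift_subproof m :
  {morph (fun (f : model) n => f (n + m)) : f1 f2 / f1 + f2}.
Proof. by []. Qed.
Definition mshift m := Endo (mshift_subproof m).

Fact mx_subproof : {morph (fun (f : model) n => mX * f n) : f1 f2 / f1 + f2}.
Proof. by move=> f1 f2; apply/funext => n; rewrite /= mulrDr. Qed.
Definition mx := Endo mx_subproof.

Lemma ymulD : {morph ymul h : p q / p + q}.
Proof.
move=> p q; apply/polyP => i; rewrite !(coefD, coefMX) !coef_map_id0 ?xder0 //.
have xderD (a b : {poly k}) : xder h (a + b) = xder h a + xder h b.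
  by rewrite /xder derivD mulrDr opprD.
by case: eqP => _; rewrite ?add0r coefD xderD // addrACA.
Qed.

Lemma ymulZ (a : {poly k}) p : xder h a = 0 -> ymul h (a *: p) = a *: ymul h p.
Proof.
move=> a0; rewrite /ymul scalerDr scalerAl; congr (_ + _); apply/polyP => i.
rewrite coefZ !coef_map_id0 ?xder0 // coefZ /xder derivM !mulrDr.
have -> : h%:P * 'X^2 * (a^`() * p`_i) = 0.
  by rewrite mulrA (oppr_inj (etrans a0 (esym (oppr0 _)))) mul0r.
by rewrite add0r mulrN !(mulrCA a).
Qed.

Lemma ymulMX p : ymul h (mX * p) = mX * ymul h p - (h%:P * 'X^2)%:P * p.
Proof.
rewrite /ymul mulrDr mulrA -addrA; congr (_ + _); apply/polyP => i.
rewrite coefB !coefCM !coef_map_id0 ?xder0 // coefCM /xder derivM derivX mul1r.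
by rewrite mulrDr opprD addrC mulrN !(mulrCA 'X).
Qed.

Fact my_subproof : {morph (fun (f : model) n => ymul h (f n) + mX *~ n * f n) :
   f1 f2 / f1 + f2}.
Proof. by move=> f1 f2; apply/funext => n; rewrite /= ymulD mulrDr addrACA. Qed.
Definition my := Endo my_subproof.

Definition at0 (w : {poly {poly k}}) : model := fun n => if n == 0 then w else 0.

Variables (R : algType k) (g gi x y : R).
Hypothesis hR : is_bosonization g gi x y.

(** The relation [g y = (y + x) g] holds because shifting turns [y + n x] into
[y + (n + 1) x]. *)
Lemma model_action : exists phi : {rmorphism R -> endo},
  [/\ phi g = mshift 1, phi gi = mshift (-1), phi x = mx & phi y = my] /\
  forall c u, phi (c *: u) = mscal c * phi u.
Proof.
apply: (bos_map hR) => [c|]; first split; last split.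
- by apply: endoP.
- by apply: endoP.
- by apply: endoP => f n; rewrite /= mulrCA.
- apply: endoP => f n; rewrite !endo_mulE /= mulrDr (mulrCA (mX *~ n)).
  by rewrite !mul_polyC ymulZ // /xder derivC mulr0 oppr0.
- by apply: endoP => f n; rewrite endo_mulE /= addrK.
- by apply: endoP => f n; rewrite endo_mulE /= subrK.
- by apply: endoP.
- apply: endoP => f n; rewrite endo_mulE /= mulrzDr mulrDl mulr1z.
  by rewrite addrA.
- apply: endoP => f n; rewrite endo_subE !endo_mulE /= ymulMX [in RHS]mulrDr.
  rewrite addrAC; congr (_ + _ - _); first by rewrite mulrCA.
  by rewrite polyCM expr2 polyCM !mulrA.
Qed.
End Model.

Section Faithful.
Variables (k : fieldType) (R : algType k) (g gi x y : R).
Hypothesis hR : is_bosonization g gi x y.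
Hypothesis char_k : [pchar k] =i pred0.

Local Notation Om := (x ^+ 2 * gi).
Local Notation mX := ('X%:P : {poly {poly k}}).

Let Om_comm := Omega_comm hR char_k.

Lemma scal_comm (c : k) (u : R) : in_alg R c * u = u * in_alg R c.
Proof. by rewrite mulr_algl mulr_algr. Qed.

Lemma horner_Omega_comm (c : {poly k}) u : horner_alg Om c * u = u * horner_alg Om c.
Proof.
elim/poly_ind: c => [|c d IH]; first by rewrite rmorph0 mul0r mulr0.
rewrite rmorphD rmorphM /= horner_algX horner_algC mulrDl mulrDr mulr_algl mulr_algr.
by rewrite -mulrA Om_comm !mulrA IH.
Qed.

Local Notation evxk := (evx x scal_comm).
Local Notation evk := (evxy x y scal_comm).
Local Notation evxO := (evx x horner_Omega_comm).
Local Notation evO := (evxy x y horner_Omega_comm).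

Section Action.
Variable phi : {rmorphism R -> endo k}.
Hypothesis phi_gen :
  [/\ phi g = mshift k 1, phi gi = mshift k (-1), phi x = mx k & phi y = my k].
Hypothesis phiZ : forall c u, phi (c *: u) = mscal c * phi u.

Let phg : phi g = mshift k 1. Proof. by case: phi_gen. Qed.
Let phgi : phi gi = mshift k (-1). Proof. by case: phi_gen. Qed.
Let phx : phi x = mx k. Proof. by case: phi_gen. Qed.
Let phy : phi y = my k. Proof. by case: phi_gen. Qed.

Lemma phiM u v f : phi (u * v) f = phi u (phi v f).
Proof. by rewrite rmorphM. Qed.
Lemma phiD u v f n : phi (u + v) f n = phi u f n + phi v f n.
Proof. by rewrite rmorphD. Qed.
Lemma phi0 f n : phi 0 f n = 0.
Proof. by rewrite rmorph0. Qed.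

Lemma phi_sum I (r : seq I) P (F : I -> R) f n :
  phi (\sum_(i <- r | P i) F i) f n = \sum_(i <- r | P i) phi (F i) f n.
Proof. by elim/big_rec2: _ => [|i a b _ <-]; rewrite ?phi0 ?phiD. Qed.

Section Coefficients.
Variables (C : idomainType) (cC : {rmorphism C -> R}).
Hypothesis cC_comm : forall c u, cC c * u = u * cC c.
Variable t : int -> C -> {poly k}.
Hypothesis t0 : forall n, t n 0 = 0.
Hypothesis phi_cC : forall c w n, phi (cC c) (at0 w) n = (t n c)%:P * w.

Lemma phi_evx a w n : phi (evx x cC_comm a) (at0 w) n =
  (\sum_(i < size a) t n a`_i * 'X^i)%:P * w.
Proof.
elim/poly_ind: a => [|a c IH]; first by rewrite rmorph0 phi0 size_poly0 big_ord0 mul0r.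
rewrite rmorphD rmorphM /= evxX evxC phiD phi_cC.
have -> : evx x cC_comm a * x = x * evx x cC_comm a.
  by rewrite -{2 3}(evxX x cC_comm) -!rmorphM mulrC.
rewrite phiM phx /= IH mulrA -mulrDl -polyCM -polyCD; congr (_%:P * w).
rewrite size_MXaddC; case: ifP => [/andP[/eqP -> /eqP ->]|_].
  by rewrite t0 size_poly0 !big_ord0 mulr0 addr0.
rewrite big_ord_recl coefD coefMX coefC /= add0r mulr1 addrC; congr (_ + _).
rewrite mulr_sumr; apply: eq_bigr => i _.
by rewrite coefD coefMX coefC /= addr0 exprS mulrCA.
Qed.

Lemma phi_yn i : phi (y ^+ i) (at0 1) = at0 'X^i.
Proof.
elim: i => [|i IH]; first by rewrite rmorph1.
rewrite exprS phiM IH phy; apply/funext => n /=; rewrite /at0.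
case: eqP => [->|_]; last by rewrite mulr0 addr0 /ymul mul0r add0r map_poly0.
rewrite mulr0z mul0r addr0 /ymul exprSr -[RHS]addr0; congr (_ + _).
apply/polyP => j; rewrite coef_map_id0 ?xder0 // coefXn coef0.
by rewrite /xder; case: eqP; rewrite ?derivC ?mulr0 ?oppr0 // linear0 mulr0 oppr0.
Qed.

(** Acting on the vector [at0 1] reads off the coefficients of an element
written in the form [evxy p]. *)
Lemma phi_evxy p n : phi (evxy x y cC_comm p) (at0 1) n =
  \poly_(m < size p) \sum_(i < size p`_m) t n p`_m`_i * 'X^i.
Proof.
rewrite /evxy phi_sum poly_def; apply: eq_bigr => i _.
by rewrite phiM phi_yn phi_evx mul_polyC.
Qed.
End Coefficients.

Lemma phi_scal c w n : phi (in_alg R c) (at0 w) n = (if n == 0 then c%:P else 0)%:P * w.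
Proof.
rewrite -[in_alg R c]/(c *: 1) phiZ rmorph1 mulr1 /= /at0; case: eqP => // _.
by rewrite mulr0 mul0r.
Qed.

Lemma phi_evk p n : phi (evk p) (at0 1) n = at0 p n.
Proof.
rewrite (phi_evxy _ _ phi_scal) /at0 => [|m]; last by rewrite polyC0 if_same.
case: eqP => [_|_].
  apply/polyP => i; rewrite coef_poly; case: ltnP => [_|le]; last first.
    by rewrite nth_default.
  rewrite -[RHS]coefK poly_def; apply: eq_bigr => j _; exact: mul_polyC.
apply/polyP => i; rewrite coef_poly coef0; case: ifP => // _.
by rewrite big1 // => j _; rewrite mul0r.
Qed.

Lemma phi_Omega f n : phi Om f n = ('X^2)%:P * f (n - 1).
Proof. by rewrite !phiM phgi rmorphXn phx /= mulrA. Qed.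

Definition Omega_coef (n : int) (c : {poly k}) : {poly k} :=
  if n is Posz l then c`_l *: 'X^(2 * l) else 0.

Lemma phi_horner_Omega c w n :
  phi (horner_alg Om c) (at0 w) n = (Omega_coef n c)%:P * w.
Proof.
elim/poly_ind: c n => [|c d IH] n.
  by rewrite rmorph0 phi0; case: n => n /=; rewrite ?coef0 ?scale0r mul0r.
rewrite rmorphD rmorphM /= horner_algX horner_algC horner_Omega_comm phiD.
rewrite phiM phi_Omega IH phi_scal; case: n => [[|n]|n] /=.
- rewrite !mul0r mulr0 add0r coefD coefMX coefC /= add0r muln0.
  by rewrite alg_polyC.
- rewrite mul0r addr0 coefD coefMX coefC /= addr0 subn1 mulrA -polyCM.
  by rewrite -scalerAr -exprD mulnS.
- by rewrite !mul0r mulr0 add0r.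
Qed.

Lemma phi_evO_inj p : (forall n, phi (evO p) (at0 1) n = 0) -> p = 0.
Proof.
move=> p0; apply/polyP => m; apply/polyP => i; apply/polyP => l; rewrite !coef0.
have := p0 (Posz l); rewrite (phi_evxy _ _ phi_horner_Omega); last first.
  by case=> n /=; rewrite ?coef0 ?scale0r.
move=> /polyP/(_ m); rewrite coef_poly coef0; case: ltnP => [_|le _]; last first.
  by rewrite (nth_default 0 le) !coef0.
move=> /polyP/(_ (2 * l + i)%N); rewrite coef0 coef_sum /=.
case: (ltnP i (size p`_m)) => [lt_i|le _]; last by rewrite (nth_default 0 le) coef0.
rewrite (bigD1 (Ordinal lt_i)) //= -scalerAl -exprD coefZ coefXn eqxx mulr1.
rewrite big1 ?addr0 // => j ne_j.
rewrite -scalerAl -exprD coefZ coefXn eqn_add2l.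
case: eqP => [ij|_]; last by rewrite mulr0.
by case/eqP: ne_j; exact/esym/val_inj.
Qed.

(** Polynomials in [g], with coefficients of the form [evk q] on the right; up to
a power of [g] every element has this form, see [evg_span]. *)
Definition evg (q : {poly {poly {poly k}}}) : R :=
  \sum_(j < size q) g ^+ j * evk q`_j.

Lemma evgE n (q : {poly {poly {poly k}}}) : (size q <= n)%N -> evg q = \sum_(j < n) g ^+ j * evk q`_j.
Proof.
move=> le; rewrite /evg (big_ord_widen _ (fun j => g ^+ j * evk q`_j) le).
rewrite big_mkcond; apply: eq_bigr => i _; case: ltnP => // le_i.
by rewrite nth_default // raddf0 mulr0.
Qed.

Lemma phi_gn j f n : phi (g ^+ j) f n = f (n + j%:Z).
Proof.
elim: j f n => [|j IH] f n; first by rewrite rmorph1 addr0.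
by rewrite exprSr phiM IH phg /= -addrA intS [1 + _]addrC.
Qed.

Lemma phi_evg_inj q : (forall n, phi (evg q) (at0 1) n = 0) -> q = 0.
Proof.
move=> q0; apply/polyP => j; rewrite coef0.
case: (ltnP j (size q)) => [lt_j|]; last exact: nth_default.
have := q0 (- j%:Z); rewrite /evg phi_sum (bigD1 (Ordinal lt_j)) //= big1 => [|i ne].
  by rewrite phiM phi_gn addNr phi_evk /at0 eqxx addr0.
rewrite phiM phi_gn phi_evk /at0; case: eqP => // /eqP.
rewrite addrC subr_eq0 eqz_nat => /eqP ij; case/eqP: ne; exact: val_inj.
Qed.
Lemma evk_half : in_alg R (2^-1 : k) = 2^-1 *: 1.
Proof. by []. Qed.

Lemma evgD q r : evg (q + r) = evg q + evg r.
Proof.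
pose n := maxn (size q) (size r).
rewrite (@evgE n) ?(@evgE n q) ?(@evgE n r) ?leq_maxl ?leq_maxr ?size_polyD //.
by rewrite -big_split; apply: eq_bigr => i _; rewrite coefD raddfD mulrDr.
Qed.

Lemma evgMX q : evg (q * 'X) = g * evg q.
Proof.
rewrite (@evgE (size q).+1); last first.
  by have [->|q0] := eqVneq q 0; rewrite ?mul0r ?size_poly0 ?size_mulX.
rewrite big_ord_recl coefMX raddf0 mulr0 add0r /evg mulr_sumr.
by apply: eq_bigr => i _; rewrite coefMX /= mulrA -exprS.
Qed.

Lemma evgMXn n q : evg (q * 'X^n) = g ^+ n * evg q.
Proof.
elim: n => [|n IH]; first by rewrite mulr1 mul1r.
by rewrite exprSr mulrA evgMX IH mulrA -exprS.
Qed.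

Lemma evg_poly n F : evg (\poly_(j < n) F j) = \sum_(j < n) g ^+ j * evk (F j).
Proof.
rewrite (evgE (size_poly _ _)); apply: eq_bigr => i _.
by rewrite coef_poly ltn_ord.
Qed.

Lemma gn_y n : g ^+ n * y = (y + x *+ n) * g ^+ n.
Proof.
have [_ _ gx gy _ _ _] := hR.
elim: n => [|n IH]; first by rewrite mul1r mulr1 addr0.
rewrite exprS -mulrA IH !mulrA mulrDr gy mulrnAr gx -mulrnAl -mulrDl.
by rewrite -addrA -mulrS -!mulrA.
Qed.

Lemma gn_x n : g ^+ n * x = x * g ^+ n.
Proof.
have [_ _ gx _ _ _ _] := hR.
elim: n => [|n IH]; first by rewrite mul1r mulr1.
by rewrite exprS -mulrA IH !mulrA gx.
Qed.

Lemma evg_span u : exists N q, g ^+ N * u = evg q.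
Proof.
have [ggi gig gx gy yx ind _] := hR.
move: u; apply: ind => [|u v [N [p up]] [M [q vq]]|c u [N [p up]]|u [N [p up]]|
  u [N [p up]]|u [N [p up]]|u [N [p up]]].
- exists 0%N, 1; rewrite mulr1 (@evgE 1) ?size_poly1 // big_ord1 mul1r coef1.
  by rewrite -[RHS]/(evk 1) -[1 in RHS]polyC1 evxyC rmorph1.
- exists (N + M)%N, (p * 'X^M + q * 'X^N).
  rewrite evgD !evgMXn -up -vq mulrDr !mulrA -!exprD; congr (_ * _ + _ * _).
  by rewrite addnC.
- exists N, (\poly_(j < size p) (c%:P *: p`_j)).
  rewrite evg_poly -scalerAr up /evg scaler_sumr; apply: eq_bigr => i _.
  by rewrite evxyZ evxC mulr_algl scalerAr.
- by exists N, (p * 'X); rewrite mulrA -exprSr exprS -mulrA up evgMX.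
- by exists N.+1, p; rewrite exprSr !mulrA -(mulrA _ g) ggi mulr1.
- exists N, (\poly_(j < size p) ('X *: p`_j)).
  rewrite evg_poly mulrA gn_x -mulrA up /evg mulr_sumr; apply: eq_bigr => i _.
  by rewrite evxyZ evxX mulrA -gn_x -mulrA.
- exists N, (\poly_(j < size p) (ymul 2^-1 p`_j + ('X *~ (N%:Z - j%:Z)) *: p`_j)).
  rewrite evg_poly mulrA gn_y -mulrA up /evg mulr_sumr; apply: eq_bigr => i _.
  have evxz m : evxk ('X *~ m) = x *~ m by rewrite rmorphMz /= evxX.
  rewrite evxyD -(y_evxy hR scal_comm evk_half) evxyZ evxz.
  rewrite -mulrDl !mulrA; congr (_ * _).
  rewrite mulrDr gn_y mulrzAr gn_x -mulrzAl -mulrDl -addrA; congr ((_ + _) * _).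
  by rewrite !pmulrn -mulrzDr addrC subrK.
Qed.

(** The coefficients of [g^N u] can be read off the image of [at0 1], hence
vanish together with it. *)
Lemma model_faithful u : phi u (at0 1) = 0 -> u = 0.
Proof.
have [_ gig _ _ _ _ _] := hR.
have [N [q uq]] := evg_span u => u0.
have q0 : q = 0.
  apply: phi_evg_inj => n; rewrite -uq phiM u0.
  by have := phi0 0 n; rewrite phi_gn.
have gu0 : g ^+ N * u = 0 by rewrite uq q0 /evg size_poly0 big_ord0.
have : gi ^+ N * g ^+ N * u = 0 by rewrite -mulrA gu0 mulr0.
have -> : gi ^+ N * g ^+ N = 1; last by rewrite mul1r.
elim: (N) => [|n IH]; first by rewrite mulr1.
by rewrite exprSr exprS mulrA -(mulrA _ gi) gig mulr1.
Qed.
End Action.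

Lemma evO_inj p : evO p = 0 -> p = 0.
Proof.
have [phi [phi_gen phiZ]] := model_action hR => p0.
by apply: (phi_evO_inj phi_gen phiZ) => n; rewrite p0 rmorph0.
Qed.

(** On the faithful module [Omega] acts as multiplication by [x^2] after a shift,
which is injective. *)
Lemma Omega_regular u : Om * u = 0 -> u = 0.
Proof.
have [phi [phi_gen phiZ]] := model_action hR => u0.
apply: (model_faithful phi_gen phiZ); apply/funext => n.
have := phi_Omega phi_gen (phi u (at0 1)) (n + 1).
rewrite -phiM u0 rmorph0 addrK => /esym/eqP.
by rewrite mulf_eq0 polyC_eq0 expf_eq0 polyX_eq0 => /eqP.
Qed.

End Faithful.

(** * Ideals met through normal forms *)


Lemma deriv_eq0 (C : idomainType) (p : {poly C}) : [pchar C] =i pred0 ->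
  p^`() = 0 -> p = (p`_0)%:P.
Proof.
move=> char_C dp0; apply: size1_polyC; rewrite leqNgt; apply/negP => lt1.
have := congr1 (fun q : {poly C} => q`_(size p).-2) dp0.
rewrite coef0 coef_deriv -mulr_natr => /eqP; rewrite mulf_eq0.
have -> : (size p).-2.+1 = (size p).-1 by case: (size p) lt1 => [|[]].
rewrite [X in _ || X](iffLR (pcharf0P C) char_C) -[p`__]/(lead_coef p).
by rewrite lead_coef_eq0 -size_poly_eq0; case: (size p) lt1 => [|[]].
Qed.

Section AboveIdeal.
Variables (k : fieldType) (R : algType k) (g gi x y : R).
Hypothesis hR : is_bosonization g gi x y.
Hypothesis char_k : [pchar k] =i pred0.
Variables (C : idomainType) (cC : {rmorphism C -> R}) (h : C).
Hypothesis char_C : [pchar C] =i pred0.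
Hypothesis cC_comm : forall c u, cC c * u = u * cC c.
Hypothesis cC_h : cC h = 2^-1 *: 1.

Local Notation Om := (x ^+ 2 * gi).
Local Notation s := (Om * x ^+ 2).
Local Notation evx := (evx x cC_comm).
Local Notation evxy := (evxy x y cC_comm).

Let Om_comm := Omega_comm hR char_k.

Let xn_evx n a : x ^+ n * evx a = evx ('X^n * a).
Proof. by rewrite rmorphM rmorphXn /= evxX. Qed.

Let x_evx a : x * evx a = evx ('X * a). Proof. exact: (xn_evx 1). Qed.

Let evx_xn n a : evx a * x ^+ n = x ^+ n * evx a.
Proof. by rewrite xn_evx mulrC rmorphM rmorphXn /= evxX. Qed.

(* This covers [P = 0], with [C = k[Omega]], and [P = (Omega - a)], with
   [C = k]. *)
Variable P : set R.
Hypothesis idP : is_ideal P.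
Hypothesis P_inj : forall p, P (evxy p) -> p = 0.
Hypothesis P_Omega : forall u, P (Om * u) -> P u.
Hypothesis P_cover : forall u, exists N p, P (s ^+ N * u - evxy p).

(** [gi s = Omega^2], so cancelling [s] reduces to cancelling [Omega]. *)
Lemma sn_cancel N u : P (s ^+ N * u) -> P u.
Proof.
have [_ _ PM] := idP.
elim: N => [|N IH]; first by rewrite mul1r.
rewrite exprS -mulrA => /(PM gi)[+ _].
have -> : gi * (s * (s ^+ N * u)) = Om * (Om * (s ^+ N * u)).
  have := gi_x2 hR; have := Om_comm; set O := Om; clearbody O => OC gix.
  by rewrite -(mulrA O) (mulrA gi O) -OC -(mulrA O) (mulrA gi (x ^+ 2)) gix.
by move=> /P_Omega/P_Omega/IH.
Qed.

Lemma sn_normal N u : exists u', s ^+ N * u = u' * s ^+ N.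
Proof.
have Omn_comm n w : Om ^+ n * w = w * Om ^+ n.
  by apply/commr_sym/commrX; exact/esym/Om_comm.
have sE : s ^+ N = Om ^+ N * x ^+ (2 * N) by rewrite exprMn_comm -?exprM.
have [u' xu] := xn_normal hR (2 * N) u.
by exists u'; rewrite sE -mulrA xu mulrA Omn_comm -mulrA.
Qed.

(** Once the denominators are cleared, [u v] becomes the product of two elements
[evxy p] and [evxy q], and [ore_mul_neq0] applies; normality of [s] is what
allows a denominator between [u] and [v] to be moved to the left. *)
Lemma completely_prime_mod u v : P (u * v) -> P u \/ P v.
Proof.
have [P0 PB PM] := idP.
have PD a b : P a -> P (a + b) -> P b := @ideal_addl _ P a b idP.
have [M [q vq]] := P_cover v => Puv.
have [u1 su] := sn_normal M u.
have [N [p up]] := P_cover u1.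
have Pu1q : P (u1 * evxy q).
  apply: (PD (u1 * (s ^+ M * v - evxy q))); first by have [] := PM u1 _ vq.
  by rewrite -mulrDr subrK mulrA -su -mulrA; have [] := PM (s ^+ M) _ Puv.
have Ppq : P (evxy p * evxy q).
  apply: (PD ((s ^+ N * u1 - evxy p) * evxy q)).
    by have [] := PM (evxy q) _ up.
  by rewrite -mulrDl subrK -mulrA; have [] := PM (s ^+ N) _ Pu1q.
have : ore_mul h p q = 0 by apply: P_inj; rewrite -(evxyM hR cC_comm cC_h).
have [p0 _|p0] := eqVneq p 0; last have [q0 _|q0] := eqVneq q 0.
- left; apply: (@sn_cancel M); rewrite su.
  have [] // := PM (s ^+ M) u1; apply: (@sn_cancel N).
  by move: up; rewrite p0 raddf0 subr0.
- by right; apply: (@sn_cancel M); move: vq; rewrite q0 raddf0 subr0.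
- by move/eqP; rewrite (negPf (ore_mul_neq0 _ p0 q0)).
Qed.

(** An ideal strictly above [P] contains some [evxy p] with [p <> 0];
commutators with [x] differentiate [p] in [y], and then commutators with [y]
differentiate in [x], until only a constant is left. *)
Lemma ideal_above_mod (I : set R) u : is_ideal I -> P `<=` I -> I u -> ~ P u ->
  exists N c, c != 0 /\ I (Om ^+ N * cC c).
Proof.
move=> [I0 IB IM] PI Iu nPu.
have IL r a : I a -> I (r * a) by move/(IM r) => [].
have IR r a : I a -> I (a * r) by move/(IM r) => [].
have IZ c a : I a -> I (c *: a) by rewrite -mulr_algl; apply: IL.
have half c : c = 2 *: (2^-1 *: c) :> R.
  by rewrite scalerA mulfV ?scale1r // (natr_neq0 char_k 1).
pose Q (p : {poly {poly C}}) := p != 0 /\ exists N M, I (x ^+ N * evxy p * x ^+ M).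
have [p [[p0 [N [M Ip]]] min_p]] : exists p, Q p /\ forall q, Q q -> (size p <= size q)%N.
  apply: min_size; have [N [p up]] := P_cover u; exists p; split.
    apply/eqP => p0; apply: nPu; apply: (@sn_cancel N).
    by move: up; rewrite p0 raddf0 subr0.
  exists 0%N, 0%N; rewrite mul1r mulr1 -(subKr (s ^+ N * u) (evxy p)).
  by apply: IB; [exact: IL|exact: PI].
have Idp : I (x ^+ N.+1 * evxy p^`() * x ^+ M.+1).
  have -> : x ^+ N.+1 * evxy p^`() * x ^+ M.+1 =
      2 *: (x * (x ^+ N * evxy p * x ^+ M) - x ^+ N * evxy p * x ^+ M * x).
    have -> : x * (x ^+ N * evxy p * x ^+ M) - x ^+ N * evxy p * x ^+ M * x =
        x ^+ N * (x * evxy p - evxy p * x) * x ^+ M.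
      rewrite mulrBr mulrBl !mulrA -exprS -exprSr -!mulrA; congr (_ - _ * (_ * _)).
      by rewrite -exprS -exprSr.
    rewrite (evxy_comm_x hR) -scalerAr -scalerAl -half.
    by rewrite exprSr exprS !mulrA.
  by apply/IZ/IB; [exact: IL|exact: IR].
have dp0 : p^`() = 0.
  apply/eqP; apply/negPn/negP => dp0.
  suff /min_p : Q p^`() by rewrite leqNgt lt_size_deriv.
  by split=> //; exists N.+1, M.+1.
have pE : p = (p`_0)%:P.
  apply: size1_polyC; rewrite leqNgt; apply/negP => lt1.
  have char_CX : [pchar {poly C}] =i pred0 by move=> n; rewrite pchar_poly.
  by move: lt1; rewrite (deriv_eq0 char_CX dp0) ltnNge size_polyC_leq1.
pose Q1 (a : {poly C}) := a != 0 /\ exists N, I (x ^+ N * evx a).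
have ex_Q1 : exists a, Q1 a.
  exists p`_0; split; first by move: p0; rewrite pE polyC_eq0 coefC.
  exists (N + M)%N; move: Ip; rewrite pE evxyC coefC /= -mulrA.
  by rewrite evx_xn mulrA -exprD.
have [a [[a0 [L Ia]] min_a]] := min_size ex_Q1.
have ILa : I (evx ('X^L * a)) by rewrite -xn_evx.
have Ida : I (x ^+ L.+2 * evx a^`()).
  have -> : x ^+ L.+2 * evx a^`() =
      - (2 *: evx (xder h ('X^L * a))) - (x * evx ('X^L * a)) *+ L.
    have -> : x * evx ('X^L * a) *+ L = evx ('X^2 * (('X^(L.-1) *+ L) * a)).
      rewrite x_evx -rmorphMn; congr evx.
      case: (L) => [|n]; first by rewrite mulr0n mul0r mulr0.
      by rewrite mulrnAl mulrnAr !mulrA -exprS -exprD.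
    have hE : 2 *: evx h%:P = 1.
      by rewrite evxC cC_h scalerA mulfV ?scale1r // (natr_neq0 char_k 1).
    have -> : xder h ('X^L * a) =
        - (h%:P * ('X^2 * (('X^(L.-1) *+ L) * a + 'X^L * a^`()))).
      by rewrite /xder derivM derivXn mulrA.
    rewrite rmorphN scalerN opprK rmorphM scalerAl hE mul1r -rmorphB.
    by rewrite mulrDr [_ + 'X^2 * _]addrC addrK mulrA -exprD xn_evx.
  have IN w : I w -> I (- w) by rewrite -sub0r => Iw; exact: IB.
  apply: (IB); first apply/IN/IZ.
    have -> : evx (xder h ('X^L * a)) = y * evx ('X^L * a) - evx ('X^L * a) * y.
      by rewrite (y_evx hR cC_comm cC_h) addrC addKr.
    by apply: (IB); [exact: IL|exact: IR].
  by rewrite -mulr_natl; apply/IL/IL.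
have a1 : a^`() = 0.
  apply/eqP; apply/negPn/negP => da0.
  suff /min_a : Q1 a^`() by rewrite leqNgt lt_size_deriv.
  by split=> //; exists L.+2.
have aE := deriv_eq0 char_C a1; exists L, a`_0; split.
  by apply: contra_neq a0; rewrite {2}aE => ->.
have -> : Om ^+ L = gi ^+ L * x ^+ L * x ^+ L.
  rewrite -(gi_x2 hR) exprMn_comm -?mulrA -?exprD ?addnn -?mul2n ?exprM //.
  by rewrite /GRing.comm (gi_x2 hR).
by rewrite -mulrA; apply: IL; rewrite -(evxC x cC_comm) -aE.
Qed.
End AboveIdeal.

Section ZeroAndOmega.
Variables (k : fieldType) (R : algType k) (g gi x y : R).
Hypothesis hR : is_bosonization g gi x y.
Hypothesis char_k : [pchar k] =i pred0.

Local Notation Om := (x ^+ 2 * gi).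
Local Notation s := (Om * x ^+ 2).
Local Notation hO := (horner_alg Om).
Local Notation hO_comm := (horner_Omega_comm hR char_k).
Local Notation evxO := (evx x hO_comm).
Local Notation evO := (evxy x y hO_comm).
Local Notation evxk := (evx x (@scal_comm k R)).
Local Notation evk := (evxy x y (@scal_comm k R)).

Let Om_comm := Omega_comm hR char_k.

Lemma hO_half : hO (2^-1)%:P = 2^-1 *: 1.
Proof. exact: horner_algC. Qed.

Lemma evxO_C c : evxO c%:P = hO c. Proof. exact: evxC. Qed.

(** The powers of [s] are denominators for [g] and its inverse: [s g = x^4] and
[s gi = Omega^2]. *)
Lemma Omega_cover u : exists N p, s ^+ N * u = evO p.
Proof.
have [ggi gig gx gy yx ind _] := hR.
pose sP : {poly {poly k}} := 'X%:P * 'X^2.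
have sE : evxO sP = s by rewrite rmorphM rmorphXn /= evxX evxO_C horner_algX.
have snE N p : s ^+ N * evO p = evO (sP ^+ N *: p).
  by rewrite evxyZ rmorphXn /= sE.
have sx : s * x = x * s by rewrite -(mulrA Om) -exprSr exprS (mulrA Om) (Om_comm x) -(mulrA x).
have sy : s * y = (y + x) * s.
  have x2y : x ^+ 2 * y = (y + x) * x ^+ 2.
    by rewrite mulrDl (y_x2 hR char_k) -exprS subrK.
  by rewrite -(mulrA Om) x2y (mulrA Om) Om_comm -mulrA.
have sny N : s ^+ N * y = (y + x *+ N) * s ^+ N.
  elim: N => [|N IH]; first by rewrite mul1r mulr1 addr0.
  rewrite exprS -(mulrA s) IH (mulrA s) mulrDr sy mulrnAr sx -mulrnAl -mulrDl.
  by rewrite -addrA -mulrS -(mulrA _ s).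
have snx N : s ^+ N * x = x * s ^+ N by apply/commr_sym/commrX/esym.
have xE p : x * evO p = evO ('X *: p) by rewrite evxyZ evxX.
move: u; apply: ind => [|u v [N [p up]] [M [q vq]]|c u [N [p up]]|u [N [p up]]|
  u [N [p up]]|u [N [p up]]|u [N [p up]]].
- by exists 0%N, 1; rewrite mulr1 -polyC1 evxyC rmorph1.
- exists (N + M)%N, (sP ^+ M *: p + sP ^+ N *: q).
  rewrite raddfD /= -!snE -up -vq mulrDr !mulrA -!exprD; congr (_ * _ + _ * _).
  by rewrite addnC.
- exists N, (c%:P%:P *: p).
  by rewrite evxyZ evxO_C horner_algC mulr_algl -scalerAr up.
- exists N.+1, ('X^4 *: p).
  have sg : s * g = x ^+ 4.
    rewrite -(mulrA Om); have -> : x ^+ 2 * g = g * x ^+ 2.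
      by apply/commr_sym/commrX.
    by rewrite mulrA -(mulrA _ gi) gig mulr1 -exprD.
  have sn4 : s ^+ N * x ^+ 4 = x ^+ 4 * s ^+ N by apply/commrX/snx.
  rewrite exprSr -(mulrA _ s) (mulrA s) sg (mulrA (s ^+ N)) sn4 -(mulrA _ (s ^+ N)).
  by rewrite up evxyZ rmorphXn /= evxX.
- exists N.+1, (('X ^+ 2)%:P *: p).
  have sgi : s * gi = Om * Om by rewrite -(mulrA Om).
  rewrite exprSr -(mulrA _ s) (mulrA s) sgi evxyZ -up evxO_C rmorphXn /=.
  by rewrite horner_algX expr2 -(mulrA Om) mulrA -Om_comm -!(mulrA Om) (mulrA (s ^+ N)) -Om_comm -(mulrA Om).
- by exists N, ('X *: p); rewrite mulrA snx -mulrA up xE.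
- exists N, (ymul (2^-1)%:P p + ('X *+ N) *: p).
  rewrite evxyD -(y_evxy hR hO_comm hO_half) evxyZ rmorphMn /=.
  by rewrite evxX -up (mulrA (s ^+ N)) sny -(mulrA _ (s ^+ N)) mulrDl.
Qed.

Lemma char_poly0 (C : idomainType) : [pchar C] =i pred0 ->
  [pchar {poly C}] =i pred0.
Proof. by move=> char_C n; rewrite pchar_poly. Qed.

Lemma set0_ideal : @is_ideal R [set 0].
Proof.
split=> // [a b|r a]; first by move=> /= -> ->; rewrite subrr.
by move=> /= ->; rewrite mulr0 mul0r.
Qed.

Lemma zero_inj p : [set (0 : R)] (evO p) -> p = 0.
Proof. exact: evO_inj. Qed.

Lemma zero_cover u : exists N p, [set (0 : R)] (s ^+ N * u - evO p).
Proof. by have [N [p up]] := Omega_cover u; exists N, p; rewrite /= up subrr. Qed.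

Lemma domain_R (u v : R) : u * v = 0 -> u = 0 \/ v = 0.
Proof.
move=> uv.
exact: (completely_prime_mod hR char_k hO_half set0_ideal zero_inj
          (@Omega_regular _ _ _ _ _ _ hR) zero_cover uv).
Qed.

(** The constants provided by [ideal_above_mod] are here polynomials in [Omega],
and these are central. *)
Lemma ideal_meets_center (I : set R) u : is_ideal I -> I u -> u <> 0 ->
  exists2 c, c != 0 & I (hO c).
Proof.
move=> idI Iu u0; have [I0 _ _] := idI.
have [||N [c [c0 Ic]]] := ideal_above_mod hR char_k (char_poly0 char_k)
    hO_half set0_ideal (@Omega_regular _ _ _ _ _ _ hR) zero_cover idI _ Iu.
- by move=> w ->.
- exact: u0.
exists ('X^N * c); first by rewrite mulf_neq0 ?expf_neq0 ?polyX_eq0.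
by rewrite rmorphM rmorphXn /= horner_algX.
Qed.

Lemma hO_inj c : hO c = 0 -> c = 0.
Proof.
move=> c0; have := @evO_inj k R g gi x y hR char_k c%:P%:P.
by rewrite evxyC evxO_C => /(_ c0)/eqP; rewrite !polyC_eq0 => /eqP.
Qed.

Section OmegaMinus.
Variable a : k.
Hypothesis a0 : a != 0.
Let P : set R := ideal_gen [set Om - a%:A].

Lemma Omega_idealP u : P u <-> exists v, u = (Om - a%:A) * v.
Proof.
have Oa_comm v : (Om - a%:A) * v = v * (Om - a%:A).
  by rewrite mulrBl mulrBr Om_comm mulr_algl mulr_algr.
split=> [|[v ->]]; last first.
  by have [_ _ PM] := ideal_gen_ideal [set Om - a%:A]; have [] := PM v _ (sub_ideal_gen erefl).
apply: (@ideal_genP _ _ [set u | exists v, u = (Om - a%:A) * v]) => [|_ ->];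
  last by exists 1; rewrite mulr1.
split=> [|_ _ [v ->] [w ->]|r _ [v ->]]; first by exists 0; rewrite mulr0.
  by exists (v - w); rewrite (mulrBr _ v).
split; last by exists (v * r); rewrite (mulrA _ v).
by exists (r * v); rewrite (mulrA r) -Oa_comm -(mulrA _ r).
Qed.

Let idP : is_ideal P. Proof. exact: ideal_gen_ideal. Qed.

Let P_Oa u : P (Om * u - a *: u).
Proof. by apply/Omega_idealP; exists u; rewrite mulrBl mulr_algl. Qed.

Let PZ c u : P u -> P (c *: u).
Proof. by rewrite -mulr_algl => Pu; have [_ _ /(_ c%:A u Pu)[]] := idP. Qed.

Lemma Omega_ideal_Omega u : P (Om * u) -> P u.
Proof.
have [_ PB _] := idP => POu.
have /(PZ a^-1) : P (a *: u) by rewrite -(subKr (Om * u) (a *: u)); exact: PB.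
by rewrite scalerA mulVf // scale1r.
Qed.

Let eva (p : {poly {poly {poly k}}}) : {poly {poly k}} :=
  map_poly (map_poly (horner_eval a)) p.

(** Modulo [Omega - a] the central variable specializes to [a]. *)
Lemma Omega_ideal_specialize p : P (evO p - evk (eva p)).
Proof.
have [P0 PB PM] := idP.
have PN u : P u -> P (- u) by move=> Pu; rewrite -sub0r; exact: PB.
have PD u v : P u -> P v -> P (u + v).
  by move=> Pu Pv; rewrite -(opprK v); apply: PB => //; exact: PN.
have PL r u : P u -> P (r * u) by move/(PM r) => [].
have PR r u : P u -> P (u * r) by move/(PM r) => [].
have POa : P (Om - a%:A) by apply: sub_ideal_gen.
have Pstep (u v w : R) b c : P (u - v) -> P (b - c) -> P (u * w + b - (v * w + c)).
  by move=> uv bc; rewrite opprD addrACA -mulrBl; apply: PD => //; exact: PR.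
have Pc c : P (hO c - c.[a]%:A).
  elim/poly_ind: c => [|c d IH]; first by rewrite rmorph0 horner0 scale0r subrr; exact: P0.
  rewrite hornerMXaddC rmorphD rmorphM /= horner_algX horner_algC.
  have -> : hO c * Om + d%:A - (c.[a] * a + d)%:A =
      hO c * (Om - a%:A) + (hO c - c.[a]%:A) * a%:A.
    rewrite (mulrBr (hO c)) mulrBl addrA subrK scalerDl opprD addrACA subrr addr0.
    by rewrite -scalerAl mul1r scalerA.
  by apply: PD; [exact: PL|exact: PR].
have Px b : P (evxO b - evxk (map_poly (horner_eval a) b)).
  elim/poly_ind: b => [|b c IH]; first by rewrite map_poly0 !rmorph0 subr0; exact: P0.
  rewrite !(rmorphD, rmorphM) /= map_polyX map_polyC /= !evxX evxO_C evxC.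
  exact: Pstep.
elim/poly_ind: p => [|p b IH]; first by rewrite /eva map_poly0 (raddf0 evO) (raddf0 evk) subr0; exact: P0.
rewrite /eva !(rmorphD, rmorphM) /= map_polyX map_polyC /= !(raddfD evO, raddfD evk) /=.
rewrite !evxy_mulX !evxyC; exact: Pstep.
Qed.

(** If [evk q = (Omega - a) w], clearing the denominator of [w] gives an equality
of polynomials in [Omega], [x] and [y].  At [Omega = a] it says that a power of
[a x^2] kills [q]. *)
Lemma Omega_ideal_inj (q : {poly {poly k}}) : P (evk q) -> q = 0.
Proof.
move=> /Omega_idealP[w qw]; have [N [p wp]] := Omega_cover w.
pose up : {poly {poly k}} -> {poly {poly {poly k}}} := map_poly (map_poly polyC).
have upE (r : {poly {poly k}}) : evk r = evO (up r).
  have upx (b : {poly k}) : evxk b = evxO (map_poly polyC b).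
    elim/poly_ind: b => [|b c IH]; first by rewrite !rmorph0.
    rewrite !(rmorphD, rmorphM) /= map_polyX map_polyC /= !evxX evxO_C evxC IH.
    by rewrite horner_algC.
  elim/poly_ind: r => [|r b IH]; first by rewrite /up rmorph0 !raddf0.
  rewrite /up !(rmorphD, rmorphM) /= map_polyX map_polyC /= !(raddfD evO, raddfD evk) /=.
  by rewrite !evxy_mulX !evxyC IH upx.
pose sP : {poly {poly k}} := 'X%:P * 'X^2.
have sE : evxO sP = s by rewrite rmorphM rmorphXn /= evxX evxO_C horner_algX.
have e : sP ^+ N *: up q = ('X - a%:P)%:P *: p.
  apply/eqP; rewrite -subr_eq0; apply/eqP.
  suff : evO (sP ^+ N *: up q - ('X - a%:P)%:P *: p) = 0 by move/zero_inj.
  rewrite evxyB !evxyZ rmorphXn /= sE -upE qw -wp.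
  rewrite evxO_C rmorphB /= horner_algX horner_algC.
  have Oa_comm v : (Om - a%:A) * v = v * (Om - a%:A).
    by rewrite mulrBl mulrBr Om_comm mulr_algl mulr_algr.
  by rewrite (mulrA (s ^+ N)) -Oa_comm -(mulrA _ (s ^+ N)) subrr.
apply/polyP => i; apply/polyP => j; rewrite !coef0.
have := congr1 (fun r : {poly {poly {poly k}}} => map_poly (horner_eval a) r`_i) e.
rewrite !coefZ !rmorphM rmorphXn /= map_polyC /= /horner_eval hornerXsubC subrr.
rewrite polyC0 mul0r => /eqP; rewrite mulf_eq0 expf_eq0.
have -> : map_poly (horner_eval a) sP = a%:P * 'X^2.
  by rewrite rmorphM /= map_polyC /= map_polyXn /horner_eval hornerX.
rewrite mulf_eq0 polyC_eq0 (negPf a0) expf_eq0 polyX_eq0 /= andbF /=.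
move=> /eqP/(congr1 (fun r : {poly k} => r`_j)).
by rewrite coef_map_id0 ?horner0 // /up coef_map /= coef_map /= hornerC coef0.
Qed.

Lemma Omega_ideal_cover u : exists N q, P (s ^+ N * u - evk q).
Proof.
have [N [p up]] := Omega_cover u.
by exists N, (eva p); rewrite up; exact: Omega_ideal_specialize.
Qed.

Lemma Omega_ideal_prime u v : P (u * v) -> P u \/ P v.
Proof.
exact: (completely_prime_mod hR char_k (@evk_half k R) idP Omega_ideal_inj
          Omega_ideal_Omega Omega_ideal_cover).
Qed.

(** The constants provided by [ideal_above_mod] are here scalars, and [Omega] is
congruent to the unit [a]. *)
Lemma Omega_ideal_maximal (I : set R) u : is_ideal I -> P `<=` I -> I u ->
  ~ P u -> I 1.
Proof.
move=> idI PI Iu Pu; have [_ IB IM] := idI.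
have [N [c [c0 Ic]]] := ideal_above_mod hR char_k char_k (@evk_half k R) idP
  Omega_ideal_Omega Omega_ideal_cover idI PI Iu Pu.
have IZ d w : I w -> I (d *: w) by rewrite -mulr_algl => Iw; case: (IM d%:A w Iw).
have {}Ic : I (Om ^+ N).
  by have := IZ c^-1 _ Ic; rewrite mulr_algr scalerA mulVf // scale1r.
elim: N Ic => [|N IH] // IN; apply: IH.
have : I (a *: Om ^+ N).
  rewrite -(subKr (Om * Om ^+ N) (a *: _)); apply: IB; first by rewrite -exprS.
  by apply: PI; exact: P_Oa.
by move/(IZ a^-1); rewrite scalerA mulVf // scale1r.
Qed.

Lemma Omega_ideal_proper : ~ P 1.
Proof.
move=> P1; suff /eqP : (1 : {poly {poly k}}) = 0 by rewrite oner_eq0.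
by apply: Omega_ideal_inj; rewrite -polyC1 evxyC rmorph1.
Qed.
End OmegaMinus.
End ZeroAndOmega.

(** * Primes of the commutative quotient *)

Section Commutative.
Variable k : fieldType.

Local Notation G := (kgy_g k).
Local Notation Gi := (kgy_gi k).
Local Notation Y := (kgy_y k).
Local Notation cst := (@kgy_const k).

(** Numerators: the inner variable of [{poly {poly k}}] stands for [g], the outer
one for [y]. *)
Definition kgyp : {poly {poly k}} -> kgy k := map_poly (@laurent_of_poly k).
HB.instance Definition _ := GRing.RMorphism.on kgyp.

Lemma laurent_of_poly_inj : injective (@laurent_of_poly k).
Proof. by move=> p q /(congr1 (@laurent_val k))/eqP; rewrite tofrac_eq => /eqP. Qed.

Lemma kgyp_inj : injective kgyp.
Proof. exact: (map_inj_poly laurent_of_poly_inj (rmorph0 _)). Qed.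

Lemma kgypD p q : kgyp (p + q) = kgyp p + kgyp q.
Proof. exact: (rmorphD (map_poly (@laurent_of_poly k))). Qed.
Lemma kgypB p q : kgyp (p - q) = kgyp p - kgyp q.
Proof. exact: (rmorphB (map_poly (@laurent_of_poly k))). Qed.
Lemma kgypM p q : kgyp (p * q) = kgyp p * kgyp q.
Proof. exact: (rmorphM (map_poly (@laurent_of_poly k))). Qed.
Lemma kgyp0 : kgyp 0 = 0.
Proof. exact: (rmorph0 (map_poly (@laurent_of_poly k))). Qed.
Lemma kgyp1 : kgyp 1 = 1.
Proof. exact: (rmorph1 (map_poly (@laurent_of_poly k))). Qed.

Lemma kgypX : kgyp 'X = Y. Proof. exact: map_polyX. Qed.
Lemma kgypC a : kgyp a%:P = (laurent_of_poly a)%:P.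
Proof. exact: map_polyC. Qed.
Lemma kgyp_g : kgyp 'X%:P = G. Proof. exact: kgypC. Qed.
Lemma kgyp_cst c : kgyp c%:P%:P = cst c. Proof. exact: kgypC. Qed.

Lemma cstD c d : cst (c + d) = cst c + cst d.
Proof. by rewrite -!kgyp_cst !polyCD kgypD. Qed.
Lemma cstM c d : cst (c * d) = cst c * cst d.
Proof. by rewrite -!kgyp_cst !polyCM kgypM. Qed.
Lemma cst0 : cst 0 = 0.
Proof. by rewrite -kgyp_cst !polyC0 kgyp0. Qed.
Lemma cst1 : cst 1 = 1.
Proof. by rewrite -kgyp_cst !polyC1 kgyp1. Qed.
Lemma kgypXn p n : kgyp (p ^+ n) = kgyp p ^+ n.
Proof. by elim: n => [|n IH]; rewrite ?kgyp1 // !exprS kgypM IH. Qed.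

Lemma kgy_gK : G * Gi = 1.
Proof. by apply: etrans (esym (polyCM _ _)) _; rewrite laurentXV. Qed.

Lemma kgy_gnK n : Gi ^+ n * G ^+ n = 1.
Proof. by rewrite -exprMn mulrC kgy_gK expr1n. Qed.

Lemma laurent_cover (a : laurent k) :
  exists n p, laurentX k ^+ n * a = laurent_of_poly p.
Proof.
have /asboolP[n [p ap]] := laurent_valP a; exists n, p; apply: val_inj.
rewrite /= -ap mulrC; congr (_ * _).
by elim: n {ap} => //= n IH; rewrite !exprS /= IH.
Qed.

Lemma kgy_cover (f : kgy k) : exists n p, G ^+ n * f = kgyp p.
Proof.
move: f; apply: poly_ind => [|f a [n [p fp]]].
  by exists 0%N, 0; rewrite mul1r kgyp0.
have [m [q aq]] := laurent_cover a.
exists (n + m)%N, ('X%:P ^+ m * p * 'X + 'X%:P ^+ n * q%:P).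
rewrite kgypD !kgypM !kgypXn kgypX kgyp_g kgypC -aq -fp.
have -> : (laurentX k ^+ m * a)%:P = G ^+ m * a%:P :> kgy k.
  by rewrite polyCM rmorphXn.
rewrite mulrDr exprD; congr (_ + _); last by rewrite -mulrA.
by rewrite -!mulrA mulrCA.
Qed.

Lemma kgy_domain (u v : kgy k) : u * v = 0 -> u = 0 \/ v = 0.
Proof.
have [n [p up]] := kgy_cover u; have [m [q vq]] := kgy_cover v => uv.
have cancel w l : G ^+ l * w = 0 -> w = 0.
  by move=> /(congr1 ( *%R (Gi ^+ l))); rewrite mulrA kgy_gnK mul1r mulr0.
have : p * q = 0.
  by apply: kgyp_inj; rewrite kgypM kgyp0 -up -vq mulrACA uv mulr0.
move/eqP; rewrite mulf_eq0 => /orP[] /eqP z.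
  by left; apply: (cancel _ n); rewrite up z kgyp0.
by right; apply: (cancel _ m); rewrite vq z kgyp0.
Qed.

Lemma zero_no_zero_div : @no_zero_div (kgy k) [set 0].
Proof.
split; [|by move/eqP; rewrite oner_eq0|exact: kgy_domain].
split=> // [a b /= -> ->|r a /= ->]; first by rewrite subrr.
by rewrite mulr0 mul0r.
Qed.

Lemma kgy_gn_cancel (P : set (kgy k)) n f : is_ideal P -> P (G ^+ n * f) -> P f.
Proof.
by move=> idP /(idealMl (Gi ^+ n) idP); rewrite mulrA kgy_gnK mul1r.
Qed.

Lemma kgy_sub (P Q : set (kgy k)) : is_ideal P -> is_ideal Q ->
  (forall p, P (kgyp p) -> Q (kgyp p)) -> P `<=` Q.
Proof.
move=> idP idQ PQ f Pf; have [n [p fp]] := kgy_cover f.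
by apply: (@kgy_gn_cancel _ n) => //; rewrite fp; apply: PQ; rewrite -fp; exact: idealMl.
Qed.

Section Evaluation.
Variables b c : k.

Lemma gy_ideal_sub p : gy_ideal b c (kgyp p - cst (p.[c%:P]).[b]).
Proof.
have idI : is_ideal (gy_ideal b c) := ideal_gen_ideal _.
have Ig : gy_ideal b c (G - cst b) by apply: sub_ideal_gen; left.
have Iy : gy_ideal b c (Y - cst c) by apply: sub_ideal_gen; right.
have step u v w z d : gy_ideal b c (u - v) -> gy_ideal b c (w - z) ->
    gy_ideal b c (u * w + d - (v * z + d)).
  move=> uv wz; have -> : u * w + d - (v * z + d) = (u - v) * w + v * (w - z).
    by rewrite opprD addrACA subrr addr0 mulrBl mulrBr addrA subrK.
  exact: (idealD idI (idealMr w idI uv) (idealMl v idI wz)).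
have stepd u v d e : gy_ideal b c (u - v) -> gy_ideal b c (d - e) ->
    gy_ideal b c (u + d - (v + e)).
  by move=> uv de; rewrite opprD addrACA; exact: (idealD idI).
have Ia a : gy_ideal b c (kgyp a%:P - cst a.[b]).
  elim/poly_ind: a => [|a d IH].
    by rewrite polyC0 kgyp0 horner0 cst0 subr0; exact: ideal0 idI.
  rewrite hornerMXaddC polyCD polyCM kgypD kgypM cstD cstM kgyp_g kgyp_cst.
  exact: (step _ _ _ _ _ IH Ig).
elim/poly_ind: p => [|p a IH].
  by rewrite kgyp0 !horner0 cst0 subr0; exact: ideal0 idI.
rewrite hornerMXaddC hornerD hornerM hornerC cstD cstM kgypD kgypM kgypX.
apply: (stepd _ _ _ _ _ (Ia a)).
have -> : kgyp p * Y - cst p.[c%:P].[b] * cst c =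
    (kgyp p - cst p.[c%:P].[b]) * Y + cst p.[c%:P].[b] * (Y - cst c).
  by rewrite mulrBl mulrBr addrA subrK.
exact: (idealD idI (idealMr _ idI IH) (idealMl _ idI Iy)).
Qed.

Hypothesis b0 : b != 0.

(** The elements with a numerator vanishing at [(b, c)] form an ideal which
contains the generators; conversely a numerator is congruent to its value at
[(b, c)], by [gy_ideal_sub]. *)
Lemma gy_idealE f : gy_ideal b c f <->
  exists n p, G ^+ n * f = kgyp p /\ (p.[c%:P]).[b] = 0.
Proof.
split=> [|[n [p [fp p0]]]]; last first.
  have idI : is_ideal (gy_ideal b c) := ideal_gen_ideal _.
  apply: (kgy_gn_cancel (n := n) idI); rewrite fp.
  by have := gy_ideal_sub p; rewrite p0 cst0 subr0.
apply: (@ideal_genP _ _ [set f | exists n p, G ^+ n * f = kgyp p /\ p.[c%:P].[b] = 0]).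
  split=> [|u v [n [p [up p0]]] [m [q [vq q0]]]|r u [n [p [up p0]]]].
  - by exists 0%N, 0; rewrite mul1r kgyp0 !horner0.
  - exists (n + m)%N, ('X%:P ^+ m * p - 'X%:P ^+ n * q).
    rewrite kgypB !kgypM !kgypXn kgyp_g -up -vq mulrBr exprD.
    split; last by rewrite hornerD hornerN !hornerM hornerD hornerN !hornerM p0 q0 !mulr0 subr0.
    by congr (_ - _); rewrite mulrA // (mulrC (G ^+ m)).
  have [m [q rq]] := kgy_cover r.
  have e : G ^+ (m + n) * (r * u) = kgyp (q * p).
    by rewrite kgypM -rq -up exprD mulrACA.
  have z : (q * p).[c%:P].[b] = 0 by rewrite !hornerM p0 mulr0.
  by split; exists (m + n)%N, (q * p); rewrite // (mulrC u).
move=> _ [->|->].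
  exists 0%N, ('X%:P - b%:P%:P); rewrite mul1r kgypB kgyp_g kgyp_cst; split=> //.
  by rewrite !hornerE subrr.
exists 0%N, ('X - c%:P%:P); rewrite mul1r kgypB kgypX kgyp_cst; split=> //.
by rewrite !hornerE subrr.
Qed.

Lemma gy_ideal_kgyp p : gy_ideal b c (kgyp p) <-> (p.[c%:P]).[b] = 0.
Proof.
split=> [/gy_idealE[n [q []]]|p0]; last by apply/gy_idealE; exists 0%N, p; rewrite mul1r.
rewrite -kgyp_g -kgypXn -kgypM => /kgyp_inj <-.
rewrite !hornerM !horner_exp !hornerC hornerX => /eqP.
by rewrite mulf_eq0 expf_eq0 (negPf b0) andbF => /eqP.
Qed.

Lemma gy_ideal_maximal : maximal_ideal (gy_ideal b c).
Proof.
have idI : is_ideal (gy_ideal b c) := ideal_gen_ideal _.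
split=> //.
  apply/(proper_ideal idI); rewrite -kgyp1 => /gy_ideal_kgyp/eqP.
  by rewrite !hornerE oner_eq0.
move=> I idI' sub; have [IS|nIS] := pselect (I `<=` gy_ideal b c).
  by left; apply/seteqP; split.
right; apply: ideal1 => //; apply: contrapT => I1; apply: nIS.
apply: kgy_sub => // p Ip; apply/gy_ideal_kgyp; apply: contrapT => /eqP p0.
set e := _.[b] in p0; suff Ie : I (cst e).
  by apply: I1; rewrite -cst1 -(mulVf p0) cstM; exact: (idealMl _ idI' Ie).
rewrite -(subKr (kgyp p) (cst e)).
exact: (idealB idI' Ip (sub _ (gy_ideal_sub p))).
Qed.
End Evaluation.

End Commutative.

Section ClosedField.
Variable k : closedFieldType.
Hypothesis char_k : [pchar k] =i pred0.

Local Notation G := (kgy_g k).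
Local Notation Gi := (kgy_gi k).
Local Notation Y := (kgy_y k).
Local Notation cst := (@kgy_const k).
Local Notation evb b := (map_poly (horner_eval b)).

(** In characteristic zero the natural numbers are more points than [p] has roots. *)
Lemma nonroot (p : {poly k}) : p != 0 -> exists b, p.[b] != 0.
Proof.
move=> p0; apply: contrapT => all0.
pose s : seq k := [seq i%:R | i <- iota 0 (size p)].
have us : uniq s.
  rewrite map_inj_uniq ?iota_uniq // => i j.
  wlog ij : i j / (i <= j)%N.
    by move=> w; case: (leqP i j) => [|/ltnW] /w // h /esym /h.
  move=> e; apply/eqP; rewrite eqn_leq ij -subn_eq0.
  by rewrite -(iffLR (pcharf0P k) char_k) natrB // e subrr eqxx.
have roots_s : all (root p) s.
  apply/allP => z _; apply/rootP/eqP; apply: contrapT => /negP pz.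
  by apply: all0; exists z.
by have := max_poly_roots p0 roots_s us; rewrite size_map size_iota ltnn.
Qed.

Section Prime.
Variable P : set (kgy k).
Hypothesis prP : prime_ideal P.
Let idP : is_ideal P. Proof. by case: prP. Qed.
Let P1 : ~ P 1. Proof. exact: prime_proper. Qed.

Lemma prime_g : ~ P G.
Proof. by move/(idealMr Gi idP); rewrite kgy_gK. Qed.

Lemma prime_g_factor (r : {poly k}) : r != 0 -> P (kgyp r%:P) ->
  exists b, b != 0 /\ P (G - cst b).
Proof.
move=> r0 Pr.
have [b] := @prime_linear_factor k _ P (fun p => kgyp p%:P) r prP
  (fun p q => etrans (congr1 _ (polyCM _ _)) (kgypM _ _)) (kgyp1 k)
  (fun p u => mulrC _ u) r0 Pr.
rewrite polyCB kgypB kgyp_g kgyp_cst => Pb; exists b; split=> //.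
by apply/eqP => b0; move: Pb; rewrite b0 cst0 subr0 => /prime_g.
Qed.

Lemma map_polyC_evb b (p : {poly {poly k}}) :
  exists h, p - map_poly polyC (evb b p) = ('X - b%:P) *: h.
Proof.
elim/poly_ind: p => [|p a [h IH]].
  by exists 0; rewrite !map_poly0 scaler0 subrr.
have /factor_theorem[q aE] : root (a - (a.[b])%:P) b.
  by rewrite rootE !hornerE subrr.
exists (h * 'X + q%:P).
rewrite !(rmorphD, rmorphM) /= !map_polyX !map_polyC /= opprD addrACA -mulrBl IH.
rewrite scalerDr -scalerAl -polyCB aE; congr (_ + _).
by rewrite -mul_polyC -polyCM mulrC.
Qed.

(** Once [g] is specialized, either [P] is generated by [g - b], or it contains
a polynomial in [y] alone, hence also some [y - c]. *)
Lemma prime_above_g b : b != 0 -> P (G - cst b) ->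
  (exists c, P = gy_ideal b c) \/ (forall p, P (kgyp p) -> evb b p = 0).
Proof.
move=> b0 Pb.
have [|no] := pselect (exists p, P (kgyp p) /\ evb b p != 0); last first.
  right=> p Pp; apply/eqP; apply: contrapT => /negP np; apply: no; by exists p.
case=> p [Pp p0]; left.
have Pq : P (kgyp (map_poly polyC (evb b p))).
  have [h ph] := map_polyC_evb b p.
  rewrite -(subKr (kgyp p) (kgyp _)); apply: (idealB idP) => //.
  rewrite -kgypB ph -mul_polyC kgypM polyCB kgypB kgyp_g kgyp_cst.
  exact: idealMr.
have [c] := @prime_linear_factor k _ P (fun p => kgyp (map_poly polyC p)) _ prP
  (fun p q => etrans (congr1 _ (rmorphM _ _ _)) (kgypM _ _))
  (etrans (congr1 _ (rmorph1 _)) (kgyp1 k)) (fun p u => mulrC _ u) p0 Pq.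
have -> : map_poly polyC ('X - c%:P) = 'X - c%:P%:P :> {poly {poly k}}.
  by rewrite rmorphB /= map_polyX map_polyC.
rewrite kgypB kgypX kgyp_cst => Pc; exists c.
have [_ _ max_gy] := gy_ideal_maximal c b0.
have [] := max_gy P idP => [|//|PT].
  by apply: ideal_genP => // _ [->|->].
by case: P1; rewrite PT.
Qed.
End Prime.

Lemma horner_evb b c (p : {poly {poly k}}) : p.[c%:P].[b] = (evb b p).[c].
Proof.
elim/poly_ind: p => [|p a IH]; first by rewrite map_poly0 !horner0.
rewrite !(rmorphD, rmorphM) /= map_polyX map_polyC /= !hornerMXaddC.
by rewrite hornerD hornerM hornerC IH.
Qed.

Lemma gy_ideal_evb b c (p : {poly {poly k}}) : b != 0 -> gy_ideal b c (kgyp p) <-> (evb b p).[c] = 0.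
Proof. by move=> b0; rewrite -horner_evb; exact: gy_ideal_kgyp. Qed.

Lemma pseudo_rem (P : set (kgy k)) (f h : {poly {poly k}}) : is_ideal P ->
  P (kgyp f) -> P (kgyp h) -> P (kgyp (h %% f)).
Proof.
move=> idP Pf Ph; have := Pdiv.Idomain.divp_eq h f.
move/eqP; rewrite addrC -subr_eq => /eqP <-; rewrite kgypB -mul_polyC !kgypM.
by apply: (idealB idP); [exact: (idealMl _ idP Ph)|exact: (idealMl _ idP Pf)].
Qed.

(** The Nullstellensatz for [k[g^+-1, y]].  If [P] meets [k[g]] only in [0], an
element [f] of least degree in [y] divides every element of [P] up to a power of
its leading coefficient, so a zero of [f] where that coefficient does not vanish
is a zero of [P]. *)
Lemma prime_in_gy (P : set (kgy k)) : prime_ideal P ->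
  exists b c, b != 0 /\ P `<=` gy_ideal b c.
Proof.
move=> prP; have idP : is_ideal P by case: prP.
have [[r [r0 Pr]]|nor] := pselect (exists r : {poly k}, r != 0 /\ P (kgyp r%:P)).
  have [b [b0 Pb]] := prime_g_factor prP r0 Pr; exists b.
  have [[c ->]|all0] := prime_above_g prP b0 Pb; first by exists c; split=> // v.
  exists 0; split=> //; apply: (kgy_sub idP) => [|p Pp].
    exact: ideal_gen_ideal.
  by apply/gy_ideal_evb => //; rewrite (all0 p Pp) horner0.
have [[f0 Pf0]|no] := pselect (exists f, f != 0 /\ P (kgyp f)); last first.
  exists 1, 0; split; first exact: oner_neq0.
  apply: (kgy_sub idP) => [|p Pp]; first exact: ideal_gen_ideal.
  have [->|p0] := eqVneq p 0; last by case: no; exists p.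
  by rewrite kgyp0; exact: (ideal0 (ideal_gen_ideal _)).
have ex_f : exists f, f != 0 /\ P (kgyp f) by exists f0.
have [f [[fn0 Pf] min_f]] := min_size ex_f.
have sz_f : (1 < size f)%N.
  rewrite ltnNge; apply/negP => /size1_polyC fE; apply: nor; exists f`_0; split.
    by apply: contra_neq fn0; rewrite {2}fE => ->.
  by rewrite -fE.
have Xa0 : 'X * lead_coef f != 0 by rewrite mulf_neq0 ?polyX_eq0 ?lead_coef_eq0.
have [b] := nonroot Xa0; rewrite hornerM hornerX mulf_eq0 negb_or => /andP[b0 ab0].
have szb : size (evb b f) = size f.
  by rewrite size_map_poly_id0 // /horner_eval.
have [c fc] : exists c, root (evb b f) c.
  by apply/closed_rootP; rewrite szb neq_ltn sz_f orbT.
exists b, c; split=> //; apply: (kgy_sub idP) => [|h Ph]; first exact: ideal_gen_ideal.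
apply/gy_ideal_evb => //.
have rem0 : h %% f = 0.
  apply/eqP; apply/negPn/negP => rem0.
  suff /min_f : h %% f != 0 /\ P (kgyp (h %% f)) by rewrite leqNgt ltn_modp fn0.
  by split=> //; exact: pseudo_rem.
have := Pdiv.Idomain.divp_eq h f; rewrite rem0 addr0.
move=> /(congr1 (fun q => (evb b q).[c])); rewrite -mul_polyC !rmorphM /= !hornerM.
rewrite (rootP fc) mulr0 map_polyC /= hornerC => /eqP.
by rewrite mulf_eq0 /horner_eval horner_exp expf_eq0 (negPf ab0) andbF => /eqP.
Qed.

(** If [Q] met [k[g]] only in [0], an element [h] of [Q] outside [P] of least
degree in [y] would divide, up to an element of [k[g]], an element of [P] of
least degree, with quotient in [P]; so [h] would be constant in [y].  Hence [Q]
contains some [g - b], and it is not generated by it, because a nonzero prime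
inside [(g - b)] is [(g - b)] itself. *)
Lemma prime_chain_gy (P Q : set (kgy k)) : prime_ideal P -> prime_ideal Q ->
  (exists2 u, P u & u <> 0) -> P `<` Q ->
  exists b c, b != 0 /\ Q = gy_ideal b c.
Proof.
move=> prP prQ [u Pu u0] [PQ nQP].
have idP : is_ideal P by case: prP.
have idQ : is_ideal Q by case: prQ.
have [n [f0 uf0]] := kgy_cover u.
have Pf0 : f0 != 0 /\ P (kgyp f0).
  split; last by rewrite -uf0; exact: (idealMl _ idP Pu).
  apply/eqP => f00; apply: u0; have := uf0; rewrite f00 kgyp0.
  by move/(congr1 ( *%R (Gi ^+ n))); rewrite mulrA kgy_gnK mul1r mulr0.
have [h0 Qh0 nPh0] : exists2 h, Q (kgyp h) & ~ P (kgyp h).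
  apply: contrapT => no; apply: nQP; apply: kgy_sub => // p Qp.
  by apply: contrapT => nPp; apply: no; exists p.
have [r [rn0 Qr]] : exists r : {poly k}, r != 0 /\ Q (kgyp r%:P).
  apply: contrapT => nor.
  have norP r : r != 0 -> ~ P (kgyp r%:P).
    by move=> r0 Pr; apply: nor; exists r; split=> //; exact: PQ.
  have ex_f : exists f, f != 0 /\ P (kgyp f) by exists f0.
have [f [[fn0 Pf] min_f]] := min_size ex_f.
  pose S (h : {poly {poly k}}) := Q (kgyp h) /\ ~ P (kgyp h).
  have [h [[Qh nPh] min_h]] : exists h, S h /\ forall q, S q -> (size h <= size q)%N.
    by apply: min_size; exists h0.
  have hn0 : h != 0.
    by apply/eqP => h_0; apply: nPh; rewrite h_0 kgyp0; exact: ideal0.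
  have lcXP q m : q != 0 -> ~ P (kgyp ((lead_coef q) ^+ m)%:P).
    by move=> qn0; apply: norP; rewrite expf_neq0 ?lead_coef_eq0.
  have lt_hf : (size h < size f)%N.
    have lt_rem : (size (h %% f)%R < size f)%N by rewrite ltn_modp.
    apply: leq_ltn_trans lt_rem; apply: min_h; split.
      by apply: (pseudo_rem idQ) => //; exact: PQ.
    move=> Prem; have : P (kgyp ((lead_coef f ^+ scalp h f)%:P * h)).
      rewrite mul_polyC Pdiv.Idomain.divp_eq kgypD kgypM.
      by apply: (idealD idP) => //; exact: (idealMl _ idP Pf).
    by rewrite kgypM => /(com_primeM prP)[]; [exact: lcXP|].
  have rem0 : f %% h = 0.
    apply/eqP; apply/negPn/negP => remn0.
    have lt_rem : (size (f %% h)%R < size h)%N by rewrite ltn_modp.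
    have [Prem|nPrem] := pselect (P (kgyp (f %% h))).
      have := min_f _ (conj remn0 Prem).
      by rewrite leqNgt (ltn_trans lt_rem lt_hf).
    have : S (f %% h) by split=> //; apply: (pseudo_rem idQ) => //; exact: PQ.
    by move/min_h; rewrite leqNgt lt_rem.
  have fE := Pdiv.Idomain.divp_eq f h; rewrite rem0 addr0 in fE.
  have lcn0 : lead_coef h ^+ scalp f h != 0 by rewrite expf_neq0 ?lead_coef_eq0.
  have qn0 : f %/ h != 0.
    apply: contra_neq fn0 => q0; move/eqP: fE.
    by rewrite q0 mul0r -mul_polyC mulf_eq0 polyC_eq0 (negPf lcn0) => /eqP.
  have Pq : P (kgyp (f %/ h)).
    have : P (kgyp (f %/ h * h)).
      by rewrite -fE -mul_polyC kgypM; exact: (idealMl _ idP Pf).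
    by rewrite kgypM => /(com_primeM prP)[|/nPh].
  have := min_f _ (conj qn0 Pq); rewrite -(size_scale f lcn0) fE size_mul //.
  move=> le_q; have sz1 : (size h <= 1)%N.
    move: le_q; have : (0 < size (f %/ h)%R)%N by rewrite lt0n size_poly_eq0.
    case: (size h) => [|[|m]] // _; rewrite addnS /= addnS.
    by rewrite ltnNge leq_addr.
  apply: nor; exists h`_0; split; last by rewrite -size1_polyC.
  by apply: contra_neq hn0 => h_0; rewrite (size1_polyC sz1) h_0.
have [b [b0 Qb]] := prime_g_factor prQ rn0 Qr; exists b.
have [[c QE]|Qall0] := prime_above_g prQ b0 Qb; first by exists c.
have divides p : Q (kgyp p) -> exists h, p = ('X - b%:P) *: h.
  move=> /Qall0 p0; have [h ph] := map_polyC_evb b p; exists h.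
  by rewrite -ph p0 map_poly0 subr0.
exfalso; have [Pb|nPb] := pselect (P (G - cst b)).
  apply: nPh0; have [h ->] := divides _ Qh0.
  rewrite -mul_polyC kgypM polyCB kgypB kgyp_g kgyp_cst.
  exact: (idealMr _ idP Pb).
(* Dividing by [g - b] lowers the degree in [g] of the leading coefficient. *)
have [m] := ubnP (size (lead_coef f0)).
elim: m f0 Pf0 {uf0} => // m IH f [fn0 Pf] le_m.
have [h fh] := divides f (PQ _ Pf).
have hn0 : h != 0 by apply: contra_neq fn0 => h_0; rewrite fh h_0 scaler0.
apply: (IH h).
  split=> //; have : P (kgyp f) by [].
  rewrite fh -mul_polyC kgypM polyCB kgypB kgyp_g kgyp_cst.
  by case/(com_primeM prP).
move: le_m; rewrite fh lead_coefZ // size_monicM ?monicXsubC ?lead_coef_eq0 //.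
by rewrite size_XsubC.
Qed.

Lemma not_gy_height1 (P : set (kgy k)) : prime_ideal P ->
  (exists2 u, P u & u <> 0) -> ~ (exists b c, b != 0 /\ P = gy_ideal b c) ->
  has_height P 1.
Proof.
move=> prP [u Pu u0] ngy; split=> //; split.
  exists (fun i => if i is 0%N then [set 0] else P); split=> [[|i] // _|[|i] // _|//].
    by rewrite /Spec /=; exact/no_zero_div_prime/zero_no_zero_div.
  split=> [v /= ->|]; first by case: prP => /ideal0.
  by move/(_ u Pu).
case=> c [cS c_lt c2]; apply: ngy.
have [c0S c1S] := (cS 0%N isT, cS 1%N isT).
have [sub01 nsub] := c_lt 0%N isT.
apply: (prime_chain_gy c1S prP); last by rewrite -c2; exact: c_lt.
apply: contrapT => no; apply: nsub => v c1v.
have [->|v0] := eqVneq v 0; first by case: c0S => /ideal0.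
by case: no; exists v => //; exact/eqP.
Qed.

Lemma height1_nonzero (P : set (kgy k)) : has_height P 1 ->
  prime_ideal P /\ exists2 u, P u & u <> 0.
Proof.
move=> [prP [[c [cS c_lt cP]] _]]; split=> //.
have [sub nsub] := c_lt 0%N isT; rewrite cP in nsub.
apply: contrapT => no; apply: nsub => v Pv.
have [->|v0] := eqVneq v 0; first by case: (cS 0%N isT) => /ideal0.
by case: no; exists v => //; exact/eqP.
Qed.
End ClosedField.

(** * The spectrum *)

Section Projection.
Variables (k : fieldType) (R : algType k) (g gi x y : R).
Hypothesis hR : is_bosonization g gi x y.
(* The commutative ring [k[g^+-1, y]], through its numerators. *)
Variables (B : comNzRingType) (num : {rmorphism {poly {poly k}} -> B}) (Bgi : B).
Hypothesis num_inj : injective num.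
Hypothesis num_gi : num 'X%:P * Bgi = 1.
Hypothesis num_cover : forall f, exists n p, num 'X%:P ^+ n * f = num p.
Variable pr : {rmorphism R -> B}.
Hypothesis pr_gen :
  [/\ pr g = num 'X%:P, pr gi = Bgi, pr x = 0 & pr y = num 'X].
Hypothesis prZ : forall c u, pr (c *: u) = num c%:P%:P * pr u.

Local Notation cst c := (num c%:P%:P).
Local Notation evxk := (evx x (@scal_comm k R)).
Local Notation evk := (evxy x y (@scal_comm k R)).
Local Notation K := (ideal_gen [set x]).
Local Notation gyI b c := (ideal_gen [set num 'X%:P - cst b; num 'X - cst c]).

Let prg : pr g = num 'X%:P. Proof. by case: pr_gen. Qed.
Let prgi : pr gi = Bgi. Proof. by case: pr_gen. Qed.
Let prx : pr x = 0. Proof. by case: pr_gen. Qed.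
Let pry : pr y = num 'X. Proof. by case: pr_gen. Qed.

Lemma pr_alg c : pr c%:A = cst c. Proof. by rewrite prZ rmorph1 mulr1. Qed.

Lemma pr_horner_g p : pr (horner_alg g p) = num p%:P.
Proof.
elim/poly_ind: p => [|p c IH]; first by rewrite !rmorph0.
rewrite polyCD polyCM [RHS]rmorphD rmorphM /=.
by rewrite rmorphD rmorphM /= horner_algX horner_algC rmorphD rmorphM /= IH prg pr_alg.
Qed.

Lemma pr_surj f : exists u, pr u = f.
Proof.
have [n [p fp]] := num_cover f.
have [v vp] : exists v, pr v = num p.
  elim/poly_ind: p {fp} => [|p a [v IH]]; first by exists 0; rewrite !rmorph0.
  by exists (v * y + horner_alg g a); rewrite !rmorphD !rmorphM /= IH pry pr_horner_g.
exists (gi ^+ n * v); rewrite rmorphM rmorphXn vp /= prgi -fp mulrA -exprMn.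
by rewrite mulrC [Bgi * _]mulrC num_gi expr1n mulr1.
Qed.

Let idK : is_ideal K. Proof. exact: ideal_gen_ideal. Qed.

Lemma pr_evk w :
  pr (evk w) = num (map_poly polyC (map_poly (horner_eval 0) w)).
Proof.
have prx0 (a : {poly k}) : pr (evxk a) = cst a.[0].
  elim/poly_ind: a => [|a c IH]; first by rewrite horner0 !rmorph0.
  rewrite hornerMXaddC mulr0 add0r -pr_alg rmorphD rmorphM /= evxX evxC.
  by rewrite rmorphD rmorphM /= prx mulr0 add0r.
elim/poly_ind: w => [|w a IH]; first by rewrite !map_poly0 !rmorph0 raddf0 rmorph0.
rewrite (raddfD evk) /= evxy_mulX evxyC [LHS]rmorphD rmorphM /= IH pry prx0.
by rewrite !(rmorphD, rmorphM) /= !map_polyX !map_polyC.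
Qed.

Lemma evk_in_x (w : {poly {poly k}}) : map_poly (horner_eval 0) w = 0 -> K (evk w).
Proof.
move=> w0; rewrite /evxy; apply: (ideal_sum _ idK) => i; apply: (idealMr _ idK).
have /factor_theorem[r ->] : root w`_i 0.
  by have := congr1 (fun q : {poly k} => q`_i) w0; rewrite coef_map coef0 rootE => /eqP.
by rewrite subr0 rmorphM /= evxX; apply: (idealMl _ idK); exact: sub_ideal_gen.
Qed.

Lemma pr_evg q : pr (evg g x y q) =
  num (\sum_(j < size q) 'X%:P ^+ j * map_poly polyC (map_poly (horner_eval 0) q`_j)).
Proof.
rewrite /evg !rmorph_sum; apply: eq_bigr => i _.
by rewrite !rmorphM !rmorphXn /= prg pr_evk.
Qed.

(** The kernel of the projection is generated by [x]: an element is, up to a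
power of [g], a polynomial in [g], [y] and [x], and vanishes in the quotient
only if its coefficients vanish at [x = 0]. *)
Lemma pr_ker u : pr u = 0 -> K u.
Proof.
have [_ gig _ _ _ _ _] := hR.
have [N [q uq]] := evg_span hR u => u0.
have gK n : gi ^+ n * g ^+ n = 1.
  elim: n => [|n IH]; first by rewrite mulr1.
  by rewrite exprSr exprS mulrA -(mulrA _ gi) gig mulr1.
suff Kq : K (evg g x y q) by rewrite -[u]mul1r -(gK N) -mulrA uq; exact: (idealMl _ idK).
have : pr (evg g x y q) = 0 by rewrite -uq rmorphM u0 mulr0.
rewrite pr_evg -(rmorph0 num) => /num_inj q0.
rewrite /evg; apply: (ideal_sum _ idK) => j; apply: (idealMl _ idK); apply: evk_in_x.
apply/polyP => m; rewrite coef0.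
have := congr1 (fun r : {poly {poly k}} => r`_m`_j) q0.
rewrite /= !coef0 !coef_sum (bigD1 j) //= big1 => [|i ij].
  by rewrite addr0 -polyC_exp coefCM coefXnM ltnn subnn coef_map coefC.
rewrite -polyC_exp coefCM coefXnM coef_map /= coefC; case: ltnP => // le_ij.
by rewrite subn_eq0 leqNgt ltn_neqAle ij le_ij.
Qed.

Lemma x_idealE : K = pr @^-1` [set 0].
Proof.
apply/seteqP; split; last exact: pr_ker.
apply: ideal_genP => [|_ -> //]; split=> [|a b /= a0 b0|r a /= a0].
- exact: rmorph0.
- by rewrite rmorphB a0 b0 subr0.
- by rewrite !rmorphM a0 mulr0 mul0r.
Qed.

Lemma comm_in_x u v : K (u * v - v * u).
Proof. by apply: pr_ker; rewrite rmorphB !rmorphM mulrC subrr. Qed.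

Lemma preim_ideal (p : set B) : is_ideal p -> is_ideal (pr @^-1` p).
Proof.
move=> idp; split=> [|a b /= pa pb|r a /= pa].
- by rewrite /= rmorph0; exact: ideal0.
- by rewrite rmorphB; exact: idealB.
- by rewrite !rmorphM; split; [exact: idealMl|exact: idealMr].
Qed.

Lemma preim_no_zero_div (p : set B) : prime_ideal p ->
  no_zero_div (pr @^-1` p).
Proof.
move=> prp; split=> [|/=|u v /=]; first by apply: preim_ideal; case: prp.
  by rewrite rmorph1; exact: prime_proper.
by rewrite rmorphM; exact: com_primeM.
Qed.

Lemma preim_subset (p q : set B) : pr @^-1` p `<=` pr @^-1` q <-> p `<=` q.
Proof.
split=> pq f; last exact: pq.
by have [u <-] := pr_surj f; exact: pq.
Qed.

Lemma image_ideal (P : set R) : is_ideal P -> is_ideal (pr @` P).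
Proof.
move=> idP; split=> [|_ _ [u Pu <-] [v Pv <-]|r _ [u Pu <-]].
- by exists 0; [exact: ideal0|rewrite rmorph0].
- by exists (u - v); [exact: idealB|rewrite rmorphB].
- have [w <-] := pr_surj r; split.
    by exists (w * u); [exact: idealMl|rewrite rmorphM].
  by exists (u * w); [exact: idealMr|rewrite rmorphM].
Qed.

Lemma preim_image (P : set R) : is_ideal P -> P x -> P = pr @^-1` (pr @` P).
Proof.
move=> idP Px; apply/seteqP; split=> [u Pu|u [v Pv vu]]; first by exists u.
rewrite -(subrK v u); apply: idealD => //; apply: (ideal_gen1 idP Px).
by apply: pr_ker; rewrite rmorphB vu subrr.
Qed.

Lemma image_prime (P : set R) : prime_ideal P -> P x -> prime_ideal (pr @` P).
Proof.
move=> prP Px; have idP : is_ideal P by case: prP.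
apply: no_zero_div_prime; split; first exact: image_ideal.
  case=> u Pu u1; apply: (prime_proper prP); rewrite (preim_image idP Px) /=.
  by exists u => //; rewrite u1 rmorph1.
move=> f f'; have [u <-] := pr_surj f; have [v <-] := pr_surj f' => uv.
have Puv r : P (u * r * v).
  rewrite (preim_image idP Px) /= !rmorphM mulrAC.
  by apply: idealMr uv; exact: image_ideal.
by case: (prime_elem prP Puv) => Pu; [left; exists u|right; exists v].
Qed.

Lemma xgy_idealE b c :
  ideal_gen [set x; g - b%:A; y - c%:A] = pr @^-1` gyI b c.
Proof.
have idI : is_ideal (ideal_gen [set x; g - b%:A; y - c%:A]).
  exact: ideal_gen_ideal.
have idgy : is_ideal (gyI b c) := ideal_gen_ideal _.
have Ix : ideal_gen [set x; g - b%:A; y - c%:A] x by apply: sub_ideal_gen; left; left.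
have gyg : gyI b c (pr (g - b%:A)).
  by rewrite rmorphB prg pr_alg; apply: sub_ideal_gen; left.
have gyy : gyI b c (pr (y - c%:A)).
  by rewrite rmorphB pry pr_alg; apply: sub_ideal_gen; right.
apply/seteqP; split.
  apply: ideal_genP; first exact: preim_ideal.
  by move=> _ [[->|->]|->] //=; rewrite prx; exact: (ideal0 idgy).
rewrite [X in _ `<=` X](preim_image idI Ix); apply/preim_subset.
apply: ideal_genP; first exact: image_ideal.
move=> _ [->|->].
  exists (g - b%:A); first by apply: sub_ideal_gen; left; right.
  by rewrite rmorphB prg pr_alg.
exists (y - c%:A); first by apply: sub_ideal_gen; right.
by rewrite rmorphB pry pr_alg.
Qed.
End Projection.

Section Spectrum.
Variables (k : closedFieldType) (R : algType k) (g gi x y : R).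
Hypothesis char_k : [pchar k] =i pred0.
Hypothesis hR : is_bosonization g gi x y.
Variables (B : comNzRingType) (num : {rmorphism {poly {poly k}} -> B}) (Bgi : B).
Hypothesis num_inj : injective num.
Hypothesis num_gi : num 'X%:P * Bgi = 1.
Hypothesis num_cover : forall f, exists n p, num 'X%:P ^+ n * f = num p.
Variable pr : {rmorphism R -> B}.
Hypothesis pr_gen :
  [/\ pr g = num 'X%:P, pr gi = Bgi, pr x = 0 & pr y = num 'X].
Hypothesis prZ : forall c u, pr (c *: u) = num c%:P%:P * pr u.

Local Notation Om := (x ^+ 2 * gi).
Local Notation oI a := (ideal_gen [set Om - a%:A]).

Lemma Omega_ideal_max (a : k) : a != 0 -> maximal_ideal (oI a).
Proof.
move=> a0; have idI : is_ideal (oI a) := ideal_gen_ideal _.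
split=> //; first exact/(proper_ideal idI)/(Omega_ideal_proper hR char_k a0).
move=> I idI' sub; have [IS|nIS] := pselect (I `<=` oI a).
  by left; apply/seteqP; split.
right; apply: ideal1 => //; apply: contrapT => I1; apply: nIS => u Iu.
apply: contrapT => nu; apply: I1.
exact: (Omega_ideal_maximal hR char_k a0 idI' sub Iu nu).
Qed.

(** [x^2 = g Omega] lies in [P], and [x R x] lies in [R x^2] by normality. *)
Lemma x_in_prime (P : set R) : prime_ideal P -> P Om -> P x.
Proof.
move=> prP POm; have idP : is_ideal P by case: prP.
have Px2 : P (x ^+ 2) by rewrite (x2_gi hR); exact: idealMl.
have Pxrx r : P (x * r * x).
  have [r' ->] := x_normal hR r.
  by rewrite -mulrA -expr2; exact: idealMl.
by case: (prime_elem prP Pxrx).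
Qed.

(** A nonzero prime contains a nonzero polynomial in the central element [Omega],
hence some [Omega - a]; for [a = 0] it contains [x]. *)
Lemma prime_classification (P : set R) : prime_ideal P ->
  [\/ P = [set 0], exists a : k, a != 0 /\ P = oI a
    | exists p, prime_ideal p /\ P = pr @^-1` p].
Proof.
move=> prP; have idP : is_ideal P by case: prP.
have [[u [Pu u0]]|no] := pselect (exists u, P u /\ u <> 0); last first.
  constructor 1; apply/seteqP; split=> [u Pu|_ ->]; last exact: ideal0.
  by apply: contrapT => u0; apply: no; exists u.
have [c c0 Pc] := ideal_meets_center hR char_k idP Pu u0.
have [a] := prime_linear_factor (phi := horner_alg Om) prP (rmorphM _) (rmorph1 _)
  (fun p u => horner_Omega_comm hR char_k p u) c0 Pc.
rewrite rmorphB /= horner_algX horner_algC => Pa.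
have [a0|a0] := eqVneq a 0; last first.
  constructor 2; exists a; split=> //.
  have [_ _ max] := Omega_ideal_max a0.
  have [|//|PT] := max P idP; first exact: ideal_gen1.
  by case: prP => _ [].
constructor 3; exists (pr @` P).
have Px : P x by apply: x_in_prime => //; move: Pa; rewrite a0 scale0r subr0.
split; first exact: (image_prime hR num_inj num_gi num_cover pr_gen prZ prP Px).
exact: (preim_image hR num_inj pr_gen prZ idP Px).
Qed.

Lemma Omega_ideal_no_zero_div (a : k) : a != 0 -> no_zero_div (oI a).
Proof.
move=> a0; split; first exact: ideal_gen_ideal.
  exact: (Omega_ideal_proper hR char_k a0).
exact: (Omega_ideal_prime hR char_k a0).
Qed.

Lemma zero_no_zero_div_R : @no_zero_div R [set 0].
Proof.
split; first exact: set0_ideal.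
  by move/eqP; rewrite oner_eq0.
exact: (domain_R hR char_k).
Qed.

Lemma prime_no_zero_div (P : set R) : prime_ideal P -> no_zero_div P.
Proof.
case/prime_classification => [->|[a [a0 ->]]|[p [prp ->]]].
- exact: zero_no_zero_div_R.
- exact: Omega_ideal_no_zero_div.
- exact: preim_no_zero_div.
Qed.

Lemma x_notin_Omega_ideal (a : k) : a != 0 -> ~ oI a x.
Proof.
move=> a0 ax; have idI : is_ideal (oI a) := ideal_gen_ideal _.
apply: (Omega_ideal_proper hR char_k a0).
have IOm : oI a Om by rewrite expr2; exact: (idealMr _ idI (idealMr _ idI ax)).
have Ia : oI a a%:A.
  suff : oI a (Om - (Om - a%:A)) by rewrite subKr.
  by apply: (idealB idI IOm); apply: sub_ideal_gen.
have := idealMl (a^-1)%:A idI Ia.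
by rewrite mulr_algl scalerA mulVf // scale1r.
Qed.

Lemma Omega_ideal_neq0 (a : k) : a != 0 -> oI a <> [set 0].
Proof.
move=> a0 I0; have : oI a (Om - a%:A) by apply: sub_ideal_gen.
rewrite I0 /= => e; have : horner_alg Om ('X - a%:P) = 0.
  by rewrite rmorphB /= horner_algX horner_algC.
by move/(hO_inj hR char_k)/eqP; rewrite polyXsubC_eq0.
Qed.
End Spectrum.

(** * Primitive ideals of rings *)

Definition left_ideal (R : pzRingType) (L : set R) : Prop :=
  [/\ L 0, forall a b, L a -> L b -> L (a + b) & forall r a, L a -> L (r * a)].

Section LeftQuotient.
Local Open Scope quotient_scope.
Variables (R : pzRingType) (L : set R).
Hypothesis hL : left_ideal L.

Definition left_pred : {pred R} := fun r => `[< L r >].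

Fact left_pred_zmod : zmod_closed left_pred.
Proof.
have [L0 LD LM] := hL; split; first exact/asboolP.
move=> a b /asboolP La /asboolP Lb; apply/asboolP/LD => //.
by rewrite -mulN1r; exact: LM.
Qed.

HB.instance Definition _ :=
  GRing.isZmodClosed.Build R left_pred left_pred_zmod.

Definition left_quot : Type := Quotient.quot left_pred.
HB.instance Definition _ := GRing.Zmodule.on left_quot.
HB.instance Definition _ := EqQuotient.on left_quot.

Definition to_left_quot (r : R) : left_quot := \pi_(Quotient.quot left_pred) r.

Lemma to_left_quot_eq a b : to_left_quot a = to_left_quot b <-> L (a - b).
Proof.
split=> [/eqP|Lab]; last apply/eqP.
  by rewrite -Quotient.idealrBE => /asboolP.
by rewrite -Quotient.idealrBE; apply/asboolP.
Qed.

Lemma repr_left_quotK (u : left_quot) : to_left_quot (repr u) = u.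
Proof. exact: reprK. Qed.

Lemma to_left_quot_is_zmod_morphism : zmod_morphism to_left_quot.
Proof. exact: (@pi_is_zmod_morphism R _ _ (Quotient.quot left_pred)). Qed.

HB.instance Definition _ :=
  GRing.isZmodMorphism.Build R left_quot to_left_quot
    to_left_quot_is_zmod_morphism.

Definition left_scale (r : R) (u : left_quot) := to_left_quot (r * repr u).

Lemma left_scaleE r a : left_scale r (to_left_quot a) = to_left_quot (r * a).
Proof.
have [_ _ LM] := hL; apply/to_left_quot_eq; rewrite -mulrBr; apply: LM.
by apply/to_left_quot_eq; rewrite repr_left_quotK.
Qed.

Fact left_scaleA a b u : left_scale a (left_scale b u) = left_scale (a * b) u.
Proof. by rewrite -[u]repr_left_quotK !left_scaleE mulrA. Qed.

Fact left_scale1 : left_id 1 left_scale.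
Proof. by move=> u; rewrite -[u]repr_left_quotK left_scaleE mul1r. Qed.

Fact left_scaleDr : right_distributive left_scale +%R.
Proof.
move=> r u v; rewrite -(repr_left_quotK u) -(repr_left_quotK v).
by rewrite -raddfD !left_scaleE mulrDr raddfD.
Qed.

Fact left_scaleDl u : {morph left_scale^~ u : a b / a + b}.
Proof.
by move=> a b; rewrite -(repr_left_quotK u) !left_scaleE mulrDl raddfD.
Qed.

HB.instance Definition _ := GRing.Zmodule_isLmodule.Build R left_quot
  left_scaleA left_scale1 left_scaleDr left_scaleDl.

Lemma left_quot_simple : ~ L 1 ->
  (forall L', left_ideal L' -> L `<=` L' -> ~ L' 1 -> L' `<=` L) ->
  exists M : lmodType R, simple_module M /\
    forall r, annihilator M r <-> forall a, L (r * a).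
Proof.
move=> L1 maxL; have [L0 _ _] := hL; exists left_quot.
have qE a : to_left_quot a = 0 <-> L a.
  rewrite -(raddf0 to_left_quot); split=> [/to_left_quot_eq|La].
    by rewrite subr0.
  by apply/to_left_quot_eq; rewrite subr0.
have sE r a : r *: to_left_quot a = to_left_quot (r * a) := left_scaleE r a.
split; last first.
  move=> r; split=> [rM a|rL m]; first by apply/qE; rewrite -sE; exact: rM.
  by rewrite -(repr_left_quotK m) sE; apply/qE.
split; first by exists (to_left_quot 1); apply/eqP => /qE.
move=> N [N0 ND NZ].
pose L' : set R := [set a | N (to_left_quot a)].
have hL' : left_ideal L'.
  split=> [|a b La Lb|r a La]; rewrite /L' /=; first by rewrite raddf0.
    by rewrite raddfD; exact: ND.
  by rewrite -sE; exact: NZ.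
have LL' : L `<=` L' by move=> a La; rewrite /L' /=; move/qE: La => ->.
have [L'1|nL'1] := pselect (L' 1).
  right; apply/seteqP; split=> // m _; rewrite -(repr_left_quotK m) -[repr m]mulr1.
  by rewrite -sE; exact: NZ.
left; apply/seteqP; split=> [m Nm|_ ->//].
rewrite /= -(repr_left_quotK m); apply/qE; apply: (maxL L') => //.
by rewrite /L' /= repr_left_quotK.
Qed.
End LeftQuotient.

Section Primitive.
Variable R : pzRingType.
Implicit Types (P L : set R).

Lemma maximal_left_ideal P : is_ideal P -> ~ P 1 ->
  exists L, [/\ left_ideal L, P `<=` L, ~ L 1 &
    forall L', left_ideal L' -> L `<=` L' -> ~ L' 1 -> L' `<=` L].
Proof.
move=> idP P1.
(* The empty set is admitted as the union of the empty chain. *)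
pose S : set (set R) := [set L | L = set0 \/ [/\ left_ideal L, P `<=` L & ~ L 1]].
have hP : left_ideal P.
  by split=> [|a b|r a]; [exact: ideal0|exact: idealD|exact: idealMl].
have [] := @Zorn_bigcup R S => [F FS totF|L [SL maxL]].
  have [[X [FX Xn0]]|no] := pselect (exists X, F X /\ X <> set0); last first.
    left; apply/seteqP; split=> // a [X FX Xa]; case: no; exists X; split=> //.
    by move=> X0; rewrite X0 in Xa.
  right; have [//|[[X0 _ _] PX _]] := FS X FX.
  split; last 2 first.
  - by move=> a Pa; exists X => //; exact: PX.
  - by move=> [Y FY Y1]; case: (FS Y FY) => [Y0|[_ _]//]; rewrite Y0 in Y1.
  split; first by exists X.
    move=> a b [Y FY Ya] [Z FZ Zb].
    wlog YZ : a b Y Z FY FZ Ya Zb / Y `<=` Z.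
      move=> w; have [YZ|ZY] := totF Y Z FY FZ; first exact: (w a b Y Z).
      by rewrite addrC; exact: (w b a Z Y).
    exists Z => //; case: (FS Z FZ) => [Z0|[[_ ZD _] _ _]]; first by rewrite Z0 in Zb.
    by apply: ZD => //; exact: YZ.
  move=> r a [Y FY Ya]; exists Y => //.
  by case: (FS Y FY) => [Y0|[[_ _ YM] _ _]]; [rewrite Y0 in Ya|exact: YM].
case: SL => [L0|[hL PL L1]].
  exfalso; apply: (maxL P); last by right; split.
  split; first by rewrite L0.
  by move/(_ 0 (ideal0 idP)); rewrite L0.
exists L; split=> // L' hL' LL' L'1; apply: contrapT => nsub.
apply: (maxL L'); first by split.
by right; split=> //; exact: subset_trans LL'.
Qed.

(** A maximal two-sided ideal is the annihilator of the quotient by a maximal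
left ideal that contains it. *)
Lemma maximal_primitive P : maximal_ideal P -> primitive_ideal P.
Proof.
move=> [idP PT maxP]; have P1 : ~ P 1 by exact/proper_ideal.
have [L [hL PL L1 maxL]] := maximal_left_ideal idP P1.
have [M [sM annM]] := left_quot_simple hL L1 maxL.
exists M; split=> //.
have idA : is_ideal (annihilator M).
  split=> [m|a b am bm m|r a am].
  - by rewrite scale0r.
  - by rewrite scalerBl am bm subr0.
  - by split=> m; rewrite -scalerA am ?scaler0.
have PA : P `<=` annihilator M.
  by move=> p Pp; apply/annM => a; apply: PL; exact: idealMr.
have [//|AT] := maxP _ idA PA.
by case: L1; have /annM/(_ 1) : annihilator M 1 by [rewrite AT|]; rewrite mulr1.
Qed.

Section Simple.
Variable M : lmodType R.
Hypothesis sM : simple_module M.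

Lemma simple_nonzero (N : set M) (m : M) : is_submodule N -> N m -> m <> 0 ->
  forall m', N m'.
Proof.
by move=> sN Nm m0 m'; case: (sM.2 N sN) => NE; move: Nm; rewrite NE // => /= /m0.
Qed.

Lemma simple_cyclic (m m' : M) : m <> 0 -> exists u, m' = u *: m.
Proof.
move=> m0; pose N : set M := [set v | exists u, v = u *: m].
apply: (@simple_nonzero N m) => //; last by exists 1; rewrite scale1r.
split; first by exists 0; rewrite scale0r.
  by move=> _ _ [a ->] [b ->]; exists (a + b); rewrite scalerDl.
by move=> r _ [a ->]; exists (r * a); rewrite scalerA.
Qed.

Lemma annihilator_ideal : is_ideal (annihilator M).
Proof.
split=> [m|a b am bm m|r a am].
- by rewrite scale0r.
- by rewrite scalerBl am bm subr0.
- by split=> m; rewrite -scalerA am ?scaler0.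
Qed.

Lemma annihilator_proper : ~ annihilator M 1.
Proof. by have [[m /eqP m0] _] := sM; move/(_ m); rewrite scale1r. Qed.
End Simple.

(** If [b m <> 0] for some [b] in [B], the vectors killed by [A] form a submodule
that contains [b m], hence the whole module. *)
Lemma primitive_prime P : primitive_ideal P -> prime_ideal P.
Proof.
move=> [M [sM ->]]; have idA := annihilator_ideal M.
split=> //; first exact/(proper_ideal idA)/annihilator_proper.
move=> A B idA' idB AB; have [|nB] := pselect (B `<=` annihilator M).
  by right.
left; have [b [m [Bb bm]]] : exists b (m : M), B b /\ b *: m <> 0.
  apply: contrapT => no; apply: nB => b Bb m; apply: contrapT => bm.
  by apply: no; exists b, m.
pose N : set M := [set v | forall a, A a -> a *: v = 0].
have sN : is_submodule N.
  split=> [a _|u v Nu Nv a Aa|r u Nu a Aa]; first by rewrite scaler0.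
    by rewrite scalerDr Nu // Nv // addr0.
  by rewrite scalerA; apply: Nu; exact: idealMr.
have Nbm : N (b *: m).
  move=> a Aa; rewrite scalerA; apply: (AB (a * b)).
  exists [:: (a, b)]; rewrite big_seq1; split=> // u.
  by rewrite inE => /eqP ->.
by move=> a Aa v; exact: (simple_nonzero sM sN Nbm bm v).
Qed.

(** If [u] does not kill [M], then [m = v u m] for some [v] and some nonzero [m];
the kernel of [1 - v u] is a submodule because [R/P] is commutative, so [1 - v u]
kills [M]. *)
Lemma primitive_comm_maximal P : primitive_ideal P ->
  (forall u v, P (u * v - v * u)) -> maximal_ideal P.
Proof.
move=> prP PC; have [idP PT _] := primitive_prime prP.
move: prP PC idP PT => [M [sM ->]] PC idP PT; split=> // I idI PI.
have [IP|nIP] := pselect (I `<=` annihilator M); first by left; apply/seteqP.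
right; have comm u v m : u *: (v *: m) = v *: (u *: m) :> M.
  by apply/eqP; rewrite -subr_eq0 !scalerA -scalerBl; apply/eqP; exact: PC.
have [u [m [Iu um]]] : exists u (m : M), I u /\ u *: m <> 0.
  apply: contrapT => no; apply: nIP => u Iu m; apply: contrapT => um.
  by apply: no; exists u, m.
have [v vm] := simple_cyclic sM m um.
apply: ideal1 => //; rewrite -(subrK (v * u) 1); apply: idealD => //; last exact: idealMl.
apply: PI; apply: (@simple_nonzero M sM [set w | (1 - v * u) *: w = 0] m).
- split=> [|a b /= a0 b0|r a /= a0]; first by rewrite /= scaler0.
    by rewrite scalerDr a0 b0 addr0.
  by rewrite comm a0 scaler0.
- by rewrite /= scalerBl scale1r -scalerA -vm subrr.
- by move=> m0; apply: um; rewrite m0 scaler0.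
Qed.
End Primitive.

(** * No simple module is faithful *)

Section PseudoDivision.
Variables (k : fieldType) (R : algType k) (g gi x y : R).
Hypothesis hR : is_bosonization g gi x y.
Variables (C : idomainType) (cC : {rmorphism C -> R}) (h : C).
Hypothesis cC_comm : forall c u, cC c * u = u * cC c.
Hypothesis cC_h : cC h = 2^-1 *: 1.

Local Notation evx := (evx x cC_comm).
Local Notation evxy := (evxy x y cC_comm).

(** Multiplying [p] by [y] on the left preserves its leading coefficient, so the
usual pseudo-division algorithm works for left division. *)
Lemma ore_pseudo_div (p q : {poly {poly C}}) : p != 0 ->
  exists (r : nat) (rem : {poly {poly C}}) (t : R), (size rem < size p)%N /\
    evxy (lead_coef p ^+ r *: q) = t * evxy p + evxy rem.
Proof.
move=> p0; have [n] := ubnP (size q); elim: n q => // n IH q le_q.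
have [lt_qp|le_pq] := ltnP (size q) (size p).
  by exists 0%N, q, 0; rewrite expr0 scale1r mul0r add0r.
set a := lead_coef p in IH *; pose j := (size q - size p)%N.
pose q' := a *: q - lead_coef q *: iter j (ymul h) p.
have sp0 : (0 < size p)%N by rewrite lt0n size_poly_eq0.
have lt_q' : (size q' < size q)%N.
  rewrite -[X in (_ < X)%N]prednK ?(leq_trans sp0) // ltnS.
  apply/leq_sizeP => i le_i; rewrite coefB !coefZ.
  have jE : ((size p).-1 + j = (size q).-1)%N.
    rewrite /j; move: sp0 le_pq; case: (size p) => // m _; case: (size q) => // l.
    by rewrite subSS ltnS; exact: subnKC.
  rewrite coef_iter_ymul jE //; case: eqP => [->|/eqP ne].
    by rewrite -[q`__]/(lead_coef q) mulrC subrr.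
  rewrite mulr0 subr0 nth_default ?mulr0 //.
  by move: le_i; rewrite leq_eqVlt eq_sym (negPf ne) /=; case: (size q).
have [|r [rem [t [lt_rem remE]]]] := IH q'.
  by rewrite (leq_trans lt_q').
exists r.+1, rem, (t + evx (a ^+ r * lead_coef q) * y ^+ j); split=> //.
have -> : a ^+ r.+1 *: q = a ^+ r *: q' + (a ^+ r * lead_coef q) *: iter j (ymul h) p.
  by rewrite /q' scalerBr !scalerA subrK exprSr.
rewrite raddfD /= remE evxyZ -(yn_evxy hR cC_comm cC_h) mulrA.
by rewrite mulrDl [LHS]addrAC.
Qed.

(** The counterpart of [evxy] with the coefficients on the right. *)
Definition evr (p : {poly {poly C}}) : R := \sum_(i < size p) y ^+ i * evx p`_i.

Lemma evrE n (p : {poly {poly C}}) : (size p <= n)%N ->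
  evr p = \sum_(i < n) y ^+ i * evx p`_i.
Proof.
move=> le; rewrite /evr (big_ord_widen _ (fun i => y ^+ i * evx p`_i) le).
rewrite big_mkcond; apply: eq_bigr => i _; case: ltnP => // le_i.
by rewrite nth_default // rmorph0 mulr0.
Qed.

Lemma evrB (p q : {poly {poly C}}) : evr (p - q) = evr p - evr q.
Proof.
pose n := maxn (size p) (size q).
rewrite (@evrE n) ?(@evrE n p) ?(@evrE n q) ?leq_maxl ?leq_maxr //.
  by rewrite -sumrB; apply: eq_bigr => i _; rewrite coefB rmorphB mulrBr.
by rewrite (leq_trans (size_polyD _ _)) ?size_polyN.
Qed.

Lemma evrMX (p : {poly {poly C}}) : evr (p * 'X) = y * evr p.
Proof.
rewrite (@evrE (size p).+1); last first.
  by have [->|p0] := eqVneq p 0; rewrite ?mul0r ?size_poly0 ?size_mulX.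
rewrite big_ord_recl coefMX rmorph0 mulr0 add0r /evr mulr_sumr.
by apply: eq_bigr => i _; rewrite coefMX /= mulrA -exprS.
Qed.

Lemma evrC a : evr a%:P = evx a.
Proof. by rewrite (@evrE 1) ?size_polyC_leq1 // big_ord1 coefC mul1r. Qed.

Lemma evrMy p : evr p * y = evr (p * 'X - map_poly (xder h) p).
Proof.
rewrite evrB evrMX (@evrE (size p) (map_poly _ _)) ?size_poly //.
rewrite /evr mulr_suml mulr_sumr -sumrB; apply: eq_bigr => i _.
rewrite coef_map_id0 ?xder0 // -[LHS]mulrA (mulrA y) -exprS exprSr.
rewrite -[y ^+ i * y * _]mulrA -mulrBr.
by rewrite (y_evx hR cC_comm cC_h) addrK.
Qed.

Lemma evxy_evr p : exists q, evxy p = evr q.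
Proof.
elim/poly_ind: p => [|p a [q IH]].
  by exists 0; rewrite raddf0 /evr size_poly0 big_ord0.
exists (q * 'X - map_poly (xder h) q - (- a)%:P).
by rewrite raddfD /= evxy_mulX IH evrMy evxyC [RHS]evrB evrC rmorphN opprK.
Qed.
End PseudoDivision.

Section Kashiwara.
Variables (k : fieldType) (R : algType k) (g gi x y : R).
Hypothesis hR : is_bosonization g gi x y.
Hypothesis char_k : [pchar k] =i pred0.
Variables (C : idomainType) (cC : {rmorphism C -> R}) (h : C).
Hypothesis cC_comm : forall c u, cC c * u = u * cC c.
Hypothesis cC_h : cC h = 2^-1 *: 1.
Variables (M : lmodType R) (a : {poly C}).

Local Notation evx := (evx x cC_comm).
Local Notation killed m := (evx a *: m = 0).

Hypothesis der_inj : forall m : M, killed m -> evx (xder h a) *: m = 0 -> m = 0.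

(** Combinations, of degree less than [n] in [y], of vectors killed by [a]. *)
Definition ydeg n (v : M) : Prop :=
  exists m : nat -> M, (forall i, killed (m i)) /\ v = \sum_(i < n) y ^+ i *: m i.

Let killed_evx b (m : M) : killed m -> killed (evx b *: m).
Proof. by move=> am; rewrite scalerA -rmorphM mulrC rmorphM -scalerA am scaler0. Qed.

Lemma ydeg0 n : ydeg n 0.
Proof.
exists (fun=> 0); split=> [i|]; first exact: scaler0.
by rewrite big1 // => i _; exact: scaler0.
Qed.

Lemma ydegD n v w : ydeg n v -> ydeg n w -> ydeg n (v + w).
Proof.
move=> [m [am ->]] [m' [am' ->]]; exists (fun i => m i + m' i); split=> [i|].
  by rewrite scalerDr am am' addr0.
by rewrite -big_split; apply: eq_bigr => i _; rewrite scalerDr.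
Qed.

Lemma ydegN n v : ydeg n v -> ydeg n (- v).
Proof.
move=> [m [am ->]]; exists (fun i => - m i); split=> [i|].
  by rewrite scalerN am oppr0.
by rewrite -sumrN; apply: eq_bigr => i _; rewrite scalerN.
Qed.

Lemma ydegB n v w : ydeg n v -> ydeg n w -> ydeg n (v - w).
Proof. by move=> dv dw; apply/ydegD/ydegN. Qed.

Lemma ydeg_sum n (r : seq nat) (F : nat -> M) :
  (forall i, i \in r -> ydeg n (F i)) -> ydeg n (\sum_(i <- r) F i).
Proof.
move=> dF; rewrite big_seq; elim/big_ind: _ => //; first exact: ydeg0.
exact: ydegD.
Qed.

Lemma ydeg_le n n' v : (n <= n')%N -> ydeg n v -> ydeg n' v.
Proof.
move=> le [m [am ->]]; exists (fun i => if (i < n)%N then m i else 0); split=> [i|].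
  by case: ifP => // _; exact: scaler0.
rewrite (big_ord_widen _ (fun i => y ^+ i *: m i) le) big_mkcond.
by apply: eq_bigr => i _; case: ifP => // _; rewrite scaler0.
Qed.

Lemma ydeg_y n v : ydeg n v -> ydeg n.+1 (y *: v).
Proof.
move=> [m [am ->]]; exists (fun i => if i is j.+1 then m j else 0).
split=> [[|i]|]; [exact: scaler0|exact: am|].
rewrite big_ord_recl scaler0 add0r scaler_sumr; apply: eq_bigr => i _.
by rewrite scalerA -exprS.
Qed.

Lemma ydeg_top n m : killed m -> ydeg n.+1 (y ^+ n *: m).
Proof.
move=> am; exists (fun i => if i == n then m else 0); split=> [i|].
  by case: ifP => // _; exact: scaler0.
rewrite big_ord_recr /= eqxx big1 ?add0r // => i _.
by rewrite ltn_eqF // scaler0.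
Qed.

Let evx_y b (v : M) : evx b *: (y *: v) = y *: (evx b *: v) - evx (xder h b) *: v.
Proof.
by apply/eqP; rewrite eq_sym subr_eq !scalerA -scalerDl (y_evx hR cC_comm cC_h).
Qed.

Lemma ydeg_evx_top n b m : killed m ->
  ydeg n (evx b *: (y ^+ n *: m) - y ^+ n *: (evx b *: m)).
Proof.
elim: n b => [|n IH] b am; first by rewrite !scale1r subrr; exact: ydeg0.
rewrite !exprS -!scalerA evx_y addrAC -scalerBr; apply: ydegB.
  exact/ydeg_y/IH.
rewrite -(subrK (y ^+ n *: (evx (xder h b) *: m)) (evx _ *: (y ^+ n *: m))).
apply: ydegD; first by apply: ydeg_le (IH _ am).
exact/ydeg_top/killed_evx.
Qed.

(** Each of the [n + 1] factors [y] contributes the same leading term to the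
commutator of [a] with [y^(n + 1)]. *)
Lemma ydeg_killed_top n m : killed m ->
  ydeg n (evx a *: (y ^+ n.+1 *: m) + (y ^+ n *: (evx (xder h a) *: m)) *+ n.+1).
Proof.
move=> am; elim: n => [|n IH].
  by rewrite expr1 evx_y am scaler0 add0r scale1r mulr1n addNr; exact: ydeg0.
set D := evx (xder h a) *: m in IH *.
have -> : evx a *: (y ^+ n.+2 *: m) + (y ^+ n.+1 *: D) *+ n.+2 =
    y *: (evx a *: (y ^+ n.+1 *: m) + (y ^+ n *: D) *+ n.+1) -
    (evx (xder h a) *: (y ^+ n.+1 *: m) - y ^+ n.+1 *: D).
  rewrite exprS -[in LHS]scalerA evx_y scalerDr -scalerMnr.
  by rewrite (scalerA y (y ^+ n)) -exprS opprB [_ *+ n.+2]mulrSr addrACA [- _ + _]addrC.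
apply: ydegB; first exact: ydeg_y.
exact: ydeg_evx_top.
Qed.

Lemma ydeg_killed n v : ydeg n.+1 v -> ydeg n (evx a *: v).
Proof.
move=> [m [am ->]]; rewrite scaler_sumr -(big_mkord xpredT (fun i => evx a *: (y ^+ i *: m i))).
apply: ydeg_sum => -[|i]; rewrite mem_index_iota => /andP[_ lt_i].
  by rewrite scale1r am; exact: ydeg0.
have lt_in : (i < n)%N := lt_i.
rewrite -(addrK ((y ^+ i *: (evx (xder h a) *: m i.+1)) *+ i.+1) (evx a *: _)).
apply: ydegB; first exact: ydeg_le (ltnW lt_in) (ydeg_killed_top i (am _)).
rewrite scalerMnr; apply: (ydeg_le lt_in); apply: ydeg_top.
by rewrite -scalerMnr killed_evx // mul0rn.
Qed.

(** The sum of the subspaces [y^i V], with [V] the kernel of [a], is direct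
(Kashiwara's lemma): multiplication by [a] lowers the degree in [y] and acts on
the leading term through the injective [xder a]. *)
Lemma ydeg_lead0 n m v : killed m -> ydeg n v -> y ^+ n *: m + v = 0 -> m = 0.
Proof.
elim: n m v => [|n IH] m v am dv mv.
  by move: mv; case: dv => m' [_ ->]; rewrite big_ord0 scale1r addr0.
set D := evx (xder h a) *: m.
have aD : killed D by exact: killed_evx.
have nD0 : D *+ n.+1 = 0.
  apply: (IH _ (- (evx a *: (y ^+ n.+1 *: m) + (y ^+ n *: D) *+ n.+1 + evx a *: v))).
  - by rewrite -scalerMnr aD mul0rn.
  - by apply/ydegN/ydegD; [exact: ydeg_killed_top|exact: ydeg_killed].
  by rewrite -scalerMnr addrAC -scalerDr mv scaler0 add0r subrr.
apply: (der_inj am); rewrite -/D.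
have nE : (n.+1%:R^-1 : k)%:A * n.+1%:R = 1 :> R.
  by rewrite mulr_algl -(scaler_nat n.+1 (1 : R)) scalerA mulVf ?natr_neq0 ?scale1r.
by rewrite -[D]scale1r -nE -scalerA scaler_nat nD0 scaler0.
Qed.

Lemma kashiwara n (m : nat -> M) : (forall i, killed (m i)) ->
  \sum_(i < n) y ^+ i *: m i = 0 -> forall i, (i < n)%N -> m i = 0.
Proof.
move=> am; elim: n => // n IH; rewrite big_ord_recr /= addrC => s0.
have mn0 : m n = 0 by apply: (ydeg_lead0 (am n) _ s0); exists m.
move=> i; rewrite ltnS leq_eqVlt => /orP[/eqP -> //|]; apply: IH.
by move: s0; rewrite mn0 scaler0 add0r.
Qed.
End Kashiwara.

Section NoFaithful.
Variables (k : closedFieldType) (R : algType k) (g gi x y : R).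
Hypothesis hR : is_bosonization g gi x y.
Hypothesis char_k : [pchar k] =i pred0.
Variable M : lmodType R.
Hypothesis sM : simple_module M.
Hypothesis faithful : forall u : R, (forall m : M, u *: m = 0) -> u = 0.

Local Notation Om := (x ^+ 2 * gi).
Local Notation s := (Om * x ^+ 2).
Local Notation hO := (horner_alg Om).
Local Notation hO_comm := (horner_Omega_comm hR char_k).
Local Notation evxO := (evx x hO_comm).
Local Notation evO := (evxy x y hO_comm).
Local Notation h := ((2^-1)%:P : {poly k}).
Local Notation sP := ('X%:P * 'X^2 : {poly {poly k}}).
Local Notation evb b := (map_poly (horner_eval b)).

Let half_Om : hO h = 2^-1 *: 1. Proof. exact: hO_half. Qed.

Let evxO_C c : evxO c%:P = hO c. Proof. exact: evxO_C. Qed.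

Let evxO_sP N : evxO (sP ^+ N) = s ^+ N.
Proof. by rewrite rmorphXn rmorphM rmorphXn /= evxX evxO_C horner_algX. Qed.

(** Kernels and images of central elements are submodules of the simple module, so
a central element that does not kill it acts bijectively. *)
Lemma central_inj c (m : M) : c != 0 -> hO c *: m = 0 -> m = 0.
Proof.
move=> c0 cm; apply: contrapT => m0.
move/eqP: c0; apply; apply: (hO_inj hR char_k); apply: faithful.
apply: (@simple_nonzero _ M sM [set v | hO c *: v = 0] m) => //.
split=> [|u v /= cu cv|r v /= cv]; first exact: scaler0.
  by rewrite scalerDr cu cv addr0.
by rewrite scalerA hO_comm -scalerA cv scaler0.
Qed.

Lemma central_surj c (m : M) : c != 0 -> exists m', m = hO c *: m'.
Proof.
move=> c0; have [[m0 /eqP m00] _] := sM.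
apply: (@simple_nonzero _ M sM [set v | exists m', v = hO c *: m'] (hO c *: m0)).
- split=> [|u v [u' ->] [v' ->]|r v [v' ->]]; first by exists 0; rewrite scaler0.
    by exists (u' + v'); rewrite scalerDr.
  by exists (r *: v'); rewrite !scalerA hO_comm.
- by exists m0.
- by move/(central_inj c0).
Qed.

Lemma x_inj (m : M) : x *: m = 0 -> m = 0.
Proof.
move=> xm; apply: (@central_inj 'X); first by rewrite polyX_eq0.
by rewrite horner_algX -(gi_x2 hR) expr2 -!scalerA xm !scaler0.
Qed.

(** Solving [m = (Omega - b) u m] in the cyclic module [R m] yields an
annihilator of [m] whose value at [Omega = b] is a power of [x]. *)
Lemma division_annihilator b (m : M) : m <> 0 ->
  exists N q, evO (('X - b%:P)%:P *: q - (sP ^+ N)%:P) *: m = 0.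
Proof.
move=> m0; have c0 : 'X - b%:P != 0 by rewrite polyXsubC_eq0.
have [m1 mE] := central_surj m c0; have [u m1E] := simple_cyclic sM m1 m0.
have [N [q uq]] := Omega_cover hR char_k u.
exists N, q; rewrite evxyB evxyZ evxyC evxO_C evxO_sP scalerBl -uq.
by rewrite mulrA hO_comm -2!scalerA -m1E -mE subrr.
Qed.

Lemma map_evb_sP (b : k) N : evb b (sP ^+ N) = (b%:P * 'X^2) ^+ N.
Proof. by rewrite rmorphXn rmorphM /= map_polyC map_polyXn /= /horner_eval hornerX. Qed.

Lemma map_evb_sP_neq0 (b : k) N : b != 0 -> evb b (sP ^+ N) != 0.
Proof.
by move=> b0; rewrite map_evb_sP expf_neq0 // mulf_neq0 ?polyC_eq0 ?expf_neq0 ?polyX_eq0.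
Qed.

Lemma map_evb_XsubC (b : k) : evb b (('X - b%:P)%:P : {poly {poly k}}) = 0.
Proof. by rewrite map_polyC /= /horner_eval hornerXsubC subrr. Qed.

(** Among the polynomials in [x] and [Omega] that kill some nonzero vector, let
[a] have least degree in [x]; then [xder a] is injective on the kernel of [a],
and by Kashiwara's lemma the relation of [division_annihilator] holds for each
coefficient in [y].  Hence [a] divides, up to powers of its leading coefficient,
a polynomial which at [Omega = b] is a power of [x]; this fails at a nonzero
root [r] of [a] at [Omega = b]. *)
Lemma no_torsion (a : {poly {poly k}}) (m : M) : a != 0 -> evxO a *: m = 0 -> m = 0.
Proof.
move=> a0 am; apply: contrapT => m0.
pose Q (a : {poly {poly k}}) := a != 0 /\ exists2 m : M, evxO a *: m = 0 & m <> 0.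
have exQ : exists a, Q a by exists a; split=> //; exists m.
have [{am m0 a0}a [[a0 [{}m am m0]] min_a]] := min_size exQ.
have small (b : {poly {poly k}}) (m' : M) : b != 0 -> (size b < size a)%N -> evxO b *: m' = 0 -> m' = 0.
  move=> b0 lt_b bm'; apply: contrapT => m'0.
  suff /min_a : Q b by rewrite leqNgt lt_b.
  by split=> //; exists m'.
have sz_a : (1 < size a)%N.
  rewrite ltnNge; apply/negP => /size1_polyC aE; apply: m0.
  apply: (@central_inj a`_0); last by rewrite -evxO_C -aE.
  by apply: contra_neq a0; rewrite {2}aE => ->.
have a00 : a`_0 != 0.
  apply/eqP => a00.
  have [b aE] : exists b, a = b * 'X.
    exists (drop_poly 1 a); rewrite -[LHS](poly_take_drop 1) expr1.
    by rewrite (size1_polyC (size_take_poly 1 a)) coef_take_poly a00 add0r.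
  have b0 : b != 0 by apply: contra_neq a0 => b0; rewrite aE b0 mul0r.
  apply: m0; apply: x_inj; apply: (small b) => //; first by rewrite aE size_mulX.
  by move: am; rewrite aE rmorphM /= evxX scalerA.
have da0 : a^`() != 0.
  apply: contraTneq sz_a => da0; rewrite -leqNgt.
  by rewrite (deriv_eq0 (char_poly0 char_k) da0) size_polyC_leq1.
have der_inj (m' : M) : evxO a *: m' = 0 -> evxO (xder h a) *: m' = 0 -> m' = 0.
  move=> _ dam; apply: (small _ _ da0 (lt_size_deriv a0)).
  do 2 apply: x_inj; rewrite !scalerA.
  have -> : x * x * evxO a^`() = - (2 *: evxO (xder h a)).
    rewrite rmorphN scalerN opprK !rmorphM /= !evxX evxO_C horner_algC.
    by rewrite -!scalerAl !mul1r scalerA mulfV ?scale1r ?(natr_neq0 char_k 1).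
  by rewrite scaleNr -mulr_algl -scalerA dam scaler0 oppr0.
have nz : 'X * lead_coef a * a`_0 != 0.
  by rewrite !mulf_neq0 ?polyX_eq0 ?lead_coef_eq0.
have [b] := nonroot char_k nz; rewrite !hornerM hornerX !mulf_eq0 !negb_or.
move=> /andP[/andP[b0 lb0] ab0].
have [N [q wm]] := division_annihilator b m0.
have [l lE] := evxy_evr hR hO_comm half_Om q.
pose c : {poly {poly k}} := ('X - b%:P)%:P; pose l' := c *: l - (sP ^+ N)%:P.
have l'm : evr x y hO_comm l' *: m = 0.
  have evr_c : evr x y hO_comm (c *: l) = evr x y hO_comm l * hO ('X - b%:P).
    rewrite (@evrE _ _ _ _ _ _ hO_comm (size l)) ?size_scale_leq // /evr mulr_suml.
    apply: eq_bigr => i _; rewrite coefZ rmorphM /= evxO_C hO_comm.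
    by rewrite -mulrA.
  by move: wm; rewrite evxyB evxyZ evxyC evxO_C hO_comm lE -evr_c evrB evrC.
have l'0m : evxO l'`_0 *: m = 0.
  have [lt0|le0] := ltnP 0%N (size l'); last by rewrite nth_default // rmorph0 scale0r.
  apply: (kashiwara hR char_k (h := h) half_Om der_inj (n := size l')
            (m := fun i => evxO l'`_i *: m)) => // [i|].
    by rewrite scalerA -rmorphM mulrC rmorphM -scalerA am scaler0.
  by rewrite -[RHS]l'm /evr scaler_suml; apply: eq_bigr => i _; rewrite scalerA.
have aE := Pdiv.Idomain.divp_eq l'`_0 a.
have rem0 : l'`_0 %% a = 0.
  apply: contrapT => /eqP remn0; apply: m0; apply: (small _ _ remn0).
    by rewrite ltn_modp.
  have := congr1 (fun p => evxO p *: m) aE.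
  rewrite -mul_polyC rmorphM /= -scalerA l'0m scaler0 rmorphD rmorphM /= scalerDl.
  by rewrite -scalerA am scaler0 add0r.
have szb : size (evb b a) = size a.
  by rewrite size_map_poly_id0 // /horner_eval.
have [r ra] : exists r, root (evb b a) r.
  by apply/closed_rootP; rewrite szb neq_ltn sz_a orbT.
have r0 : r != 0.
  apply: contraNneq ab0 => r0; move/rootP: ra; rewrite r0 horner_coef0 coef_map.
  by move/eqP.
have := congr1 (fun p => (evb b p).[r]) aE.
rewrite rem0 addr0 -mul_polyC !rmorphM /= !hornerM (rootP ra) mulr0.
rewrite coefB coefZ coefC eqxx rmorphB rmorphM /= map_evb_XsubC mul0r sub0r map_evb_sP.
rewrite map_polyC /= hornerC hornerN !(hornerM, horner_exp, hornerC, hornerX).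
move/eqP; rewrite mulf_eq0 oppr_eq0 /horner_eval horner_exp !expf_eq0 mulf_eq0.
by rewrite (negPf lb0) (negPf b0) mulf_eq0 (negPf r0) !andbF.
Qed.

(** Let [p] be an annihilator of [m] of least degree in [y].  Reducing modulo [p]
the relation of [division_annihilator] must give [0], so [Omega - b] divides a
power of [x^2 Omega] times the leading coefficient of [p]; this fails for all
but finitely many [b]. *)
Lemma faithful_absurd : False.
Proof.
have [[m /eqP m0] _] := sM.
pose Q (p : {poly {poly {poly k}}}) := p != 0 /\ evO p *: m = 0.
have exQ : exists p, Q p.
  have [N [q qm]] := division_annihilator 1 m0; exists (('X - 1%:P)%:P *: q - (sP ^+ N)%:P).
  split=> //; apply/eqP => /(congr1 (fun p : {poly {poly {poly k}}} => evb 1 p`_0)).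
  rewrite coefB coefZ coefC eqxx rmorphB rmorphM /= map_evb_XsubC mul0r sub0r.
  rewrite coef0 rmorph0 => /eqP; rewrite oppr_eq0.
  by rewrite (negPf (map_evb_sP_neq0 _ (oner_neq0 _))).
have [p [[p0 pm] min_p]] := min_size exQ.
have sz_p : (1 < size p)%N.
  rewrite ltnNge; apply/negP => /size1_polyC pE; apply: m0.
  apply: (@no_torsion p`_0); last by rewrite -(evxyC x y hO_comm) -pE.
  by apply: contra_neq p0; rewrite {2}pE => ->.
set a := lead_coef p; have a0 : a != 0 by rewrite lead_coef_eq0.
have nz : 'X * lead_coef a != 0 by rewrite mulf_neq0 ?polyX_eq0 ?lead_coef_eq0.
have [b] := nonroot char_k nz; rewrite hornerM hornerX mulf_eq0 negb_or.
move=> /andP[b0 lb0].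
have ab0 : evb b a != 0 by rewrite -size_poly_eq0 size_map_poly_id0 ?size_poly_eq0.
have [N [q qm]] := division_annihilator b m0.
have [r [rem [t [lt_rem remE]]]] := ore_pseudo_div hR hO_comm half_Om q p0.
pose w := ('X - b%:P)%:P *: rem - (a ^+ r * sP ^+ N)%:P.
have wm : evO w *: m = 0.
  have remm : evO (a ^+ r *: q) *: m = evO rem *: m.
    by rewrite remE scalerDl -scalerA pm scaler0 add0r.
  have qm' : evxO ('X - b%:P)%:P *: (evO q *: m) = evxO (sP ^+ N) *: m.
    apply/eqP; rewrite -subr_eq0 scalerA -scalerBl -evxyZ -(evxyC x y hO_comm).
    by rewrite -evxyB qm.
  have cA (c d : {poly {poly k}}) (v : M) :
      evxO c *: (evxO d *: v) = evxO d *: (evxO c *: v).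
    by rewrite !scalerA -!rmorphM mulrC.
  rewrite /w evxyB evxyZ evxyC (rmorphM evxO) scalerBl -!scalerA.
  by rewrite -remm evxyZ -scalerA cA qm' subrr.
have w0 : w = 0.
  apply/eqP; apply/negPn/negP => wn0.
  have := min_p w (conj wn0 wm); rewrite leqNgt; case/negP.
  apply: leq_ltn_trans (size_polyD _ _) _; rewrite size_polyN gtn_max.
  rewrite (leq_ltn_trans (size_scale_leq _ _)) //=.
  exact: leq_ltn_trans (size_polyC_leq1 _) sz_p.
have := congr1 (fun p : {poly {poly {poly k}}} => evb b p`_0) w0.
rewrite coefB coefZ coefC eqxx rmorphB rmorphM /= map_evb_XsubC mul0r sub0r.
rewrite coef0 rmorph0 rmorphM => /eqP; rewrite oppr_eq0 mulf_eq0.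
by rewrite rmorphXn expf_eq0 (negPf ab0) andbF (negPf (map_evb_sP_neq0 _ b0)).
Qed.
End NoFaithful.

(** * Primes, maximal ideals and inclusions *)

Section Conclusion.
Variables (k : closedFieldType) (R : algType k) (g gi x y : R).
Hypothesis hR : is_bosonization g gi x y.
Hypothesis char_k : [pchar k] =i pred0.
Variable pr : {rmorphism R -> kgy k}.
Hypothesis pr_gen :
  [/\ pr g = kgy_g k, pr gi = kgy_gi k, pr x = 0 & pr y = kgy_y k].
Hypothesis prZ : forall c u, pr (c *: u) = kgy_const c * pr u.

Local Notation Om := (x ^+ 2 * gi).
Local Notation oI a := (ideal_gen [set Om - a%:A]).
Local Notation Z := (ideal_gen [set (0 : R)]).
Local Notation xI := (ideal_gen [set x]).
Local Notation xgyI b c := (ideal_gen [set x; g - b%:A; y - c%:A]).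
Local Notation num := (@kgyp k : {rmorphism {poly {poly k}} -> kgy k}).

Let num_inj : injective num := @kgyp_inj k.
Let num_gi : num 'X%:P * kgy_gi k = 1. Proof. by rewrite /= kgyp_g kgy_gK. Qed.
Let num_cover f : exists n p, num 'X%:P ^+ n * f = num p.
Proof. by have [n [p fp]] := kgy_cover f; exists n, p; rewrite /= kgyp_g. Qed.
Let num_gen :
  [/\ pr g = num 'X%:P, pr gi = kgy_gi k, pr x = 0 & pr y = num 'X].
Proof. by rewrite /= kgyp_g kgypX. Qed.
Let numZ c u : pr (c *: u) = num c%:P%:P * pr u.
Proof. by rewrite prZ /= kgyp_cst. Qed.

Let surj := pr_surj num_gi num_cover num_gen numZ.

Lemma x_ideal_preim : xI = pr @^-1` [set 0].
Proof. exact: (x_idealE hR num_inj num_gen numZ). Qed.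

Lemma xgy_ideal_preim b c : xgyI b c = pr @^-1` gy_ideal b c.
Proof.
rewrite (xgy_idealE hR num_inj num_gi num_cover num_gen numZ) /=.
by rewrite kgyp_g kgypX !kgyp_cst.
Qed.

Lemma preimS (p q : set (kgy k)) : pr @^-1` p `<=` pr @^-1` q <-> p `<=` q.
Proof. exact: (preim_subset num_gi num_cover num_gen numZ). Qed.

Lemma preimP (p q : set (kgy k)) : pr @^-1` p `<` pr @^-1` q <-> p `<` q.
Proof. by rewrite /proper !preimS. Qed.

Lemma classification (P : set R) : prime_ideal P ->
  [\/ P = [set 0], exists a : k, a != 0 /\ P = oI a
    | exists p, prime_ideal p /\ P = pr @^-1` p].
Proof. exact: (prime_classification char_k hR num_inj num_gi num_cover num_gen numZ). Qed.

Let zero_prime : prime_ideal [set (0 : R)].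
Proof. exact/no_zero_div_prime/(zero_no_zero_div_R char_k hR). Qed.

Lemma spec_bosonization : Spec R = [set Z]
  `|` [set P | exists a : k, a != 0 /\ P = oI a]
  `|` [set P | exists p : set (kgy k), Spec (kgy k) p /\ P = pr @^-1` p].
Proof.
rewrite zero_genE; apply/seteqP; split=> P.
  case/classification => [->|aP|pP]; [left; left|left; right|right] => //.
case=> [[->|[a [a0 ->]]]|[p [prp ->]]].
- exact: zero_prime.
- exact/no_zero_div_prime/(Omega_ideal_no_zero_div char_k hR).
- exact/no_zero_div_prime/preim_no_zero_div.
Qed.

Lemma prime_bosonization (P : set R) : prime_ideal P -> no_zero_div P.
Proof. exact: (prime_no_zero_div char_k hR num_inj num_gi num_cover num_gen numZ). Qed.

Lemma preim_x (p : set (kgy k)) : is_ideal p -> (pr @^-1` p) x.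
Proof. by case: pr_gen => _ _ prx _ idp; rewrite /= prx; exact: ideal0. Qed.

Lemma Omega_ideal_above (a : k) P : a != 0 -> prime_ideal P -> ~ oI a `<` P.
Proof.
move=> a0 [idP PT _] [sub nsub]; have [_ _ max] := Omega_ideal_max char_k hR a0.
by have [PE|//] := max P idP sub; apply: nsub; rewrite PE.
Qed.

Lemma Omega_ideal_below (a : k) P : a != 0 -> prime_ideal P ->
  P `<` oI a <-> P = Z.
Proof.
move=> a0 prP; rewrite zero_genE; have idI : is_ideal (oI a) := ideal_gen_ideal _.
split=> [PO|->].
  case: (classification prP) => [//|[b [b0 PE]]|[p [prp PE]]].
    case: (Omega_ideal_above b0 (no_zero_div_prime (Omega_ideal_no_zero_div char_k hR a0))).
    by rewrite -PE.
  case: (x_notin_Omega_ideal char_k hR a0); apply: PO.1; rewrite PE.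
  by apply: preim_x; case: prp.
split=> [_ ->|sub]; first exact: ideal0.
apply: (Omega_ideal_neq0 char_k hR a0); apply/seteqP; split=> // _ ->.
exact: ideal0.
Qed.

Lemma x_ideal_below (p : set (kgy k)) : has_height p 1 -> xI `<` pr @^-1` p.
Proof.
move=> /height1_nonzero[[idp _ _] [u pu u0]]; rewrite x_ideal_preim.
apply/preimP; split=> [_ ->|sub]; first exact: ideal0.
by apply: u0; exact: sub.
Qed.

(** The ideal [(y - c)], as the kernel of evaluation at [y = c]. *)
Lemma y_ideal_height1 (c : k) : exists2 p : set (kgy k), has_height p 1 &
  forall b, b != 0 -> p `<` gy_ideal b c.
Proof.
pose p : set (kgy k) := [set f | (f : {poly laurent k}).[laurent_of_poly c%:P] = 0].
have pM f f' : (f * f' : {poly laurent k}).[laurent_of_poly c%:P] =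
    (f : {poly laurent k}).[laurent_of_poly c%:P] * f'.[laurent_of_poly c%:P].
  exact: hornerM.
have p_prime : prime_ideal p.
  apply: no_zero_div_prime; split; first split=> [|u v pu pv|r u pu].
  - exact: horner0.
  - by rewrite /p /= hornerD hornerN pu pv subrr.
  - by split; rewrite /p /=; apply: etrans (pM _ _) _; rewrite pu ?mulr0 ?mul0r.
  - move=> p1; have /eqP : (1 : laurent k) = 0 by rewrite -p1; apply/esym; exact: hornerC.
    by rewrite oner_eq0.
  move=> u v; rewrite /p /= => puv; have {}puv := etrans (esym (pM u v)) puv.
  have /eqP := congr1 (@laurent_val k) puv; rewrite /= mulf_eq0.
  by case/orP => /eqP z; [left|right]; exact: val_inj.
have p_gb b : ~ p (kgy_g k - kgy_const b).
  have e : ((laurentX k)%:P - (laurent_of_poly b%:P)%:P).[laurent_of_poly c%:P] =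
      laurent_of_poly ('X - b%:P).
    rewrite hornerD hornerN.
    apply: etrans (congr2 (fun u v => u - v) (hornerC _ _) (hornerC _ _)) _.
    exact: esym (rmorphB (@laurent_of_poly k) 'X b%:P).
  move=> pb; have : laurent_of_poly ('X - b%:P) = laurent_of_poly 0.
    by rewrite rmorph0; apply: etrans (esym e) pb.
  by move/laurent_of_poly_inj/eqP; rewrite polyXsubC_eq0.
have sub b : b != 0 -> p `<=` gy_ideal b c.
  move=> b0 f pf; have [n [q fq]] := kgy_cover f; apply/gy_idealE => //.
  exists n, q; split=> //; suff -> : q.[c%:P] = 0 by rewrite horner0.
  apply: laurent_of_poly_inj; rewrite rmorph0 -horner_map.
  pose ev (u : {poly laurent k}) := u.[laurent_of_poly c%:P].
  apply: etrans (congr1 ev (esym fq)) _; apply: etrans (pM _ _) _.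
  by apply: etrans (congr1 _ pf) _; rewrite mulr0.
exists p; last first.
  move=> b b0; split; first exact: sub.
  by move=> gyp; apply: (p_gb b); apply: gyp; apply: sub_ideal_gen; left.
apply: not_gy_height1 => //; last first.
  move=> [b [c' [_ pE]]]; apply: (p_gb b); rewrite pE.
  by apply: sub_ideal_gen; left.
exists (kgy_y k - kgy_const c).
  have e : ('X - (laurent_of_poly c%:P)%:P).[laurent_of_poly c%:P] = 0.
    by rewrite hornerXsubC subrr.
  exact: e.
move/eqP; have := polyXsubC_eq0 (laurent_of_poly c%:P) => e.
by move=> z; have := etrans (esym e) z.
Qed.

Lemma gy_ideal_not_below (p : set (kgy k)) b c : b != 0 -> prime_ideal p ->
  ~ gy_ideal b c `<` p.
Proof.
move=> b0 [idp pT _] [sub nsub]; have [_ _ max] := gy_ideal_maximal c b0.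
by have [pE|//] := max p idp sub; apply: nsub; rewrite pE.
Qed.

(** Above [x] the primes are those of [k[g^+-1, y]], whose nonzero primes are of
height one or maximal.  The inclusion of [x] in a maximal ideal factors through
the ideal [(x, y - c)]. *)
Lemma inclusions (basic : set R -> set R -> Prop) :
  (forall P, prime_ideal P -> P <> Z -> basic Z P) ->
  (forall p, has_height p 1 -> basic xI (pr @^-1` p)) ->
  (forall p b c, has_height p 1 -> b != 0 -> p `<` gy_ideal b c ->
     basic (pr @^-1` p) (xgyI b c)) ->
  forall P Q, prime_ideal P -> prime_ideal Q -> P `<` Q -> clos_trans _ basic P Q.
Proof.
move=> basic0 basicx basicxp P Q prP prQ PQ.
have idQ : is_ideal Q by case: prQ.
case: (classification prP) => [PE|[a [a0 PE]]|[p [prp PE]]].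
- apply: t_step; rewrite PE -zero_genE; apply: basic0 => // QE.
  by case: PQ => _; rewrite QE PE zero_genE; apply.
- by case: (Omega_ideal_above a0 prQ); rewrite -PE.
have idp : is_ideal p by case: prp.
have Qx : Q x by apply: PQ.1; rewrite PE; exact: preim_x.
have [q [prq QE]] : exists q, prime_ideal q /\ Q = pr @^-1` q.
  case: (classification prQ) => [Q0|[a [a0 Qa]]|//].
    case: PQ => _ []; rewrite Q0 => _ ->; case: prP => idP _ _; exact: ideal0.
  by case: (x_notin_Omega_ideal char_k hR a0); rewrite -Qa.
have pq : p `<` q by apply/preimP; rewrite -PE -QE.
have [pn0|p0] := pselect (exists2 u, p u & u <> 0).
  have [b [c [b0 qE]]] := prime_chain_gy prp prq pn0 pq.
  apply: t_step; rewrite PE QE qE -xgy_ideal_preim; apply: basicxp => //.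
    apply: not_gy_height1 => // -[b' [c' [b'0 pE]]].
    by apply: (gy_ideal_not_below b'0 prq (c := c')); rewrite -pE.
  by rewrite -qE.
have PxI : P = xI.
  rewrite PE x_ideal_preim; congr (_ @^-1` _); apply/seteqP; split=> [u pu|_ ->].
    by apply: contrapT => u0; apply: p0; exists u.
  exact: ideal0.
have qn0 : exists2 u, q u & u <> 0.
  apply: contrapT => q0; case: pq => _; apply=> u qu.
  have [->|u0] := pselect (u = 0); first exact: ideal0.
  by case: q0; exists u.
have [[b [c [b0 qE]]]|ngy] := pselect (exists b c, b != 0 /\ q = gy_ideal b c).
  have [p1 p1h sub] := y_ideal_height1 c.
  apply: (@t_trans _ _ _ (pr @^-1` p1)); apply: t_step; first by rewrite PxI; exact: basicx.
  by rewrite QE qE -xgy_ideal_preim; apply: basicxp => //; exact: sub.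
by apply: t_step; rewrite PxI QE; apply: basicx; exact: not_gy_height1.
Qed.

Lemma xgy_maximal b c : b != 0 -> maximal_ideal (xgyI b c).
Proof.
move=> b0; have [idI nT max] := gy_ideal_maximal c b0; rewrite xgy_ideal_preim.
have idJ : is_ideal (pr @^-1` gy_ideal b c) by exact: preim_ideal.
split=> // [T|I idI' sub].
  by apply: nT; apply/seteqP; split=> // u _; have [v <-] := surj u; have : (pr @^-1` gy_ideal b c) v by rewrite T.
have Ix : I x by apply: sub; exact: preim_x.
have IE := preim_image hR num_inj num_gen numZ idI' Ix.
have idim : is_ideal (pr @` I) by apply: (image_ideal num_gi num_cover num_gen numZ).
have [||E] := max (pr @` I) idim.
- by apply/preimS; rewrite -IE.
- by move=> E; left; rewrite IE E.
- by right; rewrite IE E.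
Qed.

Lemma maximal_classification (P : set R) : maximal_ideal P ->
  (exists a : k, a != 0 /\ P = oI a) \/ (exists b c : k, b != 0 /\ P = xgyI b c).
Proof.
move=> maxP; have [idP PT max] := maxP.
case: (classification (maximal_prime maxP)) => [PE|aP|[p [prp PE]]]; last first.
- right; have [b [c [b0 sub]]] := prime_in_gy char_k prp; exists b, c; split=> //.
  have subJ : P `<=` xgyI b c by rewrite PE xgy_ideal_preim; apply/preimS.
  have [-> //|xT] := max (xgyI b c) (ideal_gen_ideal _) subJ.
  by have [_ []] := xgy_maximal c b0.
- by left.
have sub : P `<=` oI 1.
  by rewrite PE => _ ->; exact: (ideal0 (ideal_gen_ideal _)).
have [_ nT _] := Omega_ideal_max char_k hR (oner_neq0 k).
have [E|//] := max (oI 1) (ideal_gen_ideal _) sub.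
by case: (Omega_ideal_neq0 char_k hR (oner_neq0 k)); rewrite E.
Qed.

Lemma max_bosonization : Max R = [set P | exists a : k, a != 0 /\ P = oI a]
  `|` [set P | exists b c : k, b != 0 /\ P = xgyI b c].
Proof.
apply/seteqP; split=> [P|P [[a [a0 ->]]|[b [c [b0 ->]]]]].
- exact: maximal_classification.
- exact: (Omega_ideal_max char_k hR).
- exact: xgy_maximal.
Qed.

Lemma prim_bosonization : Prim R = Max R.
Proof.
apply/seteqP; split=> P; last exact: maximal_primitive.
move=> primP; have prP := primitive_prime primP; have idP : is_ideal P by case: prP.
case: (classification prP) => [PE|[a [a0 ->]]|[p [prp PE]]].
- have [M [sM PM]] := primP; case: (@faithful_absurd k R g gi x y hR char_k M sM).
  move=> u uM; have : annihilator M u by exact: uM.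
  by rewrite -PM PE.
- exact: (Omega_ideal_max char_k hR).
have Px : P x by rewrite PE; apply: preim_x; case: prp.
apply: (primitive_comm_maximal primP) => u v.
apply: (ideal_gen1 idP Px); exact: (comm_in_x hR num_inj num_gen numZ).
Qed.

Lemma ideal_meets_center_bosonization (I : set R) : is_ideal I -> I <> Z ->
  exists z, [/\ I z, center R z & z != 0].
Proof.
move=> idI I0; have [u [Iu u0]] : exists u, I u /\ u <> 0.
  apply: contrapT => no; apply: I0; rewrite zero_genE; apply/seteqP.
  split=> [u Iu|_ ->]; last exact: ideal0.
  by apply: contrapT => u0; apply: no; exists u.
have [c c0 Ic] := ideal_meets_center hR char_k idI Iu u0.
exists (horner_alg Om c); split=> //; first exact: (horner_Omega_comm hR char_k c).
by apply: contra_neq c0; exact: (hO_inj hR char_k).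
Qed.
End Conclusion.


Theorem theorem3p2 (k : closedFieldType) (char_k : [pchar k] =i pred0) :
  center (J k) (Omega k) /\
  (Spec (J k) =
     [set zero_ideal k]
     `|` [set P | exists a : k, a != 0 /\ P = Omega_ideal a]
     `|` [set P | exists p : set (kgy k), Spec (kgy k) p /\ P = xp_ideal p] /\
   [/\ forall P, Spec (J k) P -> zero_ideal k `<=` P,
       forall a : k, a != 0 ->
         (forall P, Spec (J k) P -> (P `<` Omega_ideal a <-> P = zero_ideal k))
         /\ (forall P, Spec (J k) P -> ~ (Omega_ideal a `<` P)),
       forall p : set (kgy k), has_height p 1 -> x_ideal k `<` xp_ideal p,
       forall (p : set (kgy k)) (b c : k), has_height p 1 -> b != 0 ->
         (xp_ideal p `<` xgy_ideal b c <-> p `<` gy_ideal b c)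
     & forall P Q, Spec (J k) P -> Spec (J k) Q -> P `<` Q ->
         clos_trans (set (J k)) (@basic_inclusion k) P Q]) /\
  (Prim (J k) = Max (J k) /\
   Max (J k) =
     [set P | exists a : k, a != 0 /\ P = Omega_ideal a]
     `|` [set P | exists b c : k, b != 0 /\ P = xgy_ideal b c]) /\
  (forall P, Spec (J k) P -> completely_prime P) /\
  (forall I : set (J k), is_ideal I -> I <> zero_ideal k ->
     exists z : J k, [/\ I z, center (J k) z & z != 0]).
Proof.
have hJ := J_is_bosonization k.
have gen : [/\ Jproj (Jg k) = kgy_g k, Jproj (Jgi k) = kgy_gi k,
    Jproj (Jx k) = 0 & Jproj (Jy k) = kgy_y k].
  by split; exact: Jproj_gen.
have prZ := @JprojZ k.
split; first exact: (Omega_comm hJ char_k).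
split; first split.
- exact: (spec_bosonization hJ char_k gen prZ).
- split.
  + move=> P [idP _ _]; exact: (ideal_gen1 idP (ideal0 idP)).
  + move=> a a0; split=> P prP.
      exact: (Omega_ideal_below hJ char_k gen prZ a0 prP).
    exact: (Omega_ideal_above hJ char_k a0 prP).
  + move=> p p1; exact: (x_ideal_below hJ gen prZ p1).
  + move=> p b c _ _.
    have xgyE : xgy_ideal b c = xp_ideal (gy_ideal b c).
      exact: (xgy_ideal_preim hJ gen prZ).
    rewrite xgyE; exact: (preimP gen prZ).
  + apply: (inclusions hJ char_k gen prZ).
    * exact: zero_inclusion.
    * exact: x_inclusion.
    * exact: xp_inclusion.
split; first split.
- exact: (prim_bosonization hJ char_k gen prZ).
- exact: (max_bosonization hJ char_k gen prZ).
split.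
  move=> P prP; apply: no_zero_div_completely_prime.
  exact: (prime_bosonization hJ char_k gen prZ prP).
exact: (ideal_meets_center_bosonization hJ char_k).
Qed.
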